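(* Let $\mu$ be a probability measure on $[0,\infty)$ satisfying the following assumption: there exists an open interval $I\subset(0,\infty)$ with $1\in I$ such that the limit $F_\mu(x):=\lim_{y\downarrow0}F_\mu(x+\mathrm{i}y)\in\mathbb{C}^+\cup\mathbb{R}$ exists for each $x\in I$, and the map $F_\mu\colon I\to\mathbb{C}^+\cup\mathbb{R}$ is continuous at $1$. Assume also that for some $\alpha\in(0,1)$, $\rho\in[0,1]$ and $r>0$, $$F_\mu(x)=r e^{\mathrm{i}\alpha\rho\pi}(x-1+\mathrm{i}0)^{1-\alpha}+o(|x-1|^{1-\alpha})\quad\text{as }x\to1 .$$ Then, as $t\downarrow0$, the Lebesgue densities (existing on the compact set in question for all sufficiently small $t$) satisfy $$\frac{d(\mu^{\langle t\rangle})^{t^{-1/\alpha}}}{dx}\longrightarrow\frac{r\sin(\alpha\rho\pi)}{\pi x}\cdot\frac{(\log x)^{\alpha-1}}{(\log x)^{2\alpha}+2r\cos(\alpha\rho\pi)(\log x)^\alpha+r^2}$$ uniformly on each compact subset of $(1,\infty)$, and $$\frac{d(\mu^{\langle t\rangle})^{t^{-1/\alpha}}}{dx}\longrightarrow\frac{r\sin(\alpha(1-\rho)\pi)}{\pi x}\cdot\frac{(-\log x)^{\alpha-1}}{(-\log x)^{2\alpha}+2r\cos(\alpha(1-\rho)\pi)(-\log x)^\alpha+r^2}$$ uniformly on each compact subset of $(0,1)$, where $\mu^{\langle t\rangle}$ is the multiplicative Boolean convolution power. In particular, $(\mu^{\langle t\rangle})^{t^{-1/\alpha}}$ converges weakly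 to the law of $e^{\mathbf{B}_{\alpha,\rho,r}}$, where $\mathbf{B}_{\alpha,\rho,r}$ is a random variable with the Boolean stable law $\mathbf{b}_{\alpha,\rho,r}$.
   Context: $\mathbb{C}^+$ is the open upper half-plane. $G_\mu(z)=\int\frac{\mu(dx)}{z-x}$, $F_\mu=1/G_\mu$, $\eta_\mu(z)=1-zF_\mu(1/z)$. For a probability measure $\mu$ on $[0,\infty)$ and $0\le t\le1$, the multiplicative Boolean convolution power $\mu^{\langle t\rangle}$ is the probability measure on $[0,\infty)$ (it exists, by a theorem of Bercovici) determined by $$\frac{\eta_{\mu^{\langle t\rangle}}(z)}{z}=\left(\frac{\eta_\mu(z)}{z}\right)^t,\qquad z\in(-\infty,0).$$ For $p\ge0$ and $\nu$ on $[0,\infty)$, $\nu^p$ is the push-forward of $\nu$ by $x\mapsto x^p$. The expression $(x-1+\mathrm{i}0)^{1-\alpha}$ equals $(x-1)^{1-\alpha}$ for $x>1$ and $e^{\mathrm{i}\pi(1-\alpha)}(1-x)^{1-\alpha}$ for $x<1$. The Boolean stable law $\mathbf{b}_{\alpha,\rho,r}$ is the probability measure on $\mathbb{R}$ with $F_{\mathbf{b}_{\alpha,\rho,r}}(z)=z+re^{\mathrm{i}\alpha\rho\pi}z^{1-\alpha}$ for $z\in\mathbb{C}^+$ (principal branch). *)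

(* Defs.v *)
From HB Require Import structures.
From mathcomp Require Import all_boot all_order all_algebra.
From mathcomp Require Import complex.
From mathcomp Require Import all_classical all_reals all_analysis.
From mathcomp Require Import measurable_realfun.

Set Implicit Arguments.
Unset Strict Implicit.
Unset Printing Implicit Defensive.

Import Order.TTheory GRing.Theory Num.Theory.
Import numFieldNormedType.Exports.

Local Open Scope classical_set_scope.
Local Open Scope ring_scope.
Local Open Scope complex_scope.

(* R[i] gets the topology of its modulus, so that limits, continuity and Landau
   notations are available for functions with values in R[i]. *)
HB.instance Definition _ (R : rcfType) := NormedModule.copy R[i] R[i]^o.

Section ComplexFunctions.
Context {R : realType}.
Implicit Types z : R[i].

(* real-valued modulus; the norm `|z| of R[i] is R[i]-valued *)
Definition cmod z : R := ComplexField.Normc.normc z.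

Definition cexpi (theta : R) : R[i] := cos theta +i* sin theta.

(* principal argument, in ]-pi, pi] for z != 0 *)
Definition carg z : R :=
  let theta := acos (complex.Re z / cmod z) in
  if 0 <= complex.Im z then theta else - theta.

(* principal branch of the power z ^ s with a real exponent s *)
Definition cpow z (s : R) : R[i] := (cmod z `^ s)%:C * cexpi (s * carg z).

(* boundary value (w + i0) ^ s of the principal branch at a real point w *)
Definition cpow_i0 (w s : R) : R[i] :=
  if 0 <= w then (w `^ s)%:C else cexpi (pi * s) * ((- w) `^ s)%:C.

End ComplexFunctions.

Section Transforms.
Context {R : realType}.
Implicit Types (mu : probability R R) (z : R[i]).

(* the integrals are those of the real and imaginary parts of 1 / (z - x) *)
Definition G_transform mu z : R[i] :=
  (\int[mu]_x complex.Re ((z - x%:C)^-1))%R +i*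
  (\int[mu]_x complex.Im ((z - x%:C)^-1))%R.

Definition F_transform mu z : R[i] := (G_transform mu z)^-1.

Definition eta_transform mu z : R[i] := 1 - z * F_transform mu (z^-1).

(* F_mu (x + i0); meaningful only when the limit exists *)
Definition F_boundary mu (x : R) : R[i] :=
  lim (F_transform mu (x +i* y) @[y --> 0^'+]).

End Transforms.

Section Laws.
Context {R : realType}.
Implicit Types (mu nu b : probability R R) (t p : R).

Definition on_nonneg mu := mu `[0, +oo[%classic = 1%E.

(* nu is the multiplicative Boolean convolution power mu^<t>; both sides of the
   equation are nonnegative reals, seen in R[i] *)
Definition is_mult_boolean_power mu t nu :=
  on_nonneg nu /\
  forall z : R, z < 0 ->
    eta_transform nu z%:C / z%:C = cpow (eta_transform mu z%:C / z%:C) t.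

Definition is_boolean_stable (alpha rho r : R) b :=
  forall z : R[i], 0 < complex.Im z ->
    F_transform b z =
    z + r%:C * cexpi (alpha * rho * pi) * cpow z (1 - alpha).

Definition rpow p (x : R) : R := x `^ p.

HB.instance Definition _ p :=
  isMeasurableFun.Build _ _ _ _ (rpow p) (measurable_powR p).

Definition power_law nu p : probability R R := distribution nu (rpow p).

(* on D, the measure m is absolutely continuous with Lebesgue density f *)
Definition is_density_on (m : set R -> \bar R) (D : set R) (f : R -> R) :=
  [/\ measurable_fun D f,
      (forall x, D x -> 0 <= f x) &
      forall A : set R, measurable A -> A `<=` D ->
        m A = (\int[lebesgue_measure]_(x in A) (f x)%:E)%E].

Definition weakly_cvg {T : Type} (F : set_system T)
    (m_ : T -> probability R R) (m : probability R R) :=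
  forall h : R -> R, continuous h -> bounded_fun h ->
    (\int[m_ t]_x h x)%R @[t --> F] --> (\int[m]_x h x)%R.

End Laws.

(* Main.v *)
(* Put K(z) = z - F_mu(z). The defining relation of nu = mu^<t> says that z - F_nu(z) = K(z)^t on
   the negative half-line. Both K and G_nu extend to the upper half-plane, where K avoids
   ]-oo, 0], so by the identity theorem the relation holds there with the principal power. The
   identity theorem is deduced from the maximum principle on rectangles, after the change of
   variable z = - exp (- w) and multiplication by a Gaussian.

   Letting z tend to a real point x close to 1, - Im G_nu(x + iy) tends to
   - Im 1 / (x - (x - F_mu(x))^t), which is pi times the density of nu by Stieltjes inversion.
   For x = v^s and t = s^alpha, one has x - 1 ~ s log v and
   t F_mu(x) ~ s c (log v + i0)^(1 - alpha) with c = r exp(i alpha rho pi), so that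
   (x - (x - F_mu(x))^t) / s tends to
   log v + c (log v + i0)^(1 - alpha), jointly in (t, v); compactness turns joint limits into
   uniform ones. The limit is the boundary value at log v of the F-transform of the Boolean stable
   law b, so it determines the density of the image of b under exp. Since b has no atom at 0,
   these densities carry the whole mass, and locally uniform convergence of densities implies
   weak convergence. *)
Require Import Defs.
From HB Require Import structures.
From mathcomp Require Import all_boot all_order all_algebra.
From mathcomp Require Import complex.
From mathcomp Require Import all_classical all_reals all_analysis.
From mathcomp Require Import measurable_realfun ring lra.
Import Order.TTheory GRing.Theory Num.Theory.
Import numFieldNormedType.Exports.
Set Implicit Arguments.
Unset Strict Implicit.
Unset Printing Implicit Defensive.
Local Open Scope classical_set_scope.
Local Open Scope ring_scope.
Local Open Scope complex_scope.

(** The relation defining mu^<t> is given only on a piece of the boundary of the half-plane where it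
    is needed. Hence the domain [upper_slit], on which both sides have complex Taylor expansions up
    to and including that piece, so that a maximum principle can use the values there.

    Stieltjes inversion needs dominated convergence, whereas the boundary values converge only
    pointwise in x. The pointwise limits bound the mass of small balls by a multiple of the radius;
    covering an interval by such balls bounds its mass by a multiple of its length; comparing
    Poisson integrals at heights y and 2 y then gives a bound uniform in x and y.

    The inversion is carried out in a coordinate v with x = phi v, where phi v = v^s for mu^<t> and
    phi v = ln v for b. The densities of the image measures thus come out directly, without a
    separate change of variables.

    In the last step only a lower bound for the approximating densities is used. Since all measures
    have total mass 1, applying it to h + M and to M - h controls the integral of h from both
    sides. *)

Notation normc := ComplexField.Normc.normc.

(** * Limits of real and complex functions *)

Section RealLimits.
Context {R : realType} (T : Type) (F : set_system T) {FF : Filter F}.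
Implicit Types (f g : T -> R) (a b : R).

Definition rlimit f a := f x @[x --> F] --> a.

Lemma rlimitE f a b : rlimit f a -> a = b -> rlimit f b.
Proof. by move=> h <-. Qed.

Lemma rlimit_cst a : rlimit (fun=> a) a.
Proof. exact: cvg_cst. Qed.

Lemma rlimitD f g a b : rlimit f a -> rlimit g b ->
  rlimit (fun x => f x + g x) (a + b).
Proof. exact: cvgD. Qed.

Lemma rlimitN f a : rlimit f a -> rlimit (fun x => - f x) (- a).
Proof. exact: cvgN. Qed.

Lemma rlimitM f g a b : rlimit f a -> rlimit g b ->
  rlimit (fun x => f x * g x) (a * b).
Proof. exact: cvgM. Qed.

Lemma rlimit_sqr f a : rlimit f a -> rlimit (fun x => f x ^+ 2) (a ^+ 2).
Proof. by move=> h; exact: (rlimitM h h). Qed.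

Lemma rlimitV f a : rlimit f a -> a != 0 -> rlimit (fun x => (f x)^-1) a^-1.
Proof. by move=> h a0; exact: cvgV. Qed.

Lemma rlimit_norm f a : rlimit f a -> rlimit (fun x => `|f x|) `|a|.
Proof. exact: cvg_norm. Qed.

Lemma rlimit_near f g a : (\forall x \near F, f x = g x) -> rlimit f a -> rlimit g a.
Proof.
move=> fg; apply: cvg_trans; apply: near_eq_cvg.
by apply: filterS fg => x ->.
Qed.

Lemma rlimit_continuous f (g : R -> R) a : {for a, continuous g} -> rlimit f a ->
  rlimit (fun x => g (f x)) (g a).
Proof. by move=> ga fa; exact: (@cvg_comp _ _ _ f g F (nbhs a) _ fa ga). Qed.

Lemma rlimit_cvgE f a : rlimit f a = (f x @[x --> F] --> a).
Proof. by []. Qed.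

Lemma rlimitP f a : rlimit f a <->
  forall e : R, 0 < e -> \forall x \near F, `|a - f x| < e.
Proof. by split=> [/cvgrPdist_lt|h]; [|apply/cvgrPdist_lt]. Qed.
End RealLimits.

Lemma rlimit_id {R : realType} (a : R) : rlimit (nbhs a) (fun x => x) a.
Proof. exact: cvg_id. Qed.

Lemma continuous_rlimit {R : realType} (T : topologicalType) (g : T -> R) (v : T) :
  {for v, continuous g} <-> rlimit (nbhs v) g (g v).
Proof. by []. Qed.

Lemma rlimit_comp {R : realType} (T U : Type) (F : set_system T) (G : set_system U)
  (k : T -> U) (f : U -> R) (a : R) : k x @[x --> F] --> G -> rlimit G f a ->
  rlimit F (fun x => f (k x)) a.
Proof. exact: cvg_comp. Qed.

Arguments rlimit {R T} F f a : simpl never.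
#[global] Opaque rlimit.

(** The limit is an existential variable which the recursion fills in from the shape of the
    function; [rlimit_tac] then leaves the nonvanishing conditions and the equality with the
    announced value. *)
Ltac rlimit_rec :=
  lazymatch goal with
  | H : rlimit ?F ?f _ |- rlimit ?F ?f _ => exact H
  | H : rlimit ?F ?f _ |- rlimit ?F (fun x => ?f x) _ => exact H
  | |- rlimit _ (fun _ => ?a) _ => refine (@rlimit_cst _ _ _ _ a)
  | |- rlimit _ (fun x => (@?f x + @?g x)%R) _ =>
      refine (@rlimitD _ _ _ _ f g _ _ _ _); rlimit_rec
  | |- rlimit _ (fun x => (- @?f x)%R) _ =>
      refine (@rlimitN _ _ _ _ f _ _); rlimit_rec
  | |- rlimit _ (fun x => `|@?f x|%R) _ =>
      refine (@rlimit_norm _ _ _ _ f _ _); rlimit_rec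
  | |- rlimit _ (fun x => ((@?f x) ^+ 2)%R) _ =>
      refine (@rlimit_sqr _ _ _ _ f _ _); rlimit_rec
  | |- rlimit _ (fun x => (@?f x * @?g x)%R) _ =>
      refine (@rlimitM _ _ _ _ f g _ _ _ _); rlimit_rec
  | |- rlimit _ (fun x => ((@?f x)^-1)%R) _ =>
      refine (@rlimitV _ _ _ _ f _ _ _); [rlimit_rec | ]
  | |- _ => idtac
  end.
Ltac rlimit_tac := eapply rlimitE; [rlimit_rec | ].

Section ComplexLimits.
Context {R : realType}.
Implicit Types (z w : R[i]).

Lemma normc_def z : `|z| = (normc z)%:C.
Proof. by []. Qed.

Lemma normc_ge0 z : 0 <= normc z.
Proof. by case: z => a b; exact: sqrtr_ge0. Qed.

Lemma normc_gt0 z : (0 < normc z) = (z != 0).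
Proof.
rewrite lt_neqAle normc_ge0 andbT eq_sym; congr (~~ _).
by apply/eqP/eqP => [/ComplexField.Normc.eq0_normc //|->]; rewrite ComplexField.Normc.normc0.
Qed.

Lemma normc_sqr z : normc z ^+ 2 = complex.Re z ^+ 2 + complex.Im z ^+ 2.
Proof. by case: z => a b /=; rewrite sqr_sqrtr // addr_ge0 // sqr_ge0. Qed.

Lemma Re_le_normc z : `|complex.Re z| <= normc z.
Proof.
rewrite -(@ler_pXn2r _ 2) ?nnegrE ?normc_ge0// normc_sqr real_normK ?num_real//.
by rewrite lerDl sqr_ge0.
Qed.

Lemma Im_le_normc z : `|complex.Im z| <= normc z.
Proof.
rewrite -(@ler_pXn2r _ 2) ?nnegrE ?normc_ge0// normc_sqr real_normK ?num_real//.
by rewrite lerDr sqr_ge0.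
Qed.

Lemma normc_le_ReIm z : normc z <= `|complex.Re z| + `|complex.Im z|.
Proof.
rewrite -(@ler_pXn2r _ 2) ?nnegrE ?normc_ge0 ?addr_ge0// normc_sqr sqrrD.
rewrite !real_normK ?num_real// lerD2r lerDl.
by rewrite mulrn_wge0 // mulr_ge0.
Qed.

Lemma normcC (x : R) : normc x%:C = `|x|.
Proof. by rewrite /= expr0n /= addr0 sqrtr_sqr. Qed.

Lemma normcM z w : normc (z * w) = normc z * normc w.
Proof. exact: ComplexField.Normc.normcM. Qed.

Lemma normcV z : normc z^-1 = (normc z)^-1.
Proof. exact: ComplexField.Normc.normcV. Qed.

Lemma normcD z w : normc (z + w) <= normc z + normc w.
Proof. exact: le_normcD. Qed.

Lemma normcNr z : normc (- z) = normc z.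
Proof. exact: normcN. Qed.

Lemma normcB z w : normc (z - w) = normc (w - z).
Proof. by rewrite -normcNr opprB. Qed.

Lemma normcX z n : normc (z ^+ n) = normc z ^+ n.
Proof.
elim: n => [|n IH]; first by rewrite !expr0 ComplexField.Normc.normc1.
by rewrite !exprS normcM IH.
Qed.

Lemma cvgCP (T : Type) (F : set_system T) (FF : Filter F) (f : T -> R[i]) (a : R[i]) :
  f x @[x --> F] --> a <-> forall e : R, 0 < e -> \forall x \near F, normc (a - f x) < e.
Proof.
split=> [/cvgrPdist_lt h e e0|h].
  have /h : 0 < e%:C by rewrite ltcR.
  by apply: filterS => x; rewrite normc_def ltcR.
apply/cvgrPdist_lt => -[e e'] /=; rewrite ltcE /= => /andP[/eqP -> e0].
by apply: filterS (h _ e0) => x; rewrite normc_def ltcR.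
Qed.

Section algebra.
Context (T : Type) (F : set_system T) {FF : Filter F}.
Implicit Types (f g : T -> R[i]) (a b : R[i]).

(* A sealed form of convergence: unification may not unfold it, which would
   send it into the construction of the topology of R[i]. *)
Definition climit f a := f x @[x --> F] --> a.

Lemma climitE f a b : climit f a -> a = b -> climit f b.
Proof. by move=> h <-. Qed.

Lemma climit_cst a : climit (fun=> a) a.
Proof. exact: (@cvg_cst R[i] a T F FF). Qed.

Lemma climitD f g a b : climit f a -> climit g b ->
  climit (fun x => f x + g x) (a + b).
Proof. exact: (@cvgD R[i] R[i] T F FF f g a b). Qed.

Lemma climitN f a : climit f a -> climit (fun x => - f x) (- a).
Proof. exact: (@cvgN R[i] R[i] T F FF f a). Qed.

Lemma climitM f g a b : climit f a -> climit g b ->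
  climit (fun x => f x * g x) (a * b).
Proof. exact: (@cvgM R[i] T F FF f g a b). Qed.

Lemma climit_sqr f a : climit f a -> climit (fun x => f x ^+ 2) (a ^+ 2).
Proof. by move=> h; exact: (climitM h h). Qed.

Lemma climitV f a : climit f a -> a != 0 -> climit (fun x => (f x)^-1) a^-1.
Proof. by move=> h a0; exact: (@cvgV R[i] T F FF f a a0 h). Qed.

Lemma climit_near f g a : (\forall x \near F, f x = g x) -> climit f a -> climit g a.
Proof.
move=> fg; apply: cvg_trans; apply: near_eq_cvg.
by apply: filterS fg => x ->.
Qed.

Lemma climit_cvgE f a : climit f a = (f x @[x --> F] --> a).
Proof. by []. Qed.

Lemma climitP f a : climit f a <->
  forall e : R, 0 < e -> \forall x \near F, normc (a - f x) < e.
Proof. exact: cvgCP. Qed.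

Lemma climit_Re f a : climit f a -> rlimit F (fun x => complex.Re (f x)) (complex.Re a).
Proof.
move=> /climitP h; apply/rlimitP => e /h; apply: filterS => x.
by apply: le_lt_trans; rewrite -raddfB; exact: Re_le_normc.
Qed.

Lemma climit_Im f a : climit f a -> rlimit F (fun x => complex.Im (f x)) (complex.Im a).
Proof.
move=> /climitP h; apply/rlimitP => e /h; apply: filterS => x.
by apply: le_lt_trans; rewrite -raddfB; exact: Im_le_normc.
Qed.

Lemma climit_complex (u v : T -> R) (a b : R) : rlimit F u a ->
  rlimit F v b -> climit (fun x => u x +i* v x) (a +i* b).
Proof.
move=> /rlimitP hu /rlimitP hv; apply/climitP => e e0.
have e2 : 0 < e / 2 by rewrite divr_gt0.
apply: filterS2 (hu _ e2) (hv _ e2) => x h1 h2.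
rewrite (splitr e); apply: le_lt_trans (normc_le_ReIm _) _ => /=.
by apply: ltrD.
Qed.

Lemma climit_real (u : T -> R) (a : R) : rlimit F u a ->
  climit (fun x => (u x)%:C) a%:C.
Proof. by move=> h; apply: climit_complex => //; exact: rlimit_cst. Qed.

Lemma climit_normc f a : climit f a -> rlimit F (fun x => normc (f x)) (normc a).
Proof.
move=> /climitP h; apply/rlimitP => e /h; apply: filterS => x.
apply: le_lt_trans; rewrite ler_norml lerBlDr; apply/andP; split.
  by rewrite lerBrDr addrC lerBlDr addrC normcB; have := normcD (f x - a) a; rewrite subrK addrC.
by have := normcD (a - f x) (f x); rewrite subrK.
Qed.

End algebra.

Lemma climit_comp (T U : Type) (F : set_system T) (G : set_system U) (k : T -> U)
  (f : U -> R[i]) (a : R[i]) : k x @[x --> F] --> G -> climit G f a ->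
  climit F (fun x => f (k x)) a.
Proof. exact: cvg_comp. Qed.

Definition nbhs0 : set_system R[i] := nbhs (0 : R[i]).

#[global] Instance nbhs0_filter : Filter nbhs0.
Proof. exact: (nbhs_filter (0 : R[i])). Qed.

#[global] Instance nbhsC_filter z : Filter (nbhs z).
Proof. exact: (nbhs_filter z). Qed.

Lemma climit_nbhs (T : Type) (F : set_system T) (k : T -> R[i]) (a : R[i])
  (P : R[i] -> Prop) : climit F k a -> (\forall w \near nbhs a, P w) ->
  \forall x \near F, P (k x).
Proof. by move=> h; exact: h. Qed.

Lemma climit_compC (T : Type) (F : set_system T) (k : T -> R[i]) (f : R[i] -> R[i])
  (a b : R[i]) : climit F k a -> climit (nbhs a) f b -> climit F (fun x => f (k x)) b.
Proof. exact: cvg_comp. Qed.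

Lemma cvg_nbhs0 (T : Type) (F : set_system T) (k : T -> R[i]) :
  climit F k 0 -> k x @[x --> F] --> nbhs0.
Proof. by []. Qed.

End ComplexLimits.

Arguments climit {R T} F f a : simpl never.
#[global] Opaque climit.

(* Purely syntactic: unifying different ring operations of R[i] diverges. *)
Ltac climit_rec :=
  lazymatch goal with
  | H : climit ?F ?f _ |- climit ?F ?f _ => exact H
  | H : climit ?F ?f _ |- climit ?F (fun x => ?f x) _ => exact H
  | |- climit _ (fun _ => ?a) _ => refine (@climit_cst _ _ _ _ a)
  | |- climit _ (fun x => (@?f x + @?g x)%R) _ =>
      refine (@climitD _ _ _ _ f g _ _ _ _); climit_rec
  | |- climit _ (fun x => (- @?f x)%R) _ =>
      refine (@climitN _ _ _ _ f _ _); climit_rec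
  | |- climit _ (fun x => ((@?f x) ^+ 2)%R) _ =>
      refine (@climit_sqr _ _ _ _ f _ _); climit_rec
  | |- climit _ (fun x => (@?f x * @?g x)%R) _ =>
      refine (@climitM _ _ _ _ f g _ _ _ _); climit_rec
  | |- climit _ (fun x => ((@?f x)^-1)%R) _ =>
      refine (@climitV _ _ _ _ f _ _ _); [climit_rec | ]
  | |- _ => idtac
  end.
Ltac climit_tac := eapply climitE; [climit_rec | ].

(** * Complex exponential and logarithm *)

Section ComplexExp.
Context {R : realType}.
Implicit Types (z w h : R[i]).

(** One application of l'Hopital's rule reduces f x / x^2 to f1 x / (2 x), whose limit is half the
    derivative of f1 at 0. *)
Lemma second_order_expansion (f f1 : R -> R) (c : R) :
    (forall x : R, is_derive x (1 : R) f (f1 x)) -> is_derive (0 : R) (1 : R) f1 c ->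
    f 0 = 0 -> f1 0 = 0 ->
  exists2 q : R -> R, rlimit (nbhs (0 : R)) q (c / 2) & forall x, f x = x ^+ 2 * q x.
Proof.
move=> df df1 f0 f10.
have d1 : f1 x / x @[x --> (0 : R)^'] --> c.
  have hl : (fun h : R => h^-1 *: ((f1 \o shift 0) (h *: (1 : R)) - f1 0)) @ 0^' --> 'D_1 f1 0.
    exact: (@ex_derive _ _ _ _ _ _ _ df1).
  rewrite (@derive_val _ _ _ _ _ _ _ df1) in hl.
  apply: cvg_trans hl; apply: near_eq_cvg; near=> x.
  by rewrite /= f10 subr0 addr0 /GRing.scale /= mulr1 mulrC.
(* The values at 0 make the quotient of [df0] by [dg] equal to its limit c / 2 there. *)
pose dg (x : R) := if x == 0 then 1 else 2 * x.
pose df0 (x : R) := if x == 0 then c / 2 else f1 x.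
have h : f x / x ^+ 2 @[x --> (0 : R)^'] --> c / 2.
  apply: (@lhopital R f df0 (fun x => x ^+ 2) dg (-1) 1 0).
  - by rewrite in_itv/=; lra.
  - move=> x; rewrite inE /= => -[_ /eqP x0]; rewrite /df0 (negbTE x0); exact: df.
  - move=> x; rewrite inE /= => -[_ /eqP x0]; rewrite /dg (negbTE x0).
    by apply: is_derive_eq; rewrite /GRing.scale/= ; lra.
  - have : continuous f.
      move=> x; apply: differentiable_continuous; apply/derivable1_diffP.
      exact: (@ex_derive _ _ _ _ _ _ _ (df x)).
    by move=> /(_ 0); rewrite /continuous_at f0.
  - have := @exprn_continuous R 2 0; rewrite /continuous_at expr0n /=; exact.
  - by move=> x; rewrite inE /= => -[_ /eqP x0]; rewrite /dg (negbTE x0) mulf_neq0 ?pnatr_eq0.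
  - apply/cvgrPdist_lt => e e0.
    have : (f1 x / x / 2) @[x --> (0:R)^'] --> c / 2 by exact: cvgMl.
    move=> /cvgrPdist_lt /(_ _ e0); rewrite near_withinE; apply: filterS => x hx.
    have [x0|x0] := eqVneq x 0.
      by rewrite /df0 /dg /= x0 eqxx divr1 subrr normr0.
    by rewrite /df0 /dg /= (negbTE x0) invfM mulrA mulrAC; exact: hx.
exists (fun x => if x == 0 then c / 2 else f x / x ^+ 2).
  apply/rlimitP => e e0.
  move: h => /cvgrPdist_lt /(_ _ e0); rewrite near_withinE; apply: filterS => x hx.
  by case: (eqVneq x 0) => [//|x0]; rewrite ?subrr ?normr0//; exact: hx.
move=> x; case: (eqVneq x 0) => [->|x0]; first by rewrite f0 expr0n mul0r.
by rewrite mulrCA divff ?mulr1// expf_neq0.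
Unshelve. all: end_near. Qed.

Lemma expR_expansion : exists2 q : R -> R, rlimit (nbhs (0 : R)) q (1 / 2) &
  forall x, expR x - 1 - x = x ^+ 2 * q x.
Proof.
apply: (@second_order_expansion _ (fun x => expR x - 1)).
- by move=> x; apply: is_derive_eq; rewrite /GRing.scale /=; ring.
- by apply: is_derive_eq; rewrite expR0 /GRing.scale /=; ring.
- by rewrite expR0 subrr subr0.
- by rewrite expR0 subrr.
Qed.

Definition cexp z : R[i] := (expR (complex.Re z))%:C * cexpi (complex.Im z).

Lemma cexpiD (a b : R) : cexpi (a + b) = cexpi a * cexpi b.
Proof.
rewrite /cexpi cosD sinD; apply/eqP; rewrite eq_complex.
by apply/andP; split; apply/eqP => /=; ring.
Qed.

Lemma cexpD z w : cexp (z + w) = cexp z * cexp w.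
Proof. by rewrite /cexp !raddfD /= cexpiD expRD rmorphM /= mulrACA. Qed.

Lemma normc_cexpi (a : R) : normc (cexpi a) = 1.
Proof. by rewrite /= cos2Dsin2 sqrtr1. Qed.

Lemma normc_cexp z : normc (cexp z) = expR (complex.Re z).
Proof. by rewrite /cexp normcM normcC normc_cexpi mulr1 ger0_norm// expR_ge0. Qed.

Lemma cexp0 : cexp 0 = 1.
Proof. by rewrite /cexp /= expR0 /cexpi cos0 sin0 mul1r. Qed.

Lemma cexp_real (a : R) : cexp a%:C = (expR a)%:C.
Proof. by rewrite /cexp /= /cexpi cos0 sin0 mulr1. Qed.

End ComplexExp.

(** * Second-order complex Taylor expansions *)

Section Taylor2.
Context {R : realType}.
Implicit Types (f g : R[i] -> R[i]) (z w h : R[i]).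

(* Substitute for holomorphy: preserved by algebra and composition, and sufficient for the
   maximum principle. *)
Definition taylor2 f z := exists b (p : R[i] -> R[i]),
  climit nbhs0 p (p 0) /\
  \forall h \near nbhs0, f (z + h) = f z + b * h + h ^+ 2 * p h.

Lemma climit_id z : climit (nbhs z) (fun w => w) z.
Proof. exact: cvg_id. Qed.

Lemma climit_nbhs0 : climit nbhs0 (fun h => h) 0.
Proof. exact: climit_id. Qed.

Lemma taylor2_shift f z : taylor2 f z -> climit nbhs0 (fun h => f (z + h)) (f z).
Proof.
move=> [b [p [pc fE]]]; have idc := climit_nbhs0.
have : climit nbhs0 (fun h => f z + b * h + h ^+ 2 * p h) (f z + b * 0 + 0 ^+ 2 * p 0).
  by climit_tac.
rewrite mulr0 expr0n mul0r !addr0; apply: climit_near.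
by apply: filterS fE => h ->.
Qed.

Lemma climit_sub_nbhs0 z : (fun w => w - z) w @[w --> nbhs z] --> nbhs0.
Proof.
have idc := @climit_id z.
by apply: cvg_nbhs0; climit_tac; rewrite subrr.
Qed.

Lemma taylor2_continuous f z : taylor2 f z -> climit (nbhs z) f (f z).
Proof.
move=> /taylor2_shift /(climit_comp (@climit_sub_nbhs0 z)).
by apply: climit_near; apply: nearW => w; rewrite addrC subrK.
Qed.

Lemma taylor2_cst (c : R[i]) z : taylor2 (fun=> c) z.
Proof.
exists 0, (fun=> 0); split; first by climit_tac.
by apply: nearW => h; rewrite mul0r mulr0 !addr0.
Qed.

Lemma taylor2_id z : taylor2 id z.
Proof.
exists 1, (fun=> 0); split; first by climit_tac.
by apply: nearW => h; rewrite mul1r mulr0 !addr0.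
Qed.

Lemma taylor2D f g z : taylor2 f z -> taylor2 g z -> taylor2 (fun w => f w + g w) z.
Proof.
move=> [b [p [pc fE]]] [c [q [qc gE]]].
exists (b + c), (fun h => p h + q h); split; first by climit_tac.
by apply: filterS2 fE gE => h -> ->; ring.
Qed.

Lemma taylor2M f g z : taylor2 f z -> taylor2 g z -> taylor2 (fun w => f w * g w) z.
Proof.
move=> [b [p [pc fE]]] [c [q [qc gE]]]; have idc := climit_nbhs0.
exists (f z * c + b * g z), (fun h => f z * q h + g z * p h + b * c +
   h * (b * q h + c * p h + h * (p h * q h))); split; first by climit_tac.
by apply: filterS2 fE gE => h -> ->; ring.
Qed.

Lemma taylor2_comp g f z : taylor2 f z -> taylor2 g (f z) -> taylor2 (fun w => g (f w)) z.
Proof.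
move=> [b [p [pc fE]]] [c [q [qc gE]]]; have idc := climit_nbhs0.
pose k h := b * h + h ^+ 2 * p h.
have k0 : k 0 = 0 by rewrite /k mulr0 expr0n mul0r addr0.
have kc : k x @[x --> nbhs0] --> nbhs0.
  by apply: cvg_nbhs0; rewrite /k; climit_tac; exact: k0.
have qkc := climit_comp kc qc.
exists (c * b), (fun h => c * p h + (b + h * p h) ^+ 2 * q (k h)); split.
  by climit_tac; rewrite k0.
have gE' := kc _ gE.
apply: filterS2 fE gE' => h -> /= gkh.
by rewrite -addrA -/(k h) gkh /k; ring.
Qed.

Lemma taylor2V z : z != 0 -> taylor2 (fun w => w^-1) z.
Proof.
move=> z0; exists (- z ^- 2), (fun h => z ^- 2 * (z + h)^-1); split.
  have idc := climit_nbhs0.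
  by climit_tac; rewrite ?addr0.
have : 0 < normc z by rewrite normc_gt0.
have /climitP h0 := climit_nbhs0 => /h0; apply: filterS => h hz.
have zh : z + h != 0.
  apply: contraTneq hz => /eqP; rewrite addr_eq0 => /eqP ->.
  by rewrite normcNr normcB subr0 ltxx.
by field; rewrite z0 zh.
Qed.

Lemma taylor2_inv f z : taylor2 f z -> f z != 0 -> taylor2 (fun w => (f w)^-1) z.
Proof. by move=> fz fz0; apply: (@taylor2_comp (fun w => w^-1)) => //; exact: taylor2V. Qed.

Lemma taylor2N f z : taylor2 f z -> taylor2 (fun w => - f w) z.
Proof.
move=> hf; under eq_fun do rewrite -mulN1r.
by apply: taylor2M => //; exact: taylor2_cst.
Qed.

Lemma taylor2B f g z : taylor2 f z -> taylor2 g z -> taylor2 (fun w => f w - g w) z.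
Proof.
by move=> hf hg; apply: taylor2D => //; exact: taylor2N.
Qed.

Lemma rlimit_Re_nbhs0 (p : R -> R) (l : R) : rlimit (nbhs (0 : R)) p l ->
  rlimit nbhs0 (fun h => p (complex.Re h)) l.
Proof. exact: rlimit_comp (climit_Re climit_nbhs0). Qed.

Lemma rlimit_Im_nbhs0 (p : R -> R) (l : R) : rlimit (nbhs (0 : R)) p l ->
  rlimit nbhs0 (fun h => p (complex.Im h)) l.
Proof. exact: rlimit_comp (climit_Im climit_nbhs0). Qed.

Lemma cexp_expansion : exists2 p : R[i] -> R[i],
  climit nbhs0 p (p 0) & forall h, cexp h = 1 + h + h ^+ 2 * p h.
Proof.
have [E Ec EE] := @expR_expansion R.
have [C Cc CE] : exists2 q : R -> R, rlimit (nbhs (0 : R)) q (-1 / 2) &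
    forall x, cos x - 1 = x ^+ 2 * q x.
  apply: (@second_order_expansion R _ (fun x => - sin x)).
  - by move=> x; apply: is_derive_eq; rewrite /GRing.scale /=; ring.
  - by apply: is_derive_eq; rewrite cos0 /GRing.scale /=; ring.
  - by rewrite cos0 !subrr.
  - by rewrite sin0 oppr0.
have [S Sc SE] : exists2 q : R -> R, rlimit (nbhs (0 : R)) q (0 / 2) &
    forall x, sin x - x = x ^+ 2 * q x.
  apply: (@second_order_expansion R _ (fun x => cos x - 1)).
  - by apply: is_derive_eq; rewrite sin0 /GRing.scale /=; ring.
  - by rewrite sin0 !subrr.
  - by rewrite cos0 subrr.
(* For h = a + i b, substituting the real expansions into e^h - 1 - h - h^2 / 2 gives combinations
   of a^2 and b^2, whose coefficients are the terms of [eta]. As a^2 and b^2 are at most |h|^2,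
   [eta h] bounds the distance from (e^h - 1 - h) / h^2 to 1/2. *)
pose eta h : R := let a := complex.Re h in let b := complex.Im h in
  `|E a - 1 / 2| + `|C b + 1 / 2| + `|a * C b| + `|E a * (b ^+ 2 * C b)| +
  (`|S b| + `|a * S b| + `|E a * (b + b ^+ 2 * S b)|).
have eta0 : rlimit nbhs0 eta 0.
  have Ea := rlimit_Re_nbhs0 Ec; have Cb := rlimit_Im_nbhs0 Cc.
  have Sb := rlimit_Im_nbhs0 Sc.
  have a0 := climit_Re (FF := nbhs0_filter) climit_nbhs0.
  have b0 := climit_Im (FF := nbhs0_filter) climit_nbhs0.
  rewrite /eta; rlimit_tac.
  have -> : -1 / 2 + 1 / 2 = 0 :> R by field.
  by rewrite /= expr0n subrr !(mul0r, mulr0, normr0, addr0).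
pose p h := if h == 0 then 2^-1 else (cexp h - 1 - h) / h ^+ 2.
exists p; last first.
  move=> h; rewrite /p; have [->|h0] := eqVneq h 0.
    by rewrite cexp0 expr0n mul0r !addr0.
  by field.
rewrite {2}/p eqxx; apply/climitP => e e0.
move/rlimitP : eta0 => /(_ _ e0); apply: filterS => h.
rewrite sub0r normrN => etah; apply: le_lt_trans etah.
rewrite ger0_norm ?/eta ?addr_ge0//=.
have [h0|h0] := eqVneq h 0; first by rewrite /p h0 eqxx subrr normcC normr0 !addr_ge0.
have r0 : 0 < normc h ^+ 2 by rewrite exprn_gt0// normc_gt0.
rewrite -(ler_pM2r r0) -normcX -normcM /p (negbTE h0).
have -> : (2^-1 - (cexp h - 1 - h) / h ^+ 2) * h ^+ 2 =
    - (cexp h - 1 - h - h ^+ 2 / 2) by field.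
rewrite normcNr normcX; apply: le_trans (normc_le_ReIm _) _.
move: r0; rewrite normc_sqr; case: h {h0} => a b /= r0.
have EaE : expR a = 1 + a + a ^+ 2 * E a by rewrite -EE; ring.
have CbE : cos b = 1 + b ^+ 2 * C b by rewrite -CE; ring.
have SbE : sin b = b + b ^+ 2 * S b by rewrite -SE; ring.
rewrite EaE CbE SbE.
rewrite [X in `|X| + _](_ : _ = a ^+ 2 * (E a - 1 / 2) + b ^+ 2 * (C b + 1 / 2) +
  b ^+ 2 * (a * C b) + a ^+ 2 * (E a * (b ^+ 2 * C b))); last by field.
rewrite [X in _ + `|X|](_ : _ = b ^+ 2 * S b + b ^+ 2 * (a * S b) +
  a ^+ 2 * (E a * (b + b ^+ 2 * S b))); last by field.
have A X : `|a ^+ 2 * X| <= `|X| * (a ^+ 2 + b ^+ 2).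
  rewrite normrM ger0_norm ?sqr_ge0// mulrC ler_wpM2l// lerDl sqr_ge0//.
have B X : `|b ^+ 2 * X| <= `|X| * (a ^+ 2 + b ^+ 2).
  rewrite normrM ger0_norm ?sqr_ge0// mulrC ler_wpM2l// lerDr sqr_ge0//.
rewrite /= !mulrDl; apply: lerD.
  do 3 (apply: le_trans (ler_normD _ _) _; apply: lerD => //).
by do 2 (apply: le_trans (ler_normD _ _) _; apply: lerD => //).
Qed.

Lemma taylor2_cexp z : taylor2 cexp z.
Proof.
have [p pc pE] := cexp_expansion.
exists (cexp z), (fun h => cexp z * p h); split; first by climit_tac.
by apply: nearW => h; rewrite cexpD (pE h); ring.
Qed.
End Taylor2.

Section ComplexLog.
Context {R : realType}.
Implicit Types (z w h : R[i]).

(* Principal logarithm on the complement of the half-line ]-oo, 0]. *)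
Definition clog z : R[i] :=
  ln (normc z) +i* (2 * atan (complex.Im z / (normc z + complex.Re z))).

(** |z| + Re z vanishes exactly on ]-oo, 0] and is the denominator in [clog]; in this form the
    condition is visibly open. *)
Definition off_negative z := 0 < normc z + complex.Re z.

Lemma off_negativeP z : off_negative z \/ exists2 c : R, 0 <= c & z = (- c)%:C.
Proof.
have := Re_le_normc z; rewrite ler_norml => /andP[+ _].
rewrite lerNl -subr_ge0 opprK addrC le_eqVlt => /orP[/eqP e|?]; last by left; rewrite /off_negative addrC.
right; exists (normc z); first exact: normc_ge0.
have reE : complex.Re z = - normc z by apply/eqP; rewrite -addr_eq0; apply/eqP/esym.
have : normc z ^+ 2 = complex.Re z ^+ 2 + complex.Im z ^+ 2 by rewrite normc_sqr.
rewrite reE sqrrN => /eqP; rewrite -subr_eq0 opprD addNKr.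
rewrite oppr_eq0 sqrf_eq0 => /eqP imE.
by apply/eqP; rewrite eq_complex /= reE imE !eqxx.
Qed.

Lemma off_negative_neq0 z : off_negative z -> z != 0.
Proof. by apply: contraTneq => ->; rewrite /off_negative ComplexField.Normc.normc0 /= addr0 ltxx. Qed.

Lemma off_negative_real (a : R) : 0 < a -> off_negative a%:C.
Proof. by move=> a0; rewrite /off_negative normcC /= gtr0_norm// addr_gt0. Qed.

Lemma clog_real (a : R) : 0 < a -> clog a%:C = (ln a)%:C.
Proof. by move=> a0; rewrite /clog normcC gtr0_norm//= mul0r atan0 mulr0. Qed.

(** For a + i b = r exp(i theta), the quotient u = b / (r + a) is tan(theta / 2), and these are the
    formulas cos theta = (1 - u^2) / (1 + u^2) and sin theta = 2 u / (1 + u^2). *)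
Lemma half_angle_formulas (r a b : R) : r != 0 -> r + a != 0 ->
  r ^+ 2 = a ^+ 2 + b ^+ 2 -> let c2 := (1 + (b / (r + a)) ^+ 2)^-1 in
  r * ((1 - (b / (r + a)) ^+ 2) * c2) = a /\ r * (2 * (b / (r + a)) * c2) = b.
Proof.
move=> r0 ra0 rE /=; set d := r + a.
have dE : d ^+ 2 + b ^+ 2 = 2 * r * d by rewrite /d sqrrD rE; ring: rE.
have -> : (1 + (b / d) ^+ 2)^-1 = d / (2 * r).
  rewrite exprMn exprVn -[1](@divff _ (d ^+ 2)) ?expf_neq0// -mulrDl dE.
  by field; rewrite r0 ra0.
split; last by field; rewrite r0 ra0.
have bE : b ^+ 2 = d * (r - a) by rewrite /d; ring: rE.
by rewrite exprMn bE /d; field; rewrite r0 ra0.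
Qed.

Lemma cexp_clog z : off_negative z -> cexp (clog z) = z.
Proof.
move=> oz; have r0 : 0 < normc z by rewrite normc_gt0 off_negative_neq0.
rewrite /cexp /= lnK ?posrE// /cexpi mulr_natl mulr2n cosD sinD.
have [] := @half_angle_formulas (normc z) (complex.Re z) (complex.Im z).
- by rewrite gt_eqF.
- by rewrite gt_eqF.
- exact: normc_sqr.
set u := complex.Im z / (normc z + complex.Re z).
have cE : (1 + u ^+ 2)^-1 = cos (atan u) ^+ 2.
  by rewrite cos_atan exprVn sqr_sqrtr// addr_ge0// sqr_ge0.
have sE : sin (atan u) = u * cos (atan u).
  have c0 : cos (atan u) != 0.
    by rewrite cos_atan invr_eq0 sqrtr_eq0 -ltNge ltr_pwDl// sqr_ge0.
  by rewrite -{2}[u]atanK /tan divfK.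
rewrite cE sE => aE bE.
apply/eqP; rewrite eq_complex; apply/andP; split; apply/eqP => /=.
  by rewrite -[RHS]aE; ring.
by rewrite -[RHS]bE; ring.
Qed.

Lemma off_negative_near z : off_negative z -> \forall w \near nbhs z, off_negative w.
Proof.
move=> oz.
have l : rlimit (nbhs z) (fun w => normc w + complex.Re w) (normc z + complex.Re z).
  have h1 := climit_normc (FF := nbhsC_filter z) (@climit_id _ z).
  have h2 := climit_Re (FF := nbhsC_filter z) (@climit_id _ z).
  by rlimit_tac.
move/rlimitP : l => /(_ _ oz); apply: filterS => w.
by rewrite /off_negative ltr_distlC => /andP[+ _]; rewrite subrr.
Qed.

Lemma climit_clog z : off_negative z -> climit (nbhs z) clog (clog z).
Proof.
move=> oz.
have h1 := climit_normc (FF := nbhsC_filter z) (@climit_id _ z).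
have h2 := climit_Re (FF := nbhsC_filter z) (@climit_id _ z).
have h3 := climit_Im (FF := nbhsC_filter z) (@climit_id _ z).
apply: climit_complex.
  apply: rlimit_continuous h1; apply: continuous_ln.
  by rewrite normc_gt0 off_negative_neq0.
rlimit_tac; last reflexivity.
apply: (rlimit_continuous (f := fun w => complex.Im w / (normc w + complex.Re w))).
  exact: continuous_atan.
by rlimit_tac; last reflexivity; rewrite gt_eqF.
Qed.
(** The expansion of the exponential is inverted. With k = clog (z + h) - clog z, which tends to 0,
    e^k = 1 + k + k^2 p(k) gives h / z = k (1 + k p(k)). Hence k - h / z = - k^2 p(k), and k^2 = (h
    / z)^2 / (1 + k p(k))^2. *)
Lemma clog_expansion z : off_negative z -> exists p : R[i] -> R[i],
  climit nbhs0 p (p 0) /\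
  \forall h \near nbhs0, clog (z + h) = clog z + z^-1 * h + h ^+ 2 * p h.
Proof.
move=> oz; have z0 := off_negative_neq0 oz.
have [p pc pE] := @cexp_expansion R.
pose k h := clog (z + h) - clog z.
have zh : climit nbhs0 (fun h => z + h) z.
  by have idc := @climit_nbhs0 R; climit_tac; rewrite addr0.
have kc : climit nbhs0 k 0.
  have lc := climit_compC zh (climit_clog oz).
  by rewrite /k; climit_tac; rewrite subrr.
have k0 : k 0 = 0 by rewrite /k addr0 subrr.
have pkc := climit_comp (cvg_nbhs0 kc) pc.
have dc : climit nbhs0 (fun h => 1 + k h * p (k h)) 1.
  by climit_tac; rewrite mul0r addr0.
exists (fun h => - (z ^- 2 * (p (k h) * ((1 + k h * p (k h)) ^+ 2)^-1))); split.
  climit_tac; last by rewrite k0 mul0r addr0.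
  by rewrite expr1n oner_neq0.
have d0 : \forall h \near nbhs0, 1 + k h * p (k h) != 0.
  move/climitP : dc => /(_ _ ltr01); apply: filterS => h.
  by apply: contraTneq => ->; rewrite subr0 normcC normr1 ltxx.
have ozh : \forall h \near nbhs0, off_negative (z + h).
  exact: climit_nbhs zh (off_negative_near oz).
apply: filterS2 ozh d0 => h oh dh0.
have hE : h = z * (k h * (1 + k h * p (k h))).
  have : z + h = z * (1 + k h + k h ^+ 2 * p (k h)).
    rewrite -pE -[X in _ = X * _](cexp_clog oz) -cexpD.
    have -> : clog z + k h = clog (z + h) by rewrite /k; ring.
    by rewrite cexp_clog.
  by move/(canRL (addKr z)) => {1}->; ring.
have kE : k h * (1 + k h * p (k h)) = h / z by apply: (mulfI z0); rewrite -hE mulrCA divff// mulr1.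
have -> : clog (z + h) = clog z + k h by rewrite /k; ring.
rewrite -addrA; congr (_ + _).
have -> : h ^+ 2 * - (z ^- 2 * (p (k h) * ((1 + k h * p (k h)) ^+ 2)^-1)) =
   - (h / z) ^+ 2 * (p (k h) * ((1 + k h * p (k h)) ^+ 2)^-1).
  by rewrite exprMn exprVn; ring.
by rewrite [z^-1 * h]mulrC -kE; field.
Qed.
Lemma taylor2_clog z : off_negative z -> taylor2 clog z.
Proof. by move=> /clog_expansion; exists z^-1. Qed.
End ComplexLog.

(** * Maximum principle *)

Section MaximumPrinciple.
Context {R : realType}.
Implicit Types (g : R[i] -> R[i]).

Lemma rlimit_at_right0 : rlimit (0 : R)^'+ (fun d => d) (0 : R).
Proof.
apply/rlimitP => e e0; near=> x.
by rewrite sub0r normrN gtr0_norm//; near: x; exact: nbhs_right_lt.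
Unshelve. all: end_near. Qed.

Lemma near_nbhs0_ray (u : R[i]) (P : R[i] -> Prop) :
  (\forall h \near nbhs0, P h) -> \forall d \near (0 : R)^'+, P (d%:C * u).
Proof.
have cl : climit (0 : R)^'+ (fun d => d%:C * u) 0.
  have idc := climit_real (FF := at_right_proper_filter (0 : R)) rlimit_at_right0.
  by climit_tac; rewrite /= mul0r.
by move=> /(climit_nbhs cl).
Qed.

(* Averaging over the four points c + d i^k kills the linear and quadratic terms of the
   Taylor expansion of g. *)
Lemma no_interior_maximum g (c : R[i]) (e : R) : taylor2 g c -> 0 < e ->
  \forall d \near (0 : R)^'+, exists2 h : R[i], normc h = d &
   complex.Re (g c) + e * (complex.Re c) ^+ 2 <
   complex.Re (g (c + h)) + e * (complex.Re (c + h)) ^+ 2.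
Proof.
move=> [b [p [pc gE]]] e0.
have e4 : 0 < e / 4 by rewrite divr_gt0.
have /climitP/(_ _ e4) pe := pc.
pose Q h := normc (p 0 - p h) < e / 4 /\ g (c + h) = g c + b * h + h ^+ 2 * p h.
have NQ : \forall h \near nbhs0, Q h by apply: filterS2 pe gE.
near=> d.
have d0 : 0 < d by near: d; exact: nbhs_right_gt.
have [p1 g1] : Q (d%:C * 1) by near: d; exact: (near_nbhs0_ray 1 NQ).
have [p2 g2] : Q (d%:C * -1) by near: d; exact: (near_nbhs0_ray (-1) NQ).
have [p3 g3] : Q (d%:C * 'i) by near: d; exact: (near_nbhs0_ray 'i NQ).
have [p4 g4] : Q (d%:C * - 'i) by near: d; exact: (near_nbhs0_ray (- 'i) NQ).
apply: contrapT => H.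
have {}H u : normc u = 1 -> complex.Re (g (c + d%:C * u)) +
    e * complex.Re (c + d%:C * u) ^+ 2 <= complex.Re (g c) + e * complex.Re c ^+ 2.
  move=> u1; rewrite leNgt; apply/negP => lt; apply: H; exists (d%:C * u) => //.
  by rewrite normcM normcC u1 mulr1 gtr0_norm.
have n1 : normc 1 = 1 :> R by rewrite ComplexField.Normc.normc1.
have n3 : normc 'i = 1 :> R by rewrite /= expr0n expr1n add0r sqrtr1.
have := H 1 n1; have := H (-1); have := H 'i n3; have := H (- 'i).
rewrite !normcNr n1 n3 => /(_ erefl) h4 h3 /(_ erefl) h2 h1.
have K h : normc (p 0 - p h) < e / 4 -> `|complex.Re (p h) - complex.Re (p 0)| < e / 4.
  by apply: le_lt_trans; rewrite -raddfB /= normcB Re_le_normc.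
have {}p1 := K _ p1; have {}p2 := K _ p2; have {}p3 := K _ p3; have {}p4 := K _ p4.
rewrite ltr_norml in p1; rewrite ltr_norml in p2.
rewrite ltr_norml in p3; rewrite ltr_norml in p4.
move: h1 h2 h3 h4; rewrite g1 g2 g3 g4 {g1 g2 g3 g4}.
move: (p (_ * 1)) (p (_ * -1)) (p (_ * 'i)) (p (_ * - 'i)) p1 p2 p3 p4.
move: (p 0) (g c) => [q0 q0'] [m m'] [q1 q1'] [q2 q2'] [q3 q3'] [q4 q4'] /=.
have E z : z = complex.Re z +i* complex.Im z by case: z.
rewrite [b]E [c]E.
move: (complex.Re b) (complex.Im b) (complex.Re c) (complex.Im c) => b1 b2 c1 c2.
move=> /andP[p1 _] /andP[p2 _] /andP[_ p3] /andP[_ p4] /=.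
have d2 : 0 < d * d by rewrite mulr_gt0.
rewrite -(ltr_pM2l d2) in p1; rewrite -(ltr_pM2l d2) in p2.
rewrite -(ltr_pM2l d2) in p3; rewrite -(ltr_pM2l d2) in p4.
move=> h1 h2 h3 h4.
have d2e : 0 < d * d * e by rewrite mulr_gt0.
lra.
Unshelve. all: end_near. Qed.

(** Adding e (Re z)^2 to Re g makes it strictly subharmonic, so its maximum over the compact
    rectangle lies on the boundary. The perturbation costs at most e B there, where B bounds (Re
    z)^2 and the summant 1 only makes it positive. *)
Lemma maximum_principle g (x1 x2 y1 y2 M : R) :
  (forall x y, x1 <= x <= x2 -> y1 <= y <= y2 -> taylor2 g (x +i* y)) ->
  (forall x y, x1 <= x <= x2 -> y1 <= y <= y2 ->
     [|| x == x1, x == x2, y == y1 | y == y2] -> complex.Re (g (x +i* y)) <= M) ->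
  forall x y, x1 <= x <= x2 -> y1 <= y <= y2 -> complex.Re (g (x +i* y)) <= M.
Proof.
move=> gT gM x y xx yy; apply/ler_addgt0Pr => e' e'0.
pose B := 1 + x1 ^+ 2 + x2 ^+ 2.
have B0 : 0 < B by rewrite /B -addrA ltr_pwDl// addr_ge0// sqr_ge0.
have [e e0 eB] : exists2 e, 0 < e & e * B = e'.
  by exists (e' / B); rewrite ?divr_gt0// divfK// gt_eqF.
pose Q : set (R * R) := `[x1, x2] `*` `[y1, y2].
pose toC (q : R * R) : R[i] := q.1 +i* q.2.
pose u (q : R * R) : R := complex.Re (g (toC q)) + e * (complex.Re (toC q)) ^+ 2.
have cQ : compact Q by apply: compact_setX; exact: segment_compact.
have cu : {within Q, continuous u}.
  apply: continuous_in_subspaceT => q; rewrite inE => -[/= q1 q2].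
  have cC : climit (nbhs q) toC (toC q).
    by apply: climit_complex; [exact: cvg_fst|exact: cvg_snd].
  have gc := climit_Re (FF := nbhs_filter q) (climit_compC cC (taylor2_continuous (gT _ _ q1 q2))).
  have rc := climit_Re (FF := nbhs_filter q) cC.
  rewrite /continuous_at -rlimit_cvgE /u.
  by rlimit_tac.
have [c /[!inE] -[/= c1 c2] cmax] : exists2 c, c \in Q & forall q, q \in Q -> u q <= u c.
  by apply: compact_EVT_max => //; exists (x, y).
have sqB a : x1 <= a <= x2 -> a ^+ 2 <= B.
  move=> /andP[a1 a2]; rewrite /B; have := sqr_ge0 x1; have := sqr_ge0 x2.
  have [a0|a0] := leP 0 a; first by nra.
  nra.
have uxy : complex.Re (g (x +i* y)) <= u c.
  apply: (@le_trans _ _ (u (x, y))); last by apply: cmax; rewrite inE.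
  by rewrite /u /= lerDl mulr_ge0// ?sqr_ge0// ltW.
apply: le_trans uxy _; rewrite /u -eB /=.
have [bd|] := boolP [|| c.1 == x1, c.1 == x2, c.2 == y1 | c.2 == y2].
  by apply: lerD; [exact: gM|rewrite ler_pM2l//; exact: sqB].
rewrite !negb_or => /and4P[n1 n2 n3 n4]; exfalso.
have /andP[c11 c12] := c1; have /andP[c21 c22] := c2.
have {}c11 : 0 < c.1 - x1 by rewrite subr_gt0 lt_neqAle eq_sym n1.
have {}c12 : 0 < x2 - c.1 by rewrite subr_gt0 lt_neqAle n2.
have {}c21 : 0 < c.2 - y1 by rewrite subr_gt0 lt_neqAle eq_sym n3.
have {}c22 : 0 < y2 - c.2 by rewrite subr_gt0 lt_neqAle n4.
near (0 : R)^'+ => d.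
have [[h1 h2] hd] : exists2 h : R[i], normc h = d &
   complex.Re (g (toC c)) + e * (complex.Re (toC c)) ^+ 2 <
   complex.Re (g (toC c + h)) + e * (complex.Re (toC c + h)) ^+ 2.
  by near: d; apply: no_interior_maximum => //; exact: gT.
have dlt1 : d < c.1 - x1 by near: d; exact: nbhs_right_lt.
have dlt2 : d < x2 - c.1 by near: d; exact: nbhs_right_lt.
have dlt3 : d < c.2 - y1 by near: d; exact: nbhs_right_lt.
have dlt4 : d < y2 - c.2 by near: d; exact: nbhs_right_lt.
have := Re_le_normc (h1 +i* h2); have := Im_le_normc (h1 +i* h2).
rewrite hd /= !ler_norml => /andP[a1 a2] /andP[a3 a4].
apply/negP; rewrite -leNgt.
apply: (cmax (c.1 + h1, c.2 + h2)); rewrite inE; split => /=; rewrite in_itv/=; lra.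
Unshelve. all: end_near. Qed.
End MaximumPrinciple.

(** * Cauchy transforms *)

Section ComplexIntegral.
Context {R : realType} (mu : probability R R).
Implicit Types (f g : R -> R[i]) (c : R[i]).

(** Inversion for either sign is reduced to a real power of a nonnegative function: 1 / u = u
    (u^2)^(-1), also at u = 0. *)
Lemma measurable_funV (D : set R) (u : R -> R) : measurable D ->
  measurable_fun D u -> measurable_fun D (fun x => (u x)^-1).
Proof.
move=> mD mu_.
rewrite (_ : (fun x => (u x)^-1) = (fun x => u x * (u x * u x) `^ (-1))).
  apply: measurable_funM => //.
  apply: (measurableT_comp (measurable_powR (-1))); exact: measurable_funM.
apply/funext => x; rewrite powR_inv1; last by rewrite -expr2 sqr_ge0.
have [->|u0] := eqVneq (u x) 0; first by rewrite invr0 mul0r.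
by field.
Qed.

Definition cmeasurable f := measurable_fun setT (fun x => complex.Re (f x)) /\
  measurable_fun setT (fun x => complex.Im (f x)).

Lemma cmeasurable_cst c : cmeasurable (fun=> c).
Proof. by split; exact: measurable_cst. Qed.

Lemma cmeasurableD f g : cmeasurable f -> cmeasurable g -> cmeasurable (fun x => f x + g x).
Proof.
move=> [f1 f2] [g1 g2]; split.
  by under eq_fun do rewrite raddfD; exact: measurable_funD.
by under eq_fun do rewrite raddfD; exact: measurable_funD.
Qed.

Lemma ReM (a b : R[i]) : complex.Re (a * b) =
  complex.Re a * complex.Re b - complex.Im a * complex.Im b.
Proof. by case: a b => [? ?] [? ?]. Qed.

Lemma ImM (a b : R[i]) : complex.Im (a * b) =
  complex.Re a * complex.Im b + complex.Im a * complex.Re b.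
Proof. by case: a b => [? ?] [? ?]. Qed.

Lemma ImB (a b : R[i]) : complex.Im (a - b) = complex.Im a - complex.Im b.
Proof. by case: a b => [? ?] [? ?]. Qed.

Lemma ReCM (r : R) (a : R[i]) : complex.Re (r%:C * a) = r * complex.Re a.
Proof. by case: a => a b; rewrite /= mul0r subr0. Qed.

Lemma ImCM (r : R) (a : R[i]) : complex.Im (r%:C * a) = r * complex.Im a.
Proof. by case: a => x y /=; rewrite mul0r addr0. Qed.

Lemma ReV (a : R[i]) : complex.Re a^-1 = complex.Re a / (complex.Re a ^+ 2 + complex.Im a ^+ 2).
Proof. by case: a. Qed.

Lemma ImV (a : R[i]) : complex.Im a^-1 = - (complex.Im a / (complex.Re a ^+ 2 + complex.Im a ^+ 2)).
Proof. by case: a. Qed.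

Lemma cmeasurableM f g : cmeasurable f -> cmeasurable g -> cmeasurable (fun x => f x * g x).
Proof.
move=> [f1 f2] [g1 g2]; split.
  by under eq_fun do rewrite ReM; apply: measurable_funB; exact: measurable_funM.
by under eq_fun do rewrite ImM; apply: measurable_funD; exact: measurable_funM.
Qed.

Lemma cmeasurableV f : cmeasurable f -> cmeasurable (fun x => (f x)^-1).
Proof.
move=> [f1 f2].
have m2 : measurable_fun setT (fun x => (complex.Re (f x) ^+ 2 + complex.Im (f x) ^+ 2)^-1).
  by apply: measurable_funV => //; apply: measurable_funD; exact: measurable_funX.
split.
  by under eq_fun do rewrite ReV; exact: measurable_funM.
under eq_fun do rewrite ImV; apply: (measurableT_comp (@oppr_measurable R setT)).
exact: measurable_funM.
Qed.

Lemma cmeasurable_shift (z : R[i]) (u : R -> R) : measurable_fun setT u ->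
  cmeasurable (fun x => z - (u x)%:C).
Proof.
move=> mu_; split.
  under eq_fun do rewrite raddfB /=.
  by apply: measurable_funB => //; exact: measurable_cst.
under eq_fun do rewrite raddfB /= subr0.
exact: measurable_cst.
Qed.

Definition cbounded f (B : R) := forall x, normc (f x) <= B.

Lemma cboundedM f g A B : cbounded f A -> cbounded g B -> cbounded (fun x => f x * g x) (A * B).
Proof. by move=> fA gB x; rewrite normcM ler_pM// normc_ge0. Qed.

Lemma cbounded_cst c : cbounded (fun=> c) (normc c).
Proof. by move=> x. Qed.

Lemma bounded_integrable (u : R -> R) (B : R) : measurable_fun setT u ->
  (forall x, `|u x| <= B) -> mu.-integrable setT (EFin \o u).
Proof.
move=> mu_ uB; apply: measurable_bounded_integrable => //.
  by rewrite [X in (X < _)%E](@probability_setT _ _ _ mu) ltry.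
exists B; split; first exact: num_real.
by move=> b Bb x _ /=; exact: le_trans (uB x) (ltW Bb).
Qed.

Lemma cbounded_integrable f B : cmeasurable f -> cbounded f B ->
  mu.-integrable setT (EFin \o (fun x => complex.Re (f x))) /\
  mu.-integrable setT (EFin \o (fun x => complex.Im (f x))).
Proof.
move=> [f1 f2] fB; split; apply: (@bounded_integrable _ B) => // x.
  exact: le_trans (Re_le_normc _) (fB x).
exact: le_trans (Im_le_normc _) (fB x).
Qed.

Definition cint f : R[i] :=
  (\int[mu]_x complex.Re (f x))%R +i* (\int[mu]_x complex.Im (f x))%R.

Lemma cintD f g A B : cmeasurable f -> cbounded f A -> cmeasurable g -> cbounded g B ->
  cint (fun x => f x + g x) = cint f + cint g.
Proof.
move=> mf bf mg bg; have [f1 f2] := cbounded_integrable mf bf.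
have [g1 g2] := cbounded_integrable mg bg.
apply/eqP; rewrite eq_complex; apply/andP; split; apply/eqP => /=.
  by under eq_Rintegral do rewrite raddfD; rewrite RintegralD.
by under eq_Rintegral do rewrite raddfD; rewrite RintegralD.
Qed.

Lemma integrableZ_EFin (u : R -> R) (c : R) : mu.-integrable setT (EFin \o u) ->
  mu.-integrable setT (EFin \o (fun x => c * u x)).
Proof. by move=> iu; exact: (integrableZl measurableT c iu). Qed.

Lemma cintZ c f B : cmeasurable f -> cbounded f B -> cint (fun x => c * f x) = c * cint f.
Proof.
move=> mf bf; have [f1 f2] := cbounded_integrable mf bf.
apply/eqP; rewrite eq_complex; apply/andP; split; apply/eqP; rewrite ?ReM ?ImM /=.
  under eq_Rintegral do rewrite ReM.
  by rewrite RintegralB ?RintegralZl//; exact: integrableZ_EFin.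
under eq_Rintegral do rewrite ImM.
by rewrite RintegralD ?RintegralZl//; exact: integrableZ_EFin.
Qed.

Lemma Rintegral_prob_cst (c : R) : (\int[mu]_x c)%R = c.
Proof. by rewrite Rintegral_cst// [X in fine X](@probability_setT _ _ _ mu) mulr1. Qed.

Lemma cint_cst c : cint (fun=> c) = c.
Proof. by rewrite /cint !Rintegral_prob_cst; case: c. Qed.

Lemma Rintegral_le_bound (u : R -> R) (B : R) : mu.-integrable setT (EFin \o u) ->
  (forall x, `|u x| <= B) -> `|(\int[mu]_x u x)%R| <= B.
Proof.
move=> iu uB; apply: le_trans (le_normr_Rintegral _ iu) _ => //.
rewrite -[leRHS]Rintegral_prob_cst; apply: le_Rintegral => //.
- exact: (integrable_abse iu).
- by apply: (@bounded_integrable _ `|B|).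
Qed.

Lemma normc_cint_le f B : cmeasurable f -> cbounded f B -> normc (cint f) <= 2 * B.
Proof.
move=> mf bf; have [f1 f2] := cbounded_integrable mf bf.
apply: le_trans (normc_le_ReIm _) _; rewrite mulr_natl mulr2n lerD//=.
  by apply: Rintegral_le_bound => // x; exact: le_trans (Re_le_normc _) (bf x).
by apply: Rintegral_le_bound => // x; exact: le_trans (Im_le_normc _) (bf x).
Qed.
End ComplexIntegral.

Section CauchyTransform.
Context {R : realType} (mu : probability R R).
Implicit Types (z w h : R[i]) (x : R).

(* The point x is moved to [0, +oo[, where mu lives, to keep the kernel bounded. *)
Definition cauchy_kernel z x : R[i] := (z - (Num.max x 0)%:C)^-1.

Definition off_support z (d : R) := 0 < d /\ forall x, 0 <= x -> d <= normc (z - x%:C).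

(* The closed upper half-plane minus [0, +oo[ *)
Definition upper_slit z := 0 < complex.Im z \/ (complex.Im z = 0 /\ complex.Re z < 0).

Lemma upper_slit_off_support z : upper_slit z -> exists d, off_support z d.
Proof.
move=> [z0|[z1 z0]].
  exists (complex.Im z); split => // x _.
  by apply: le_trans (Im_le_normc _); rewrite raddfB /= subr0 ler_norm.
exists (- complex.Re z); split; first by rewrite oppr_gt0.
move=> x x0; apply: le_trans (Re_le_normc _); rewrite raddfB /= -normrN opprB.
by apply: le_trans (ler_norm _); rewrite lerBrDl; lra.
Qed.

Lemma off_supportD z d h : off_support z d -> normc h < d / 2 -> off_support (z + h) (d / 2).
Proof.
move=> [d0 zd] hd; split => [|x x0]; first by rewrite divr_gt0.
have := zd x x0; have := normcD (z + h - x%:C) (- h).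
have -> : z + h - x%:C - h = z - x%:C by ring.
rewrite normcNr => h1 h2; lra.
Qed.

Lemma max0_ge0 x : 0 <= Num.max x 0.
Proof. by rewrite le_max lexx orbT. Qed.

Lemma off_support_neq0 z d x : off_support z d -> z - (Num.max x 0)%:C != 0.
Proof. by move=> [d0 zd]; rewrite -normc_gt0; apply: lt_le_trans d0 (zd _ (max0_ge0 x)). Qed.

Lemma cauchy_kernel_bounded z d : off_support z d -> cbounded (cauchy_kernel z) d^-1.
Proof.
move=> [d0 zd] x; rewrite /cauchy_kernel normcV lef_pV2 ?posrE//; first exact/zd/max0_ge0.
exact: lt_le_trans d0 (zd _ (max0_ge0 x)).
Qed.

Lemma measurable_max0 : measurable_fun setT (fun x : R => Num.max x 0).
Proof. exact: measurable_maxr. Qed.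

Lemma cauchy_kernel_measurable z : cmeasurable (cauchy_kernel z).
Proof. by apply: cmeasurableV; apply: cmeasurable_shift; exact: measurable_max0. Qed.

Lemma nonneg_ae : on_nonneg mu -> {ae mu, forall x, 0 <= x}.
Proof.
move=> mu1; exists (~` `[0, +oo[%classic); split.
- by apply: measurableC.
- by rewrite probability_setC// mu1 subee.
- by move=> x /= /negP; rewrite -ltNge => x0; rewrite in_itv/= andbT; apply/negP; rewrite -ltNge.
Qed.

Lemma Rintegral_ae_eq (u v : R -> R) : measurable_fun setT u -> measurable_fun setT v ->
  {ae mu, forall x, u x = v x} -> (\int[mu]_x u x)%R = (\int[mu]_x v x)%R.
Proof.
move=> mu_ mv uv; congr fine; apply: ae_eq_integral => //; try exact/measurable_EFinP.
by apply: filterS uv => x /= -> _.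
Qed.

Lemma G_transformE z : on_nonneg mu -> G_transform mu z = cint mu (cauchy_kernel z).
Proof.
move=> /nonneg_ae mu0.
have [m1 m2] := cauchy_kernel_measurable z.
have [m3 m4] : cmeasurable (fun x => (z - x%:C)^-1).
  by apply: cmeasurableV; apply: cmeasurable_shift; exact: measurable_id.
rewrite /G_transform /cint; congr (_ +i* _); apply: Rintegral_ae_eq => //;
  by apply: filterS mu0 => x x0; rewrite /cauchy_kernel max_l.
Qed.

(** The identity 1 / (a + h) = 1 / a - h / a^2 + h^2 / (a^2 (a + h)) with a = z - x is integrated
    over x. All kernels are bounded because z keeps a positive distance d from [0, +oo[. *)
Lemma taylor2_cauchy z : upper_slit z -> taylor2 (fun w => cint mu (cauchy_kernel w)) z.
Proof.
move=> /upper_slit_off_support[d zd].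
have d0 := zd.1; have d20 : 0 < d / 2 by rewrite divr_gt0.
have kb := cauchy_kernel_bounded zd; have km := cauchy_kernel_measurable.
have near_h : \forall h \near nbhs0, normc h < d / 2.
  have /climitP/(_ _ d20) := @climit_nbhs0 R; apply: filterS => h.
  by rewrite normcB subr0.
pose k2 x := cauchy_kernel z x * cauchy_kernel z x.
have k2m : cmeasurable k2 by exact: cmeasurableM.
have k2b : cbounded k2 (d^-1 * d^-1) by exact: cboundedM.
pose q h x := k2 x * cauchy_kernel (z + h) x.
have qm h : cmeasurable (q h) by exact: cmeasurableM.
have qb h : normc h < d / 2 -> cbounded (q h) (d^-1 * d^-1 * (d / 2)^-1).
  by move=> hd; apply: cboundedM => //; exact/cauchy_kernel_bounded/off_supportD.
exists (- cint mu k2), (fun h => cint mu (q h)); split; last first.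
  apply: filterS near_h => h hd.
  have zhd := off_supportD zd hd.
  have bb (c : R[i]) f B : cbounded f B -> cbounded (fun x => c * f x) (normc c * B).
    by move=> fB; apply: cboundedM => //; exact: cbounded_cst.
  have mm (c : R[i]) f : cmeasurable f -> cmeasurable (fun x => c * f x).
    by move=> fB; apply: cmeasurableM => //; exact: cmeasurable_cst.
  transitivity (cint mu (fun x => cauchy_kernel z x + (- h) * k2 x + h ^+ 2 * q h x)).
    congr (cint mu _); apply/funext => x; rewrite /q /k2 /cauchy_kernel.
    field; apply/andP; split; first by rewrite (off_support_neq0 x zhd).
    exact: off_support_neq0 x zd.
  rewrite (cintD _ (A := d^-1 + normc (- h) * (d^-1 * d^-1))
    (B := normc (h ^+ 2) * (d^-1 * d^-1 * (d / 2)^-1))).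
  - rewrite (cintD _ (A := d^-1) (B := normc (- h) * (d^-1 * d^-1)))//.
    + by rewrite (cintZ _ _ k2m k2b) (cintZ _ _ (qm h) (qb _ hd)); ring.
    + exact: mm.
    + exact: bb.
  - by apply: cmeasurableD => //; exact: mm.
  - move=> x; apply: le_trans (normcD _ _) _; apply: lerD => //; exact: (bb (- h)).
  - exact: mm.
  - exact/bb/qb.
apply/climitP => e e0.
pose C := d^-1 * d^-1 * d^-1 * (d / 2)^-1.
have C0 : 0 < 2 * C by rewrite /C !(mulr_gt0, invr_gt0).
have eC : 0 < e / (2 * C) by rewrite divr_gt0.
have near_e : \forall h \near nbhs0, normc h < e / (2 * C).
  have /climitP/(_ _ eC) := @climit_nbhs0 R; apply: filterS => h.
  by rewrite normcB subr0.
apply: filterS2 near_h near_e => h hd he.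
(* By the same resolvent identity [q 0] - [q h] = h [r], and [r] is bounded by C; the factor 2 in
   the estimates comes from integrating real and imaginary parts separately. *)
pose r x := k2 x * cauchy_kernel z x * cauchy_kernel (z + h) x.
have rm : cmeasurable r by do 2 (apply: cmeasurableM => //).
have rb : cbounded r C.
  by apply: cboundedM; [exact: cboundedM|exact/cauchy_kernel_bounded/off_supportD].
have -> : cint mu (q 0) = cint mu (q h) + h * cint mu r.
  have hm : cmeasurable (fun x => h * r x) by apply: cmeasurableM => //; exact: cmeasurable_cst.
  have hb : cbounded (fun x => h * r x) (normc h * C).
    by apply: cboundedM => //; exact: cbounded_cst.
  rewrite -(cintZ mu h rm rb) -(cintD mu (qm h) (qb _ hd) hm hb).
  congr (cint mu _); apply/funext => x; rewrite /q /r /k2 addr0 /cauchy_kernel.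
  have zhd := off_supportD zd hd.
  field; apply/andP; split; first by rewrite (off_support_neq0 x zhd).
  exact: off_support_neq0 x zd.
rewrite addrC addKr normcM; apply: le_lt_trans (_ : normc h * (2 * C) < e).
  by rewrite ler_wpM2l ?normc_ge0//; exact: normc_cint_le.
by rewrite -ltr_pdivlMr.
Qed.
End CauchyTransform.

Section CauchyTransformValues.
Context {R : realType} (mu : probability R R).
Implicit Types (z : R[i]) (x : R).
Hypothesis mu_pos : (0 < mu (`]0%R, +oo[%classic : set R))%E.

Lemma Rintegral_gt0 (A : set R) (u : R -> R) (B : R) : measurable A -> (0 < mu A)%E ->
  measurable_fun setT u -> (forall x, `|u x| <= B) -> (forall x, 0 <= u x) ->
  (forall x, A x -> 0 < u x) -> 0 < (\int[mu]_x u x)%R.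
Proof.
move=> mA A0 mu_ uB u0 uA; rewrite lt_neqAle Rintegral_ge0 ?andbT//.
apply/eqP => i0; have iu := bounded_integrable mu mu_ uB.
have : (\int[mu]_x `|(u x)%:E|)%E = 0%E.
  under eq_integral do rewrite gee0_abs ?lee_fin//.
  have fi : (\int[mu]_x (u x)%:E)%E \is a fin_num by exact: integrable_fin_num.
  by rewrite -(fineK fi) -[fine _]/(Rintegral mu setT u) -i0.
have mu' : measurable_fun setT (EFin \o u) by exact/measurable_EFinP.
move/(ae_eq_integral_abs mu measurableT mu').
case=> N [mN N0 uN]; move: A0; apply/negP; rewrite -leNgt -N0.
apply: le_measure; rewrite ?inE// => x Ax; apply: uN => /= /(_ I) [] ux0.
by have := uA _ Ax; rewrite ux0 ltxx.
Qed.

(** For fixed z all values of the kernel lie in one open half-plane bounded by a line through 0,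
    which is rotated onto the right half-plane. By convexity, integrals of the kernel against
    nonzero positive weights cannot vanish. *)
Lemma upper_slit_half_plane z : upper_slit z ->
  exists l : R[i], forall x, 0 <= x -> 0 < complex.Re (l * (z - x%:C)^-1).
Proof.
case: z => a b [/= b0|[/= b0 a0]].
  exists 'i => x _; rewrite ReM ReV ImV /= mul0r mul1r sub0r opprK subr0.
  by rewrite divr_gt0// ltr_wpDl ?sqr_ge0// exprn_gt0.
exists (-1) => x x0; rewrite ReM ReV ImV /= b0 subrr expr0n /= addr0 oppr0 mul0r subr0.
rewrite mulN1r -mulNr opprB divr_gt0//; first by lra.
rewrite exprn_even_gt0//=; lra.
Qed.

Local Notation Gm := (cint mu (cauchy_kernel (R := R))).

Lemma cauchy_neq0 z : upper_slit z -> cint mu (cauchy_kernel z) != 0.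
Proof.
move=> sz; have [l lz] := upper_slit_half_plane sz.
have [d zd] := upper_slit_off_support sz.
have km := cauchy_kernel_measurable z; have kb := cauchy_kernel_bounded zd.
apply/eqP => G0.
have : 0 < (\int[mu]_x complex.Re (l * cauchy_kernel z x))%R.
  apply: (@Rintegral_gt0 setT _ (normc l * d^-1)) => //.
  - by rewrite [X in (_ < X)%E](@probability_setT _ _ _ mu).
  - by case: (cmeasurableM (cmeasurable_cst l) km).
  - move=> x; apply: le_trans (Re_le_normc _) _.
    exact: (cboundedM (cbounded_cst l) kb).
  - by move=> x; apply/ltW/lz/max0_ge0.
  - by move=> x _; apply/lz/max0_ge0.
have -> : (\int[mu]_x complex.Re (l * cauchy_kernel z x))%R =
    complex.Re (cint mu (fun x => l * cauchy_kernel z x)) by [].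
by rewrite (cintZ mu l km kb) G0 mulr0 ltxx.
Qed.

Definition cauchy_K z := z - (cint mu (cauchy_kernel z))^-1.

(** If K(z) = - c with c >= 0, then (z + c) G(z) = 1, that is, the integral of (x + c) / (z - x)
    vanishes. But these values lie in an open half-plane for x > 0, and mu charges ]0, +oo[. *)
Lemma cauchy_K_off_negative z : upper_slit z -> off_negative (cauchy_K z).
Proof.
move=> sz; have [l lz] := upper_slit_half_plane sz.
have [d zd] := upper_slit_off_support sz.
have km := cauchy_kernel_measurable z; have kb := cauchy_kernel_bounded zd.
have G0 := cauchy_neq0 sz.
have [//|[c c0 KE]] := off_negativeP (cauchy_K z); exfalso.
have G1 : (z + c%:C) * cint mu (cauchy_kernel z) = 1.
  have -> : z + c%:C = (cint mu (cauchy_kernel z))^-1.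
    by move: KE => /eqP; rewrite /cauchy_K subr_eq => /eqP {1}->; rewrite rmorphN /=; ring.
  by rewrite mulVf.
have mb : cmeasurable (fun x => (z + c%:C) * cauchy_kernel z x).
  by apply: cmeasurableM => //; exact: cmeasurable_cst.
have bb := cboundedM (cbounded_cst (z + c%:C)) kb.
have I0 : cint mu (fun x => (z + c%:C) * cauchy_kernel z x + -1) = 0.
  rewrite (cintD mu mb bb (cmeasurable_cst _) (cbounded_cst (-1))).
  by rewrite (cintZ mu _ km kb) cint_cst G1 subrr.
pose f x := (z + c%:C) * cauchy_kernel z x + -1.
have fE x : f x = (Num.max x 0 + c)%:C * cauchy_kernel z x.
  rewrite /f rmorphD /= /cauchy_kernel; field.
  by rewrite (off_support_neq0 x zd).
have fm : cmeasurable f by apply: cmeasurableD => //; exact: cmeasurable_cst.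
have fb : cbounded f (normc (z + c%:C) * d^-1 + normc (-1)).
  by move=> x; apply: le_trans (normcD _ _) _; rewrite lerD.
have : 0 < (\int[mu]_x complex.Re (l * f x))%R.
  have lf x : complex.Re (l * f x) =
      (Num.max x 0 + c) * complex.Re (l * cauchy_kernel z x).
    by rewrite fE mulrCA ReCM.
  apply: (@Rintegral_gt0 (`]0%R, +oo[%classic : set R) _
    (normc l * (normc (z + c%:C) * d^-1 + normc (-1)))) => //.
  - by case: (cmeasurableM (cmeasurable_cst l) fm).
  - move=> x; apply: le_trans (Re_le_normc _) _.
    exact: (cboundedM (cbounded_cst l) fb).
  - move=> x; rewrite lf mulr_ge0// ?addr_ge0 ?max0_ge0//.
    by apply/ltW/lz/max0_ge0.
  - move=> x /=; rewrite in_itv/= andbT => x0; rewrite lf mulr_gt0//.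
      by rewrite ltr_pwDl// lt_max x0.
    exact/lz/max0_ge0.
have -> : (\int[mu]_x complex.Re (l * f x))%R =
    complex.Re (cint mu (fun x => l * f x)) by [].
by rewrite (cintZ mu l fm fb) I0 mulr0 ltxx.
Qed.

Lemma taylor2_cauchy_K z : upper_slit z -> taylor2 cauchy_K z.
Proof.
move=> sz; apply: taylor2B; first exact: taylor2_id.
by apply: taylor2_inv; [exact: taylor2_cauchy|exact: cauchy_neq0].
Qed.

End CauchyTransformValues.

(** * Analytic continuation *)

Section IdentityTheorem.
Context {R : realType}.
Implicit Types (f : R[i] -> R[i]) (z w : R[i]).

(* The strip 0 <= Im w < pi is mapped by - exp (- w) onto the upper half-plane together with
   the negative reals, which are the image of the real axis. *)
Lemma upper_strip (x y : R) : 0 <= y < pi -> upper_slit (- cexp (- (x +i* y))).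
Proof.
move=> /andP[]; rewrite le_eqVlt => /orP[/eqP <-|y0] ypi.
  right; rewrite /cexp /cexpi /= oppr0 cos0 sin0; split; first by ring.
  by rewrite mulr1 mulr0 subr0 oppr_lt0 expR_gt0.
left; rewrite /cexp /cexpi /= mul0r addr0 sinN mulrN opprK mulr_gt0 ?expR_gt0//.
by rewrite sin_gt0_pi// y0.
Qed.

Lemma upper_strip_onto z : 0 < complex.Im z ->
  exists x y : R, 0 < y < pi /\ z = - cexp (- (x +i* y)).
Proof.
move=> z0.
have oz : off_negative (- z).
  have [//|[c _ zE]] := off_negativeP (- z).
  by move: zE => /(congr1 (fun w => complex.Im w)); case: z z0 => a b /= + /eqP;
    rewrite oppr_eq0 => + /eqP b0; rewrite b0 ltxx.
exists (- complex.Re (clog (- z))), (- complex.Im (clog (- z))); split; last first.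
  rewrite -[LHS]opprK -{1}(cexp_clog oz); congr (- cexp _).
  by case: (clog _) => a b; apply/eqP; rewrite eq_complex /= !opprK !eqxx.
rewrite /clog /= -mulrN -atanN -mulNr raddfN opprK.
set u := _ / _.
have u0 : 0 < u by rewrite divr_gt0.
have := atan_ltpi2 u; have := lt_atan u0; rewrite atan0 => a0 a1.
by apply/andP; split; lra.
Qed.

Lemma taylor2_bounded f (x1 x2 y1 y2 : R) : x1 <= x2 -> y1 <= y2 ->
  (forall x y, x1 <= x <= x2 -> y1 <= y <= y2 -> taylor2 f (x +i* y)) ->
  exists M : R, forall x y, x1 <= x <= x2 -> y1 <= y <= y2 -> normc (f (x +i* y)) <= M.
Proof.
move=> x12 y12 fT.
pose Q : set (R * R) := `[x1, x2] `*` `[y1, y2].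
pose u (q : R * R) : R := normc (f (q.1 +i* q.2)).
have cQ : compact Q by apply: compact_setX; exact: segment_compact.
have cu : {within Q, continuous u}.
  apply: continuous_in_subspaceT => q; rewrite inE => -[/= q1 q2].
  have cC : climit (nbhs q) (fun q => q.1 +i* q.2) (q.1 +i* q.2).
    by apply: climit_complex; [exact: cvg_fst|exact: cvg_snd].
  rewrite /continuous_at -rlimit_cvgE /u.
  exact: climit_normc (climit_compC cC (taylor2_continuous (fT _ _ q1 q2))).
have Q0 : Q !=set0 by exists (x1, y1); split; rewrite /= in_itv/= lexx.
have [c _ cmax] := compact_EVT_max Q0 cQ cu.
by exists (u c) => x y hx hy; apply: (cmax (x, y)); rewrite inE.
Qed.

Lemma identity_theorem f : (forall z, upper_slit z -> taylor2 f z) ->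
  (forall x : R, x < 0 -> f x%:C = 0) -> forall z, 0 < complex.Im z -> f z = 0.
Proof.
move=> fT f0 z /upper_strip_onto[x0 [y0 [/andP[y00 y0pi] ->]]] {z}.
(* The height is chosen strictly between y0 and pi: the rectangle stays inside the strip and z0 lies
   below its top side. *)
pose h := (y0 + pi) / 2.
have y0h : y0 < h by rewrite /h; lra.
have hpi : h < pi by rewrite /h; lra.
have h0 : 0 < h by apply: lt_trans y0h.
pose F w := f (- cexp (- w)).
have FT x y : x0 - h <= x <= x0 + h -> 0 <= y <= h -> taylor2 F (x +i* y).
  move=> _ /andP[y_0 yh].
  apply: (taylor2_comp (g := f) (f := fun w => - cexp (- w))).
    apply: taylor2N; apply: (taylor2_comp (g := cexp) (f := fun w => - w)).
      by apply: taylor2N; exact: taylor2_id.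
    exact: taylor2_cexp.
  by apply/fT/upper_strip; rewrite y_0 (le_lt_trans yh).
have [M FM] : exists M : R, forall x y, x0 - h <= x <= x0 + h -> 0 <= y <= h ->
    normc (F (x +i* y)) <= M.
  by apply: taylor2_bounded => //; lra.
set z0 := _ +i* _; change (F z0 = 0); apply/eqP/negPn/negP => F0.
have nF0 : 0 < normc (F z0) by rewrite normc_gt0.
(* This factor turns the real part of l F at z0 into |F(z0)|^2, so that the maximum principle for
   real parts bounds a modulus. *)
pose l := conjc (F z0).
pose c := x0 +i* h.
(* On the three sides of the rectangle where F may not vanish the Gaussian factor is at most 1,
   while at z0 it tends to infinity with N. *)
pose g (N : R) w := l * F w * cexp (- (N%:C * (w - c) ^+ 2)).
have key N : 0 <= N ->
    normc (F z0) ^+ 2 * expR (N * (h - y0) ^+ 2) <= normc l * M.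
  move=> N0.
  have phiE x y : complex.Re (- (N%:C * ((x +i* y) - c) ^+ 2)) =
      N * ((y - h) ^+ 2 - (x - x0) ^+ 2).
    by rewrite raddfN /= ; ring.
  have -> : normc (F z0) ^+ 2 * expR (N * (h - y0) ^+ 2) = complex.Re (g N z0).
    rewrite /g; have -> : - (N%:C * (z0 - c) ^+ 2) = (N * (h - y0) ^+ 2)%:C.
      by apply/eqP; rewrite eq_complex; apply/andP; split; apply/eqP => /=; ring.
    rewrite cexp_real [X in complex.Re X]mulrC ReCM mulrC; congr (_ * _).
    by rewrite normc_sqr /l; case: (F z0) => a b /=; ring.
  apply: (@maximum_principle R (g N) (x0 - h) (x0 + h) 0 h).
  - move=> x y hx hy; apply: taylor2M.
      by apply: taylor2M; [exact: taylor2_cst|exact: FT].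
    apply: (taylor2_comp (g := cexp)); last exact: taylor2_cexp.
    apply/taylor2N/taylor2M; first exact: taylor2_cst.
    by apply: taylor2M; (apply: taylor2B; [exact: taylor2_id|exact: taylor2_cst]).
  - move=> x y hx hy bd; have [y_0|y_0] := eqVneq y 0.
      have -> : g N (x +i* y) = 0.
        rewrite /g /F y_0; have -> : - (x +i* 0) = (- x)%:C.
          by apply/eqP; rewrite eq_complex /= oppr0 !eqxx.
        rewrite cexp_real -[X in f X]rmorphN f0 ?oppr_lt0 ?expR_gt0//.
        by rewrite mulr0 mul0r.
      have := normc_ge0 (F (x +i* y)); have := FM _ _ hx hy; have := normc_ge0 l.
      by move=> ? ? ? /=; rewrite mulr_ge0//; lra.
    apply: le_trans (le_trans (ler_norm _) (Re_le_normc _)) _.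
    rewrite /g normcM normc_cexp normcM phiE -[leRHS]mulr1.
    apply: ler_pM; rewrite ?mulr_ge0 ?normc_ge0 ?expR_ge0//.
      by rewrite ler_wpM2l ?normc_ge0 ?FM.
    (* On the vertical sides |x - x0| = h >= h - y, which is why the half-width equals the height;
       on the top side y = h. *)
    rewrite -expR0 ler_expR mulr_ge0_le0// subr_le0.
    move: hx hy => /andP[hx1 hx2] /andP[hy1 hy2].
    move: bd; rewrite (negbTE y_0) /= => /or3P[/eqP ->|/eqP ->|/eqP ->].
    + have -> : x0 - h - x0 = - h by ring.
      by rewrite sqrrN -subr_ge0; nra.
    + have -> : x0 + h - x0 = h by ring.
      by rewrite -subr_ge0; nra.
    + by rewrite subrr expr0n sqr_ge0.
  - by rewrite lerBlDr !lerDl ltW.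
  - by rewrite !ltW.
have a0 : 0 < (h - y0) ^+ 2 by rewrite exprn_gt0// subr_gt0.
pose C := normc l * M; pose A := normc (F z0) ^+ 2.
have A0 : 0 < A by rewrite exprn_gt0.
have C0 : 0 <= C by have := key 0 (lexx _); rewrite mul0r expR0 mulr1; exact: le_trans (ltW A0).
(* For this N the exponent N (h - y0)^2 equals C / A, and 1 + u <= exp u turns the estimate into A +
   C <= C. *)
have N0 : 0 <= C / (A * (h - y0) ^+ 2) by rewrite divr_ge0// mulr_ge0// ltW.
have := key _ N0; rewrite -/A -/C => AC.
have := expR_ge1Dx (C / (A * (h - y0) ^+ 2) * (h - y0) ^+ 2).
rewrite -(ler_pM2l A0) => /le_trans /(_ AC).
have -> : A * (1 + C / (A * (h - y0) ^+ 2) * (h - y0) ^+ 2) = A + C.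
  by field; rewrite !gt_eqF ?subr_gt0.
by rewrite gerDr leNgt A0.
Qed.
End IdentityTheorem.

(** * Continuation of the defining relation to the half-plane *)

Section Continuation.
Context {R : realType}.
Implicit Types (mu nu : probability R R) (z : R[i]).

Lemma F_transform_K mu z : on_nonneg mu -> z - F_transform mu z = cauchy_K mu z.
Proof. by move=> mu0; rewrite /F_transform (G_transformE _ mu0). Qed.

Lemma cauchy_real mu (x : R) : complex.Im (cint mu (cauchy_kernel x%:C)) = 0.
Proof.
rewrite /cint /= /Rintegral.
under eq_integral => y _ do rewrite subrr mul0r oppr0.
by rewrite integral0.
Qed.

Lemma cauchy_K_real mu (x : R) : x < 0 ->
  (0 < mu (`]0%R, +oo[%classic : set R))%E ->
  exists2 a : R, 0 < a & cauchy_K mu x%:C = a%:C.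
Proof.
move=> x0 mup.
have sx : upper_slit x%:C by right.
have := cauchy_K_off_negative mup sx.
have KE : cauchy_K mu x%:C = (complex.Re (cauchy_K mu x%:C))%:C.
  suff i0 : complex.Im (cauchy_K mu x%:C) = 0.
    by apply/eqP; rewrite eq_complex eqxx i0 eqxx.
  by rewrite ImB ImV cauchy_real mul0r oppr0 subr0.
rewrite KE; set a := complex.Re _.
rewrite /off_negative normcC /= => aa; exists a => //.
rewrite ltNge; apply/negP => a0.
by move: aa; rewrite ler0_norm// addNr ltxx.
Qed.

Lemma cpow_real (a t : R) : 0 < a -> cpow a%:C t = cexp (t%:C * clog a%:C).
Proof.
move=> a0; rewrite clog_real// -rmorphM cexp_real /cpow /carg /cmod normcC.
rewrite gtr0_norm//= lexx divff ?gt_eqF// acos1 mulr0 /cexpi cos0 sin0 mulr1.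
by rewrite /powR gt_eqF.
Qed.

(** The product form lets the identity theorem apply before anything is known about zeros of z -
    K^t; that this factor does not vanish is then a consequence. *)
Lemma mult_boolean_continuation mu nu (t : R) : on_nonneg mu ->
  (0 < mu (`]0%R, +oo[%classic : set R))%E -> is_mult_boolean_power mu t nu ->
  forall z, 0 < complex.Im z ->
    G_transform nu z * (z - cexp (t%:C * clog (z - F_transform mu z))) = 1.
Proof.
move=> mu0 mup [nu0 nuE] z z0; rewrite F_transform_K// G_transformE//.
apply/eqP; rewrite -subr_eq0; apply/eqP; move: z z0.
pose f z := cint nu (cauchy_kernel z) * (z - cexp (t%:C * clog (cauchy_K mu z))) - 1.
apply: (@identity_theorem R f) => [z sz|x x0].
  apply: taylor2B; last exact: taylor2_cst.
  apply: taylor2M; first exact: taylor2_cauchy.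
  apply: taylor2B; first exact: taylor2_id.
  apply: (taylor2_comp (g := cexp)); last exact: taylor2_cexp.
  apply: taylor2M; first exact: taylor2_cst.
  apply: (taylor2_comp (g := clog)); first exact: taylor2_cauchy_K.
  exact/taylor2_clog/cauchy_K_off_negative.
have sx : upper_slit x%:C by right.
have [a a0 aE] := cauchy_K_real x0 mup.
have G0 := cauchy_neq0 nu sx.
have xV : x^-1 < 0 by rewrite invr_lt0.
(* At the point 1 / x the quotient eta(z) / z is x - F(x), so the defining relation reads K_nu =
   K_mu^t. *)
have etaE (m : probability R R) : on_nonneg m ->
    eta_transform m (x^-1)%:C / (x^-1)%:C = cauchy_K m x%:C.
  move=> m0; rewrite -F_transform_K// /eta_transform !fmorphV invrK.
  have x0' : x%:C != 0 :> R[i] by rewrite eq_complex /= eqxx andbT lt_eqF.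
  by field.
have := nuE _ xV; rewrite !etaE// aE cpow_real// => KE.
by rewrite /f aE -KE /cauchy_K opprB addrC subrKC mulfV// addNr.
Qed.

End Continuation.

(** * Stieltjes inversion *)

Section Poisson.
Context {R : realType} (nu : probability R R).
Implicit Types (x y s u : R).

(** The Poisson kernel of the half-plane without its factor 1 / pi, so that its integral is exactly
    - Im G(x + iy). *)
Definition poisson_kernel y u : R := y / (u ^+ 2 + y ^+ 2).

Definition poisson x y : R := (\int[nu]_s poisson_kernel y (x - s))%R.

Definition mass (A : set R) : R := fine (nu A).

Lemma poisson_kernel_ge0 y u : 0 < y -> 0 <= poisson_kernel y u.
Proof. by move=> y0; rewrite /poisson_kernel divr_ge0// ?addr_ge0// ?sqr_ge0// ltW. Qed.

Lemma poisson_kernel_le y u : 0 < y -> poisson_kernel y u <= y^-1.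
Proof.
move=> y0; rewrite ler_pdivrMr; last by rewrite ltr_wpDl ?sqr_ge0// exprn_gt0.
by rewrite mulrDr expr2 [X in _ + X]mulrA mulVf ?gt_eqF// mul1r lerDr mulr_ge0 ?sqr_ge0// invr_ge0 ltW.
Qed.

Lemma continuous_poisson_kernel y : 0 < y -> continuous (poisson_kernel y).
Proof.
move=> y0 u; rewrite /continuous_at -rlimit_cvgE.
have idc : rlimit (nbhs u) (fun u => u) u by rewrite rlimit_cvgE; exact: cvg_id.
by rewrite /poisson_kernel; rlimit_tac; [rewrite gt_eqF// ltr_wpDl ?sqr_ge0// exprn_gt0|].
Qed.

Lemma measurable_poisson_kernel x y : 0 < y ->
  measurable_fun setT (fun s : R => poisson_kernel y (x - s)).
Proof.
move=> y0; apply: (measurableT_comp (f := poisson_kernel y)).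
  by apply: continuous_measurable_fun; exact: continuous_poisson_kernel.
by apply: measurable_funB => //; exact: measurable_cst.
Qed.

Lemma poisson_kernel_integrable x y : 0 < y ->
  nu.-integrable setT (EFin \o (fun s => poisson_kernel y (x - s))).
Proof.
move=> y0; apply: (@bounded_integrable _ _ _ y^-1) => [|s].
  exact: measurable_poisson_kernel.
by rewrite ger0_norm ?poisson_kernel_ge0// poisson_kernel_le.
Qed.

Lemma poissonE x y : 0 < y -> poisson x y = - complex.Im (G_transform nu (x +i* y)).
Proof.
move=> y0; have i1 := poisson_kernel_integrable x y0.
have -> : complex.Im (G_transform nu (x +i* y)) =
    (\int[nu]_s (-1 * poisson_kernel y (x - s)))%R.
  by apply: eq_Rintegral => s _; rewrite ImV /= subr0 mulN1r.
by rewrite RintegralZl// mulN1r opprK.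
Qed.

Lemma mass_ge0 A : 0 <= mass A. Proof. exact: fine_ge0. Qed.

Lemma massE A : measurable A -> (mass A)%:E = nu A.
Proof. by move=> mA; rewrite fineK// fin_num_measure. Qed.

Lemma le_mass A B : measurable A -> measurable B -> A `<=` B -> mass A <= mass B.
Proof.
by move=> mA mB AB; rewrite -lee_fin !massE//; apply: le_measure; rewrite ?inE.
Qed.

Lemma massU_le A B : measurable A -> measurable B -> mass (A `|` B) <= mass A + mass B.
Proof.
move=> mA mB; rewrite -lee_fin EFinD !massE//; last exact: measurableU.
exact: measureU2.
Qed.

Lemma Rintegral_indic A : measurable A -> (\int[nu]_s \1_A s)%R = mass A.
Proof. by move=> mA; rewrite /Rintegral integral_indic// setIT. Qed.

(** On the ball the kernel is at least 1 / (2 y). *)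
Lemma mass_ball_le x y : 0 < y -> mass `[x - y, x + y]%classic <= 2 * y * poisson x y.
Proof.
move=> y0; have mI : measurable (`[x - y, x + y]%classic : set R) by [].
rewrite -Rintegral_indic// -RintegralZl//; last exact: poisson_kernel_integrable.
apply: le_Rintegral => //.
- apply: (@bounded_integrable _ _ _ 1) => [|s]; first exact: measurable_indic.
  by rewrite ger0_norm// indic_le1.
- have := poisson_kernel_integrable x y0 => /(integrableZl measurableT (2 * y)).
  by apply: eq_integrable => // s _ /=.
move=> s _; rewrite indicE /=; case: (boolP (s \in _)) => [|_]; last first.
  by rewrite mulr_ge0 ?poisson_kernel_ge0// mulr_ge0// ltW.
rewrite inE /= in_itv/= => /andP[s1 s2]; rewrite mulrA ler_pdivlMr ?mul1r.
  nra.
by rewrite ltr_wpDl ?sqr_ge0// exprn_gt0.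
Qed.

(* Outside [x - 3y, x + 3y] the kernel of height y is at most 3/4 of the kernel of height 2y. *)
Lemma poisson_halving x y : 0 < y ->
  poisson x y <= 3 / 4 * poisson x (2 * y) + y^-1 * mass `[x - 3 * y, x + 3 * y]%classic.
Proof.
move=> y0; have y20 : 0 < 2 * y by rewrite mulr_gt0.
have mI : measurable (`[x - 3 * y, x + 3 * y]%classic : set R) by [].
have i1 := poisson_kernel_integrable x y0.
have i2 := poisson_kernel_integrable x y20.
have i3 : nu.-integrable setT (EFin \o (fun s => \1_(`[x - 3 * y, x + 3 * y]%classic : set R) s)).
  apply: (@bounded_integrable _ _ _ 1) => [|s]; first exact: measurable_indic.
  by rewrite ger0_norm// indic_le1.
have i4 := integrableZ_EFin (3 / 4) i2; have i5 := integrableZ_EFin y^-1 i3.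
rewrite -Rintegral_indic// -RintegralZl// -RintegralZl// -RintegralD//.
apply: le_Rintegral => //.
  by have := integrableD measurableT i4 i5; apply: eq_integrable.
move=> s _; rewrite indicE; case: (boolP (s \in _)) => [_|].
  rewrite mulr1 -[leLHS]add0r lerD ?poisson_kernel_le//.
  by rewrite mulr_ge0 ?poisson_kernel_ge0// divr_ge0.
rewrite notin_setE /= in_itv/= => /negP sI; rewrite mulr0 addr0.
have u2 : 5 * y ^+ 2 <= (x - s) ^+ 2.
  have [le1|lt1] := leP (x - 3 * y) s; last by nra.
  have [le2|lt2] := leP s (x + 3 * y); last by nra.
  by rewrite le1 le2 in sI.
rewrite /poisson_kernel ler_pdivrMr; last by rewrite ltr_wpDl ?sqr_ge0// exprn_gt0.
rewrite mulrA mulrAC ler_pdivlMr; last by rewrite ltr_wpDl ?sqr_ge0// exprn_gt0.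
nra.
Qed.

Lemma poisson_le x y : 0 < y -> poisson x y <= y^-1.
Proof.
move=> y0; rewrite -[leRHS](Rintegral_prob_cst nu); apply: le_Rintegral => //.
- exact: poisson_kernel_integrable.
- by apply: (@bounded_integrable _ _ _ `|y^-1|).
- by move=> s _; exact: poisson_kernel_le.
Qed.

Lemma poisson_ge0 x y : 0 < y -> 0 <= poisson x y.
Proof. by move=> y0; apply: Rintegral_ge0 => s _; exact: poisson_kernel_ge0. Qed.

(* Covering argument: the supremum of the points up to which the bound holds is the
   right end point. *)
Lemma mass_itv_le (a b L : R) :
  (forall x, a < x < b -> \forall y \near 0^'+,
     mass `[x - y, x + y]%classic <= L * y) ->
  forall c d, a < c -> c <= d -> d < b -> mass `[c, d]%classic <= L * (d - c).
Proof.
move=> small c d ac cd db.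
have L0 : 0 <= L.
  near (0 : R)^'+ => y.
  have y0 : 0 < y by near: y; exact: nbhs_right_gt.
  have : mass `[c - y, c + y]%classic <= L * y.
    by near: y; apply: small; rewrite ac (le_lt_trans cd).
  by move=> /(le_trans (mass_ge0 _)); rewrite pmulr_lge0.
pose S : set R := [set x | c <= x <= d /\ mass `[c, x]%classic <= L * (x - c)].
have Sc : S c.
  split; first by rewrite lexx.
  rewrite subrr mulr0; apply/ler_addgt0Pr => e e0; rewrite add0r.
  have Le : 0 < e / (L + 1) by rewrite divr_gt0// ltr_wpDl.
  near (0 : R)^'+ => y.
  have y0 : 0 < y by near: y; exact: nbhs_right_gt.
  apply: (@le_trans _ _ (L * y)).
    apply: (@le_trans _ _ (mass `[c - y, c + y]%classic)).
      apply: le_mass => // x /=; rewrite !in_itv/= => /andP[x1 x2]; lra.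
    by near: y; apply: small; rewrite ac (le_lt_trans cd).
  have : y < e / (L + 1) by near: y; exact: nbhs_right_lt.
  by rewrite ltr_pdivlMr ?ltr_wpDl// => ye; nra.
have hS : has_sup S by split; [exists c|exists d => x [/andP[]]].
pose m := sup S.
have cm : c <= m by apply: sup_upper_bound.
have md : m <= d by apply: ge_sup; [exists c|move=> x [/andP[]]].
have amb : a < m < b by rewrite (lt_le_trans ac)//= (le_lt_trans md).
have [e /= e0 em] := small m amb.
have me y : 0 < y -> y < e -> mass `[m - y, m + y]%classic <= L * y.
  by move=> y0 ye; apply: em => //=; rewrite sub0r normrN gtr0_norm.
have [x Sx xm] := sup_adherent e0 hS.
have xlem : x <= m by apply: sup_upper_bound.
have Sm : S m.
  have [/eqP xm'|xm'] := boolP (x == m); first by rewrite -xm'.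
  split; first by rewrite cm md.
  case: Sx => /andP[cx xd] Sx.
  have y0 : 0 < m - x by rewrite subr_gt0 lt_neqAle xm'.
  have := me _ y0 ltac:(rewrite -/m in xm; lra) => my.
  apply: (@le_trans _ _ (mass `[c, x]%classic + mass `[m - (m - x), m + (m - x)]%classic)).
    apply: le_trans (massU_le _ _) => //; apply: le_mass => //.
      exact: measurableU.
    move=> z /=; rewrite !in_itv/= => /andP[z1 z2].
    by have [zx|xz] := leP z x; [left; lra|right; lra].
  by apply: le_trans (lerD Sx my) _; rewrite -mulrDr; apply: ler_wpM2l => //; lra.
have [md0|mned] := eqVneq m d; first by case: Sm; rewrite md0.
have {}mned : m < d by rewrite lt_neqAle mned.
pose y := Num.min (e / 2) (d - m).
have y0 : 0 < y by rewrite lt_min divr_gt0//= subr_gt0.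
have ye : y < e by rewrite gt_min; apply/orP; left; lra.
have yd : y <= d - m by rewrite ge_min lexx orbT.
have : S (m + y).
  split; first by lra.
  case: Sm => _ Sm.
  apply: (@le_trans _ _ (mass `[c, m]%classic + mass `[m - y, m + y]%classic)).
    apply: le_trans (massU_le _ _) => //; apply: le_mass => //.
      exact: measurableU.
    move=> z /=; rewrite !in_itv/= => /andP[z1 z2].
    by have [zx|xz] := leP z m; [left; lra|right; lra].
  by apply: le_trans (lerD Sm (me _ y0 ye)) _; rewrite -mulrDr; apply: ler_wpM2l => //; lra.
by move=> /(sup_upper_bound hS); rewrite -/m gerDl leNgt y0.
Unshelve. all: end_near. Qed.

(** For heights at least e the trivial bound 1 / e applies. Smaller heights are reached by repeated
    halving, and [poisson_halving] preserves the bound M because the mass term contributes at most 6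
    L. *)
Lemma poisson_bounded (a b L : R) :
  (forall x, a < x < b -> \forall y \near 0^'+,
     mass `[x - y, x + y]%classic <= L * y) ->
  forall c d, a < c -> d < b -> exists M : R,
  forall x y, c <= x <= d -> 0 < y -> poisson x y <= M.
Proof.
move=> small c d ac db.
have [dc|cd] := ltP d c.
  by exists 0 => x y /andP[cx xd]; have := le_lt_trans (le_trans cx xd) dc; rewrite ltxx.
have bnd := mass_itv_le small.
(* Intervals of half-width 3 e around points of [c, d] stay inside ]a, b[. *)
pose e := Num.min ((c - a) / 6) ((b - d) / 6).
have e0 : 0 < e by rewrite lt_min !divr_gt0// subr_gt0.
have e1 : 6 * e <= c - a.
  by have : e <= (c - a) / 6; [rewrite ge_min lexx|lra].
have e2 : 6 * e <= b - d.
  by have : e <= (b - d) / 6; [rewrite ge_min lexx orbT|lra].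
(* 24 L is the threshold from which 3/4 M + 6 L <= M. *)
pose M := Num.max e^-1 (24 * L).
exists M => x y /andP[cx xd] y0.
have step n z : e / 2 ^+ n <= z -> poisson x z <= M.
  elim: n z => [|n IH] z.
    rewrite expr0 divr1 => ez; have z0 : 0 < z by apply: lt_le_trans ez.
    by apply: le_trans (poisson_le x z0) _; rewrite le_max lef_pV2 ?posrE// ez.
  rewrite exprS => ez; have z0 : 0 < z by apply: lt_le_trans ez; rewrite divr_gt0 ?mulr_gt0.
  have [ez0|ze] := leP e z.
    by apply: le_trans (poisson_le x z0) _; rewrite le_max lef_pV2 ?posrE// ez0.
  apply: le_trans (poisson_halving x z0) _.
  have h1 : poisson x (2 * z) <= M.
    apply: IH; have -> : e / 2 ^+ n = 2 * (e / (2 * 2 ^+ n)).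
      by field; rewrite expf_neq0.
    by rewrite ler_pM2l.
  have h2 : z^-1 * mass `[x - 3 * z, x + 3 * z]%classic <= 6 * L.
    rewrite ler_pdivrMl//; apply: le_trans (bnd _ _ _ _ _) _; lra.
  have h3 : 24 * L <= M by rewrite le_max lexx orbT.
  lra.
have [n yn] : exists n : nat, e / y < 2 ^+ n.
  exists (Num.bound (e / y)); apply: (lt_le_trans (archi_boundP _)).
    by rewrite divr_ge0// ltW.
  by rewrite -natrX ler_nat ltnW// ltn_expl.
apply: (step n); rewrite ler_pdivrMr ?exprn_gt0//.
by move: yn; rewrite ltr_pdivrMr// mulrC => /ltW.
Qed.
End Poisson.

Section StieltjesInversion.
Context {R : realType} (nu : probability R R).
Context (phi dphi : R -> R) (p q : R).
Hypothesis dphiE : forall v, p < v < q -> is_derive v (1 : R) phi (dphi v).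
Hypothesis dphi_cont : forall v, p < v < q -> {for v, continuous dphi}.
Hypothesis dphi_gt0 : forall v, p < v < q -> 0 < dphi v.
Context (c d : R).
Hypotheses (pc : p < c) (cd : c < d) (dq : d < q).

Let cdpq v : v \in `[c, d] -> p < v < q.
Proof.
by rewrite in_itv/= => /andP[cv vd]; rewrite (lt_le_trans pc cv) (le_lt_trans vd dq).
Qed.

Let phi_cont v : p < v < q -> {for v, continuous phi}.
Proof.
move=> v01; apply: differentiable_continuous; apply/derivable1_diffP.
exact: (@ex_derive _ _ _ _ _ _ _ (dphiE v01)).
Qed.

Definition arc y s := atan ((phi d - s) / y) - atan ((phi c - s) / y).

(** With the weight [dphi], atan ((phi v - s) / y) is a primitive in v; this is where the
    substitution x = phi v takes place. *)
Lemma integral_poisson_kernel y s : 0 < y ->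
  (\int[lebesgue_measure]_(v in `[c, d]) (poisson_kernel y (phi v - s) * dphi v)%:E =
   (arc y s)%:E)%E.
Proof.
move=> y0.
have dF v : p < v < q -> is_derive v (1 : R) (fun v => atan ((phi v - s) / y))
    (poisson_kernel y (phi v - s) * dphi v).
  move=> v01; have dv := dphiE v01.
  have d1 : is_derive v (1 : R) (fun v => (phi v - s) / y) (dphi v / y).
    rewrite (_ : (fun v => _) = (fun v => y^-1 *: (phi v - s))); last first.
      by apply/funext => w; rewrite /GRing.scale /= mulrC.
    by apply: is_derive_eq; rewrite subr0 /GRing.scale /= mulrC.
  have d2 := @is_derive1_comp R atan (fun v => (phi v - s) / y) v _ _ (is_derive1_atan _) d1.
  apply: (is_derive_eq d2); rewrite /poisson_kernel.
  have y0' : y != 0 by rewrite gt_eqF.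
  have h : (phi v - s) ^+ 2 + y ^+ 2 != 0.
    by rewrite gt_eqF// ltr_wpDl ?sqr_ge0// exprn_gt0.
  have -> : 1 + ((phi v - s) / y) ^+ 2 = ((phi v - s) ^+ 2 + y ^+ 2) / y ^+ 2.
    by field.
  by rewrite invf_div; move: (_ + _) h => D h; field; rewrite y0' h.
have cF v : p < v < q -> {for v, continuous (fun v => atan ((phi v - s) / y))}.
  move=> v01; apply: differentiable_continuous; apply/derivable1_diffP.
  exact: (@ex_derive _ _ _ _ _ _ _ (dF v v01)).
rewrite /arc EFinB; apply: (@continuous_FTC2 R _ (fun v => atan ((phi v - s) / y))) => //.
- apply: continuous_in_subspaceT => v; rewrite inE => /cdpq v01.
  have /continuous_rlimit hp := phi_cont v01.
  have /continuous_rlimit hd := dphi_cont v01.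
  have pv : rlimit (nbhs v) (fun v => phi v - s) (phi v - s) by rlimit_tac.
  have cp : {for phi v - s, continuous (poisson_kernel y)}.
    exact: continuous_poisson_kernel.
  have h2 := rlimit_continuous cp pv.
  by apply/continuous_rlimit; rlimit_tac.
- split.
  + move=> v; rewrite in_itv/= => /andP[cv vd].
    by apply: (@ex_derive _ _ _ _ _ _ _ (dF v _)); rewrite (lt_trans pc cv) (lt_trans vd dq).
  + apply: cvg_at_right_filter; apply: cF; rewrite pc (lt_trans cd dq)//.
  + apply: cvg_at_left_filter; apply: cF; rewrite dq (lt_trans pc cd)//.
- move=> v; rewrite in_itv/= => /andP[cv vd].
  rewrite derive1E; apply: (@derive_val _ _ _ _ _ _ _ (dF v _)).
  by rewrite (lt_trans pc cv) (lt_trans vd dq).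
Qed.

Let measurable_phi : measurable_fun setT (phi \_ `[c, d]).
Proof.
apply/(measurable_restrictT _ _).1 => //.
apply: subspace_continuous_measurable_fun => //.
by apply: continuous_in_subspaceT => v; rewrite inE => /cdpq /phi_cont.
Qed.

Let measurable_dphi : measurable_fun setT (dphi \_ `[c, d]).
Proof.
apply/(measurable_restrictT _ _).1 => //.
apply: subspace_continuous_measurable_fun => //.
by apply: continuous_in_subspaceT => v; rewrite inE => /cdpq /dphi_cont.
Qed.

(** The integrand is extended by 0 outside [c, d], through the factor [dphi], so that Tonelli's
    theorem applies on the whole plane. *)
Let f y (w : R * R) : \bar R :=
  (poisson_kernel y ((phi \_ `[c, d]) w.1 - w.2) * (dphi \_ `[c, d]) w.1)%:E.

Let f_ge0 y w : 0 < y -> (0 <= f y w)%E.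
Proof.
move=> y0; rewrite lee_fin mulr_ge0 ?poisson_kernel_ge0// patchE.
by case: ifPn => // /set_mem /cdpq /dphi_gt0 /ltW.
Qed.

Let measurable_f y : 0 < y -> measurable_fun setT (f y).
Proof.
move=> y0; apply/measurable_EFinP; apply: measurable_funM.
  apply: (measurableT_comp (f := poisson_kernel y)).
    by apply: continuous_measurable_fun; exact: continuous_poisson_kernel.
  apply: measurable_funB; last exact: measurable_snd.
  exact: (measurableT_comp measurable_phi measurable_fst).
exact: (measurableT_comp measurable_dphi measurable_fst).
Qed.

Let integral_f y v : 0 < y -> (\int[nu]_s f y (v, s) =
  ((fun v => (poisson nu (phi v) y * dphi v)%:E) \_ `[c, d]) v)%E.
Proof.
move=> y0; rewrite patchE /f /=; case: ifPn => vcd; last first.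
  rewrite integral0_eq// => s _.
  by rewrite [X in _ * X]patchE (negbTE vcd) mulr0.
rewrite !patchE vcd mulrC; under eq_integral do rewrite mulrC EFinM.
have ip := poisson_kernel_integrable nu (phi v) y0.
rewrite integralZl// EFinM; congr (_ * _)%E.
by rewrite /poisson /Rintegral fineK//; exact: integrable_fin_num ip.
Qed.

Lemma measurable_poisson y : 0 < y ->
  measurable_fun `[c, d] (fun v => poisson nu (phi v) y * dphi v).
Proof.
move=> y0; apply/measurable_EFinP.
apply/(measurable_restrictT _ _).2 => //.
rewrite (_ : _ \_ _ = fun v => (\int[nu]_s f y (v, s))%E).
  apply: measurable_fun_fubini_tonelli_F; first exact: measurable_f.
  by move=> w; exact: f_ge0.
by apply/funext => v; rewrite integral_f.
Qed.

Lemma poisson_fubini y : 0 < y ->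
  (\int[lebesgue_measure]_(v in `[c, d]) (poisson nu (phi v) y * dphi v)%:E =
   \int[nu]_s (arc y s)%:E)%E.
Proof.
move=> y0.
have := @fubini_tonelli _ _ _ _ _ lebesgue_measure nu (f y) (measurable_f y0)
  (fun w => f_ge0 w y0).
under eq_integral do rewrite integral_f//.
rewrite -integral_mkcond => ->; apply: eq_integral => s _.
rewrite -(integral_poisson_kernel s y0) [RHS]integral_mkcond.
apply: eq_integral => v _; rewrite [RHS]patchE /f /=; case: ifPn => vcd.
  by rewrite !patchE vcd.
by rewrite [X in _ * X]patchE (negbTE vcd) mulr0.
Qed.
End StieltjesInversion.

Section StieltjesLimit.
Context {R : realType} (nu : probability R R).
Context (phi dphi : R -> R) (p q : R).
Hypothesis dphiE : forall v, p < v < q -> is_derive v (1 : R) phi (dphi v).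
Hypothesis dphi_cont : forall v, p < v < q -> {for v, continuous dphi}.
Hypothesis dphi_gt0 : forall v, p < v < q -> 0 < dphi v.
Hypothesis phi_incr : forall v w, p < v -> v < w -> w < q -> phi v < phi w.
Context (a b C : R) (U : R -> R).
Hypothesis phi_ab : forall v, p < v < q -> a < phi v < b.
Hypothesis poissonU : forall x, a < x < b -> rlimit (0 : R)^'+ (poisson nu x) (U x).
Hypothesis UC : forall x, a < x < b -> U x <= C.

(** Near 0 the Poisson integral is at most U x + 1 <= C + 1, and a ball has mass at most 2 y times
    this integral. *)
Let small_mass x : a < x < b -> \forall y \near 0^'+,
  mass nu `[x - y, x + y]%classic <= (2 * (C + 1)) * y.
Proof.
move=> xab; have /rlimitP/(_ _ ltr01) := poissonU xab.
have h : \forall y \near (0 : R)^'+, 0 < y by exact: nbhs_right_gt.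
apply: filterS2 h => y y0; rewrite ltr_norml => /andP[h _].
apply: le_trans (mass_ball_le nu x y0) _; rewrite mulrAC ler_pM2r//.
by rewrite ler_pM2l//; have := UC xab; lra.
Qed.

Let no_atom x : a < x < b -> mass nu [set x] = 0.
Proof.
move=> /andP[ax xb]; apply/eqP; rewrite eq_le mass_ge0 andbT.
by have := mass_itv_le small_mass ax (lexx x) xb; rewrite subrr mulr0 set_itv1.
Qed.

Let y_ (n : nat) : R := n.+1%:R^-1.

Let y_gt0 n : 0 < y_ n.
Proof. by rewrite invr_gt0. Qed.

Let y_cvg : y_ n @[n --> \oo] --> (0 : R)^'+.
Proof.
move=> A; rewrite /nbhs /= /at_right => -[e /= e0 eA].
have : y_ n @[n --> \oo] --> (0 : R) by exact: cvg_harmonic.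
move=> /cvgrPdist_lt/(_ _ e0); apply: filterS => n yn.
exact: eA.
Qed.

Section interval.
Context (c d : R).
Hypotheses (pc : p < c) (cd : c < d) (dq : d < q).

Let cdpq v : v \in `[c, d] -> p < v < q.
Proof.
by rewrite in_itv/= => /andP[cv vd]; rewrite (lt_le_trans pc cv) (le_lt_trans vd dq).
Qed.

Let phi_le v w : p < v -> v <= w -> w < q -> phi v <= phi w.
Proof.
by move=> pv; rewrite le_eqVlt => /predU1P[-> //|vw wq]; apply/ltW/phi_incr.
Qed.

Let dphi_integrable (M : R) :
  lebesgue_measure.-integrable `[c, d] (EFin \o (fun v => M * dphi v)).
Proof.
apply: continuous_compact_integrable; first exact: segment_compact.
apply: continuous_in_subspaceT => v; rewrite inE => /cdpq /dphi_cont.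
by move=> /continuous_rlimit h; apply/continuous_rlimit; rlimit_tac.
Qed.

Let density v := U (phi v) * dphi v.

(** The dominating function is M [dphi] with M from [poisson_bounded]; the density is measurable as
    a pointwise limit. *)
Lemma stieltjes_density : measurable_fun `[c, d] density /\
  (\int[lebesgue_measure]_(v in `[c, d]) (poisson nu (phi v) (y_ n) * dphi v)%:E
    @[n --> \oo] --> \int[lebesgue_measure]_(v in `[c, d]) (density v)%:E)%E.
Proof.
have /andP[ac _] : a < phi c < b by apply: phi_ab; rewrite pc (lt_trans cd).
have /andP[_ db] : a < phi d < b by apply: phi_ab; rewrite dq (lt_trans pc).
have [M Mb] := poisson_bounded small_mass ac db.
pose f_ n v := (poisson nu (phi v) (y_ n) * dphi v)%:E.
have mf n : measurable_fun `[c, d] (f_ n).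
  apply/measurable_EFinP.
  exact: (measurable_poisson nu dphiE dphi_cont dphi_gt0 pc dq (y_gt0 n)).
have cf v : v \in `[c, d] -> f_ ^~ v @ \oo --> (density v)%:E.
  move=> vcd; have vpq := cdpq vcd; have := poissonU (phi_ab vpq).
  move=> /(rlimit_comp y_cvg) h.
  have : rlimit \oo (fun n => poisson nu (phi v) (y_ n) * dphi v) (density v).
    by rlimit_tac.
  by rewrite rlimit_cvgE => h'; apply: cvg_EFin => //; exact: nearW.
have bf n v : v \in `[c, d] -> (`|f_ n v| <= (M * dphi v)%:E)%E.
  move=> vcd; have vpq := cdpq vcd; have d0 := dphi_gt0 vpq.
  rewrite lee_fin normrM (gtr0_norm d0) ler_pM2r// ger0_norm ?poisson_ge0//.
  apply: Mb => //; move: vcd; rewrite in_itv/= => /andP[cv vd].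
  by rewrite !phi_le ?(lt_le_trans pc) ?(le_lt_trans vd).
have mdens : measurable_fun `[c, d] (fun v => (density v)%:E).
  by apply: (emeasurable_fun_cvg f_) => //; move=> v /cf.
split; first exact/measurable_EFinP.
have [] // := @dominated_convergence _ _ _ lebesgue_measure `[c, d]%classic _ f_
  (fun v => (density v)%:E) (fun v => (M * dphi v)%:E).
- by apply: aeW => v; exact: cf.
- exact: dphi_integrable.
- by apply: aeW => v n vcd; exact: bf.
Qed.

Let atan_limit u : u != 0 ->
  rlimit \oo (fun n => atan (u / y_ n)) (if 0 < u then pi / 2 else - (pi / 2)).
Proof.
have pos w : 0 < w -> rlimit \oo (fun n => atan (w / y_ n)) (pi / 2).
  move=> w0; suff wy : w / y_ n @[n --> \oo] --> +oo.
    by apply: (rlimit_comp wy); rewrite rlimit_cvgE; exact: cvgy_atan.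
  apply/cvgryPge => A; near=> n.
  have An : A / w < n%:R by near: n; exact: nbhs_infty_gtr.
  rewrite /y_ invrK -ler_pdivrMl// mulrC; apply: le_trans (ltW An) _.
  by rewrite ler_nat.
move=> u0; case: ltP => [/pos//|ule].
have Nu : 0 < - u by rewrite oppr_gt0 lt_neqAle u0.
have /rlimitN := pos _ Nu; apply: rlimit_near; apply: nearW => n.
by rewrite mulNr atanN opprK.
Unshelve. all: end_near. Qed.

(** As y tends to 0 the difference of arctangents tends to pi inside the interval and to 0 outside
    its closure. The two end points are negligible since nu has no atoms in ]a, b[. *)
Lemma arc_limit : (\int[nu]_s (arc phi c d (y_ n) s)%:E @[n --> \oo] -->
  pi%:E * nu `]phi c, phi d[%classic)%E.
Proof.
have cpq : p < c < q by rewrite pc (lt_trans cd).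
have dpq : p < d < q by rewrite dq (lt_trans pc).
have pcd : phi c < phi d by exact: phi_incr.
pose h s : R := pi * \1_(`]phi c, phi d[%classic : set R) s.
have <- : (\int[nu]_s (h s)%:E = pi%:E * nu `]phi c, phi d[%classic)%E.
  rewrite /h; under eq_integral do rewrite EFinM.
  rewrite ge0_integralZl//.
  - by rewrite integral_indic// setIT.
  - exact/measurable_EFinP/measurable_indic.
  - by rewrite lee_fin pi_ge0.
have marc n : measurable_fun setT (fun s => (arc phi c d (y_ n) s)%:E).
  have mat (w : R) : measurable_fun setT (fun s : R => atan ((w - s) / y_ n)).
    apply: (measurableT_comp (f := atan)).
      by apply: continuous_measurable_fun; exact: continuous_atan.
    apply: measurable_funM; last exact: measurable_cst.
    by apply: measurable_funB => //; exact: measurable_cst.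
  by apply/measurable_EFinP; exact: measurable_funB.
have [] // := @dominated_convergence _ _ _ nu setT measurableT
  (fun n s => (arc phi c d (y_ n) s)%:E) (fun s => (h s)%:E) (cst pi%:E).
- apply/measurable_EFinP; apply: measurable_funM; first exact: measurable_cst.
  exact: measurable_indic.
- exists ([set phi c] `|` [set phi d]); split.
  + by apply: measurableU; exact: measurable_set1.
  + apply/eqP; rewrite eq_le measure_ge0 andbT.
    have m0 v : p < v < q -> mass nu [set phi v] = 0 by move=> /phi_ab /no_atom.
    have m1 v : measurable [set phi v : R] by exact: measurable_set1.
    rewrite -[X in (X <= _)%E]massE; last exact: measurableU.
    by rewrite lee_fin; apply: le_trans (massU_le _ _ _) _; rewrite // !m0// addr0.
  + move=> s /= /not_implyP[_ ns]; apply: contrapT => /not_orP[/eqP sc /eqP sd].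
    apply: ns; apply: cvg_EFin; first exact: nearW.
    rewrite -rlimit_cvgE.
    have c0 : phi c - s != 0 by rewrite subr_eq0 eq_sym.
    have d0 : phi d - s != 0 by rewrite subr_eq0 eq_sym.
    have lc := atan_limit c0; have ld := atan_limit d0.
    suff : rlimit \oo (fun n => arc phi c d (y_ n) s) (h s) by [].
    rewrite /arc; rlimit_tac; rewrite /h indicE !subr_gt0.
    have -> : (s \in (`]phi c, phi d[%classic : set R)) = (phi c < s < phi d).
      by apply/idP/idP; rewrite inE /= in_itv.
    have [dlts|slt] := ltP s (phi d); have [clts|cslt] := ltP s (phi c).
    * by rewrite (ltNge _ s) (ltW clts) /= mulr0 subrr.
    * by rewrite lt_neqAle eq_sym sc cslt /= mulr1 opprK; field.
    * by have := lt_trans clts (lt_le_trans pcd slt); rewrite ltxx.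
    * by rewrite andbF mulr0 subrr.
- exact: (@bounded_integrable _ nu (cst pi) `|pi|).
- apply: aeW => s n _; rewrite lee_fin /arc.
  have [l1 u1] := (atan_gtNpi2 ((phi c - s) / y_ n), atan_ltpi2 ((phi c - s) / y_ n)).
  have [l2 u2] := (atan_gtNpi2 ((phi d - s) / y_ n), atan_ltpi2 ((phi d - s) / y_ n)).
  by rewrite ler_norml; apply/andP; split; lra.
Qed.

Lemma stieltjes_itv : (pi%:E * nu `]phi c, phi d[%classic =
  \int[lebesgue_measure]_(v in `[c, d]) (density v)%:E)%E.
Proof.
have [_ h1] := stieltjes_density.
have E n : (\int[lebesgue_measure]_(v in `[c, d]) (poisson nu (phi v) (y_ n) * dphi v)%:E =
    \int[nu]_s (arc phi c d (y_ n) s)%:E)%E.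
  exact: (poisson_fubini nu dphiE dphi_cont dphi_gt0 pc cd dq (y_gt0 n)).
apply: (cvg_unique _ _ h1) => //.
apply: cvg_trans arc_limit; apply: near_eq_cvg; apply: nearW => n; exact/esym/E.
Qed.
End interval.
End StieltjesLimit.

(** * From intervals to measurable sets *)

Section DensityMeasure.
Context {R : realType} (g : R -> \bar R).
Hypotheses (mg : measurable_fun setT g) (g0 : forall x, (0 <= g x)%E).

(** Measurability and positivity are arguments of the definition so that the measure structure can
    be found from the term itself. *)
Definition density_measure of measurable_fun setT g & (forall x, (0 <= g x)%E) :=
  fun A : set R => (\int[lebesgue_measure]_(x in A) g x)%E.

Local Notation dm := (density_measure mg g0).

Let dm0 : dm set0 = 0%E.
Proof. exact: integral_set0. Qed.

Let dm_ge0 A : (0 <= dm A)%E.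
Proof. by apply: integral_ge0 => x _; exact: g0. Qed.

Let dm_additive : semi_sigma_additive dm.
Proof. exact: (@semi_sigma_additive_nng_induced _ _ R lebesgue_measure g mg g0). Qed.

HB.instance Definition _ := isMeasure.Build _ _ _ dm dm0 dm_ge0 dm_additive.
End DensityMeasure.

Section DensityOfIntervals.
Context {R : realType} (m : probability R R) (f : R -> R) (p q : R).
Hypothesis f_ge0 : forall v, p < v < q -> 0 <= f v.
Hypothesis f_meas : forall c d, p < c -> c < d -> d < q -> measurable_fun `[c, d] f.
Hypothesis mE : forall c d, p < c -> c < d -> d < q ->
  m `]c, d[%classic = (\int[lebesgue_measure]_(v in `[c, d]) (f v)%:E)%E.

(** Finite measures that agree on the open intervals, a generating family stable under intersection,
    are equal. This is applied to the restrictions of both measures to an interval D around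
    [c, d]. *)
Lemma is_density_itv c d : p < c -> c < d -> d < q -> is_density_on m `[c, d] f.
Proof.
move=> pc cd dq; split; first exact: f_meas.
  move=> x /=; rewrite in_itv/= => /andP[cx xd].
  by apply: f_ge0; rewrite (lt_le_trans pc cx) (le_lt_trans xd dq).
(* The hypotheses concern intervals with end points strictly inside ]p, q[. This margin makes the
   trace on D of any open interval empty or of that kind. *)
pose p' := (p + c) / 2; pose q' := (d + q) / 2.
have pp' : p < p' by rewrite /p'; lra.
have p'c : p' < c by rewrite /p'; lra.
have dq' : d < q' by rewrite /q'; lra.
have q'q : q' < q by rewrite /q'; lra.
pose D : set R := `]p', q'[%classic.
have mD : measurable D by exact: measurable_itv.
have fD : measurable_fun D f.
  apply: (@measurable_funS _ _ _ _ `[p', q']%classic) => //; last first.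
    by apply: f_meas => //; rewrite (lt_trans p'c)// (lt_trans cd).
  exact: subset_itv_oo_cc.
pose g := (EFin \o f) \_ D.
have mg : measurable_fun setT g.
  by apply/(measurable_restrictT _ _).1 => //; exact/measurable_EFinP.
have g0 x : (0 <= g x)%E.
  rewrite /g patchE; case: ifPn => // /set_mem; rewrite /D /= in_itv/= => /andP[x1 x2].
  by rewrite lee_fin f_ge0// (lt_trans pp' x1) (lt_trans x2 q'q).
have dmE A : density_measure mg g0 A = (\int[lebesgue_measure]_(x in A `&` D) (f x)%:E)%E.
  by rewrite integral_mkcondr.
have mDoo A : measurable A -> (m (A `&` D) < +oo)%E.
  by move=> mA; rewrite (le_lt_trans (probability_le1 _ _)) ?ltry//; exact: measurableI.
have key A : measurable A -> mrestr m mD A = density_measure mg g0 A.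
  apply: (measure_unique (@RGenOpens.G R) (fun k => `](- k%:R), k%:R[%classic)).
  - exact: RGenOpens.measurableE.
  - move=> _ _ [x1 [y1 ->]] [x2 [y2 ->]].
    exists (Num.max x1 x2), (Num.min y1 y2).
    apply/seteqP; split => z /=; rewrite !in_itv/= gt_max lt_min.
      by move=> [/andP[-> ->] /andP[-> ->]].
    by move=> /andP[/andP[-> ->] /andP[-> ->]].
  - by move=> k; exists (- k%:R), k%:R.
  - apply/seteqP; split => // x _; exists (Num.bound `|x|) => //=.
    by rewrite in_itv/= -ltr_norml archi_boundP.
  - move=> _ [x [y ->]]; rewrite [RHS]dmE; change (m (`]x, y[%classic `&` D) =
      \int[lebesgue_measure]_(x in `]x, y[%classic `&` D) (f x)%:E)%E.
    pose x' := Num.max x p'; pose y' := Num.min y q'.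
    have -> : (`]x, y[%classic `&` D) = (`]x', y'[%classic : set R).
      apply/seteqP; split => z /=; rewrite /D /= !in_itv/= /x' /y' gt_max lt_min.
        by move=> [/andP[-> ->] /andP[-> ->]].
      by move=> /andP[/andP[-> ->] /andP[-> ->]].
    have [xy|yx] := ltP x' y'; last first.
      have -> : (`]x', y'[%classic : set R) = set0.
        by rewrite set_itv_ge// bnd_simp -leNgt.
      by rewrite measure0 integral_set0.
    have px : p < x' by rewrite /x' lt_max pp' orbT.
    have yq : y' < q by rewrite /y' gt_min q'q orbT.
    rewrite mE// integral_itv_bndoo//; apply/measurable_EFinP.
    apply: (@measurable_funS _ _ _ _ `[x', y']%classic) => //.
      exact: subset_itv_oo_cc.
    exact: f_meas.
  - by move=> k; apply: mDoo; exact: measurable_itv.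
move=> A mA Acd; have AD : A `<=` D.
  move=> x /Acd; rewrite /D /= !in_itv/= => /andP[cx xd].
  by rewrite (lt_le_trans p'c cx) (le_lt_trans xd dq').
by have := key A mA; rewrite dmE /mrestr setIidl.
Qed.
End DensityOfIntervals.

Section StieltjesInversionTheorem.
Context {R : realType} (nu m : probability R R).
Context (phi dphi : R -> R) (p q : R).
Hypothesis dphiE : forall v, p < v < q -> is_derive v (1 : R) phi (dphi v).
Hypothesis dphi_cont : forall v, p < v < q -> {for v, continuous dphi}.
Hypothesis dphi_gt0 : forall v, p < v < q -> 0 < dphi v.
Hypothesis phi_incr : forall v w, p < v -> v < w -> w < q -> phi v < phi w.
Context (a b C : R) (U : R -> R).
Hypothesis phi_ab : forall v, p < v < q -> a < phi v < b.
Hypothesis poissonU : forall x, a < x < b -> rlimit (0 : R)^'+ (poisson nu x) (U x).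
Hypothesis UC : forall x, a < x < b -> U x <= C.
Hypothesis mE : forall c d, p < c -> c < d -> d < q ->
  m `]c, d[%classic = nu `]phi c, phi d[%classic.

Lemma poisson_limit_ge0 x : a < x < b -> 0 <= U x.
Proof.
move=> /poissonU/rlimitP Ux; rewrite leNgt; apply/negP => Ux0.
have e0 : 0 < - U x by rewrite oppr_gt0.
near (0 : R)^'+ => y.
have y0 : 0 < y by near: y; exact: nbhs_right_gt.
have : `|U x - poisson nu x y| < - U x by near: y; exact: Ux.
have := poisson_ge0 nu x y0; rewrite ltr_norml => h /andP[h1 h2]; lra.
Unshelve. all: end_near. Qed.

(** Here m is the measure in the coordinate v and nu the one in x = phi v, so inversion and change
    of variables are obtained together. The division by pi normalises the Poisson kernel. *)
Lemma stieltjes_inversion c d : p < c -> c < d -> d < q ->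
  is_density_on m `[c, d] (fun v => U (phi v) * dphi v / pi).
Proof.
have mU c' d' : p < c' -> c' < d' -> d' < q ->
    measurable_fun `[c', d'] (fun v => U (phi v) * dphi v).
  move=> pc cd dq.
  by have [] := stieltjes_density dphiE dphi_cont dphi_gt0 phi_incr phi_ab poissonU UC pc cd dq.
apply: is_density_itv.
- move=> v vpq; rewrite !mulr_ge0 ?invr_ge0 ?pi_ge0//.
    exact/poisson_limit_ge0/phi_ab.
  exact/ltW/dphi_gt0.
- by move=> c' d' pc cd dq; apply: measurable_funM; [exact: mU|exact: measurable_cst].
move=> c' d' pc cd dq; rewrite mE//.
have := stieltjes_itv dphiE dphi_cont dphi_gt0 phi_incr phi_ab poissonU UC pc cd dq.
have pi0 : pi != 0 :> R by rewrite gt_eqF// pi_gt0.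
under [X in _ -> _ = X]eq_integral do rewrite mulrC EFinM.
rewrite ge0_integralZl//; last 3 first.
- by apply/measurable_EFinP; exact: mU.
- move=> v; rewrite /= in_itv/= => /andP[cv vd]; rewrite lee_fin.
  have vpq : p < v < q by rewrite (lt_le_trans pc cv) (le_lt_trans vd dq).
  by rewrite mulr_ge0 ?(ltW (dphi_gt0 _))//; exact/poisson_limit_ge0/phi_ab.
- by rewrite lee_fin invr_ge0 pi_ge0.
by move=> <-; rewrite muleA -EFinM mulVf// mul1e.
Qed.
End StieltjesInversionTheorem.

(** * Asymptotics of the boundary values *)

Section BoundaryValues.
Context {R : realType} (mu : probability R R) (I : set R) (alpha rho r : R).
Hypotheses (mu_nonneg : on_nonneg mu).
Hypotheses (I_open : open I) (I1 : I 1).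
Hypothesis F_cvg : forall x, I x -> cvg (F_transform mu (x +i* y) @[y --> 0^'+]).
Hypotheses (alpha_gt0 : 0 < alpha) (alpha_lt1 : alpha < 1).
Local Notation c := (r%:C * cexpi (alpha * rho * pi)).
Hypothesis F_expansion :
       (fun x : R => F_boundary mu x -
          r%:C * cexpi (alpha * rho * pi) * cpow_i0 (x - 1) (1 - alpha))
       =o_ ((1 : R)^') (fun x : R => (`|x - 1| `^ (1 - alpha))%:C).

Local Notation Fb := (F_boundary mu).

Lemma F_boundary_limit x : I x -> climit (0 : R)^'+ (fun y => F_transform mu (x +i* y)) (Fb x).
Proof. by move=> /F_cvg h; rewrite climit_cvgE; exact: h. Qed.

Definition remainder x : R[i] := (Fb x - c * cpow_i0 (x - 1) (1 - alpha)) /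
  (`|x - 1| `^ (1 - alpha))%:C.

Lemma remainder_limit : climit (1 : R)^' remainder 0.
Proof.
apply/climitP => e e0.
have e20 : 0 < (e / 2)%:C :> R[i] by rewrite ltcR divr_gt0.
move/eqoP : F_expansion => /(_ _ e20); rewrite near_withinE => h.
rewrite near_withinE; apply: filterS h => x h x1; have := h x1.
have d0 : 0 < `|x - 1| `^ (1 - alpha) by apply: powR_gt0; rewrite normr_gt0 subr_eq0.
rewrite !normc_def normcC (ger0_norm (ltW d0)) -rmorphM lecR => h'.
rewrite sub0r normcNr /remainder normcM normcV normcC (ger0_norm (ltW d0)).
rewrite ltr_pdivrMr//; apply: le_lt_trans h' _.
by rewrite ltr_pM2r//; lra.
Qed.

Lemma F_boundaryE x : x != 1 ->
  Fb x = c * cpow_i0 (x - 1) (1 - alpha) + remainder x * (`|x - 1| `^ (1 - alpha))%:C.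
Proof.
move=> x1; rewrite /remainder divfK ?subrKC//.
by rewrite -normc_gt0 normcC normr_gt0 gt_eqF//; apply: powR_gt0; rewrite normr_gt0 subr_eq0.
Qed.

Lemma rlimit_powR0 (a : R) : 0 < a -> rlimit (nbhs (0 : R)) (fun x => `|x| `^ a) 0.
Proof.
move=> a0; apply/rlimitP => e e0.
have d0 : 0 < e `^ a^-1 by rewrite powR_gt0.
have /rlimitP/(_ _ d0) := @rlimit_id R 0; apply: filterS => x.
rewrite !sub0r !normrN (ger0_norm (powR_ge0 _ _)) => h.
have -> : e = (e `^ a^-1) `^ a by rewrite -powRrM mulVf ?gt_eqF// powRr1// ltW.
by rewrite gt0_ltr_powR// ?nnegrE// ltW.
Qed.

(** This homogeneity lets the scale s be factored out of the leading term of F_mu at 1 + s m. *)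
Lemma cpow_i0_pM (s m a : R) : 0 < s -> cpow_i0 (s * m) a = (s `^ a)%:C * cpow_i0 m a.
Proof.
move=> s0; have CM (u v : R) : (u * v)%:C = u%:C * v%:C :> R[i] by exact: rmorphM.
rewrite /cpow_i0 pmulr_rge0//; case: leP => m0; first by rewrite powRM ?(ltW s0)//; exact: CM.
rewrite -mulrN powRM ?oppr_ge0 ?(ltW s0) ?(ltW m0)//.
transitivity (cexpi (pi * a) * ((s `^ a)%:C * ((- m) `^ a)%:C)); last by rewrite mulrCA.
by congr (_ * _); exact: CM.
Qed.

Lemma normc_cpow_i0 (m a : R) : normc (cpow_i0 m a) = `|m| `^ a.
Proof.
rewrite /cpow_i0; case: leP => m0.
  by rewrite normcC !ger0_norm// powR_ge0.
by rewrite normcM normcC normc_cexpi mul1r ger0_norm ?powR_ge0// ltr0_norm.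
Qed.

Lemma F_boundary_limit1 : climit (1 : R)^' Fb 0.
Proof.
have p0 : rlimit (1 : R)^' (fun x => `|x - 1| `^ (1 - alpha)) 0.
  have x1 : rlimit (1 : R)^' (fun x => x - 1) 0.
    have h : rlimit (nbhs (1 : R)) (fun x => x - 1) 0.
      by have h := @rlimit_id R 1; rlimit_tac; rewrite subrr.
    by apply/rlimitP => e e0; apply: cvg_within; move/rlimitP : h; exact.
  have a1 : 0 < 1 - alpha by rewrite subr_gt0.
  move: x1; rewrite rlimit_cvgE => x1.
  exact: (rlimit_comp x1 (rlimit_powR0 a1)).
have rc := remainder_limit.
have lim : climit (1 : R)^' (fun x => c * cpow_i0 (x - 1) (1 - alpha) +
    remainder x * (`|x - 1| `^ (1 - alpha))%:C) 0.
  have h1 : climit (1 : R)^' (fun x => cpow_i0 (x - 1) (1 - alpha)) 0.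
    apply/climitP => e e0; move/rlimitP : p0 => /(_ _ e0); apply: filterS => x.
    by rewrite !sub0r normrN normcNr normc_cpow_i0 ger0_norm// powR_ge0.
  have h2 := climit_real (FF := (dnbhs_filter (1 : R))) p0.
  by climit_tac; rewrite mulr0 mul0r addr0.
apply: climit_near lim; rewrite near_withinE; apply: nearW => x x1.
by rewrite -F_boundaryE.
Qed.

Lemma near_I : \forall x \near (1 : R)^', I x.
Proof. by apply: cvg_within; exact: open_nbhs_nbhs. Qed.

(* If mu were the Dirac mass at 0, then F_mu(x) = x would not vanish at 1. *)
Lemma mass_positive : (0 < mu (`]0%R, +oo[%classic : set R))%E.
Proof.
rewrite lt_neqAle measure_ge0 andbT; apply/eqP => mu0.
have ae0 : {ae mu, forall x : R, x = 0}.
  have h0 := nonneg_ae mu_nonneg.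
  have h1 : {ae mu, forall x : R, x <= 0}.
    exists (`]0%R, +oo[%classic); split => //.
    by move=> x /= /negP; rewrite -ltNge in_itv/= andbT.
  by apply: filterS2 h0 h1 => x x0 x1; apply/eqP; rewrite eq_le x0 x1.
have FE x y : F_transform mu (x +i* y) = x +i* y.
  have [m1 m2] : cmeasurable (fun s : R => (x +i* y - s%:C)^-1).
    by apply: cmeasurableV; apply: cmeasurable_shift; exact: measurable_id.
  have -> : F_transform mu (x +i* y) = (cint mu (fun=> (x +i* y)^-1))^-1.
    rewrite /F_transform /G_transform /cint; congr (_ +i* _)^-1.
      apply: Rintegral_ae_eq => //.
      by apply: filterS ae0 => s ->; rewrite subr0.
    apply: Rintegral_ae_eq => //.
    by apply: filterS ae0 => s ->; rewrite subr0.
  by rewrite cint_cst invrK.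
have FbE x : I x -> Fb x = x%:C.
  move=> /F_boundary_limit h.
  have h' : climit (0 : R)^'+ (fun y => F_transform mu (x +i* y)) x%:C.
    under eq_fun do rewrite FE.
    apply: climit_complex; first exact: rlimit_cst.
    exact: rlimit_at_right0.
  by rewrite climit_cvgE in h; rewrite climit_cvgE in h'; exact: (cvg_unique _ h h').
have F1 : climit (1 : R)^' (fun x => x%:C) (0 : R[i]).
  by apply: climit_near F_boundary_limit1; apply: filterS near_I => x /FbE.
have x1 : climit (1 : R)^' (fun x => x%:C) (1 : R)%:C.
  apply: climit_real; apply/rlimitP => e e0; apply: cvg_within.
  by move/rlimitP : (@rlimit_id R 1); exact.
rewrite climit_cvgE in F1; rewrite climit_cvgE in x1.
have h01 : (0 : R[i]) = (1 : R)%:C by exact: (cvg_unique _ F1 x1).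
have h : complex.Re (0 : R[i]) = complex.Re (1 : R)%:C by rewrite -h01.
by move/eqP: h; rewrite /= eq_sym oner_eq0.
Qed.
End BoundaryValues.

(** * Boundary values of the Boolean stable transform *)

Section BooleanStableBoundary.
Context {R : realType} (alpha rho r : R).
Hypotheses (alpha01 : 0 < alpha < 1) (rho01 : 0 <= rho <= 1) (r_gt0 : 0 < r).

(* boundary value at L of the F-transform of the Boolean stable law *)
Definition stable_F (L : R) : R[i] :=
  L%:C + r%:C * cexpi (alpha * rho * pi) * cpow_i0 L (1 - alpha).

Lemma cosD1_gt0 (theta : R) : 0 <= theta < pi -> 0 < 1 + cos theta.
Proof.
move=> /andP[t0 tpi].
have -> : theta = (theta / 2) *+ 2 by rewrite -mulr_natr divfK.
rewrite cos_mulr2n addrC subrK mulrn_wgt0// exprn_gt0//.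
by apply: cos_gt0_pihalf; apply/andP; split; lra.
Qed.

(** With a = u^alpha the denominator is (a - r)^2 + 2 r a (1 + cos theta), and theta < pi. *)
Lemma stable_denominator_gt0 (theta u : R) : 0 <= theta < pi -> 0 < u ->
  0 < u `^ (2 * alpha) + 2 * r * cos theta * u `^ alpha + r ^+ 2.
Proof.
move=> /cosD1_gt0 c0 u0; have a0 : 0 < u `^ alpha by rewrite powR_gt0.
rewrite mulrC powRrM powR_mulrn ?powR_ge0//.
set a := u `^ alpha in a0 *.
have -> : a ^+ 2 + 2 * r * cos theta * a + r ^+ 2 =
  (a - r) ^+ 2 + 2 * r * a * (1 + cos theta) by ring.
by rewrite ltr_wpDl ?sqr_ge0// !mulr_gt0.
Qed.

Lemma angle_bound (s : R) : 0 <= s <= 1 -> 0 <= alpha * s * pi < pi.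
Proof.
case/andP: alpha01 => a0 a1 /andP[s0 s1].
have p0 := pi_gt0 R.
rewrite !mulr_ge0 ?(ltW a0) ?(ltW p0)//= gtr_pMl//.
by apply: le_lt_trans a1; rewrite ler_piMr// ltW.
Qed.

Lemma stable_kernel_gt0 (theta u e : R) : 0 <= theta < pi -> 0 < u ->
  e ^+ 2 = 1 ->
  let w := e%:C * (u%:C + r%:C * (cos theta +i* (e * sin theta)) * (u `^ (1 - alpha))%:C) in
  w != 0 /\ - complex.Im w^-1 = r * sin theta *
    (u `^ (alpha - 1) /
      (u `^ (2 * alpha) + 2 * r * cos theta * u `^ alpha + r ^+ 2)).
Proof.
move=> tb u0 e1; have D0 := stable_denominator_gt0 tb u0.
move: D0; set D := (X in 0 < X) => D0 w.
have b0 : 0 < u `^ (1 - alpha) by rewrite powR_gt0.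
have ua : u `^ (alpha - 1) = (u `^ (1 - alpha))^-1 by rewrite -powRN opprB.
have uE : u = u `^ alpha * u `^ (1 - alpha).
  by rewrite -powRD ?subrKC ?powRr1 ?ltW//; apply/implyP; rewrite gt_eqF.
have DE : D = (u `^ alpha) ^+ 2 + 2 * r * cos theta * u `^ alpha + r ^+ 2.
  by rewrite /D (mulrC 2) powRrM powR_mulrn ?powR_ge0.
have Rw : complex.Re w = e * (u `^ (1 - alpha) * (u `^ alpha + r * cos theta)).
  rewrite /w ReCM raddfD/= mulr0 subr0 !mul0r !subr0 [X in X + _]uE; ring.
have Iw : complex.Im w = u `^ (1 - alpha) * (r * sin theta).
  rewrite /w ImM/= !mul0r mulr0 !addr0 add0r.
  transitivity (e ^+ 2 * (u `^ (1 - alpha) * (r * sin theta))); first by ring.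
  by rewrite e1 mul1r.
have nw : complex.Re w ^+ 2 + complex.Im w ^+ 2 = (u `^ (1 - alpha)) ^+ 2 * D.
  have s2 : sin theta ^+ 2 = 1 - cos theta ^+ 2 by rewrite -(cos2Dsin2 theta) addrC addKr.
  by rewrite Rw Iw DE exprMn e1 mul1r !exprMn s2; ring.
have nw0 : 0 < complex.Re w ^+ 2 + complex.Im w ^+ 2 by rewrite nw mulr_gt0// exprn_gt0.
split.
  by apply: contraTneq nw0 => ->; rewrite expr0n/= addr0 ltxx.
rewrite -/D ImV opprK nw Iw ua; clearbody D w; field.
by rewrite !gt_eqF.
Qed.

Lemma stable_F_pos (L : R) : 0 < L -> stable_F L != 0 /\
  - complex.Im (stable_F L)^-1 = r * sin (alpha * rho * pi) *
    (L `^ (alpha - 1) /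
      (L `^ (2 * alpha) + 2 * r * cos (alpha * rho * pi) * L `^ alpha + r ^+ 2)).
Proof.
move=> L0; have := stable_kernel_gt0 (angle_bound rho01) L0 (expr1n _ 2).
suff -> : stable_F L = (1 : R)%:C * (L%:C + r%:C * (cos (alpha * rho * pi)
  +i* (1 * sin (alpha * rho * pi))) * (L `^ (1 - alpha))%:C) by [].
by rewrite /stable_F /cpow_i0 ltW// !mul1r.
Qed.

Lemma stable_F_neg (L : R) : L < 0 -> stable_F L != 0 /\
  - complex.Im (stable_F L)^-1 = r * sin (alpha * (1 - rho) * pi) *
    ((- L) `^ (alpha - 1) /
      ((- L) `^ (2 * alpha) + 2 * r * cos (alpha * (1 - rho) * pi) * (- L) `^ alpha
        + r ^+ 2)).
Proof.
move=> L0; have rho1 : 0 <= 1 - rho <= 1 by case/andP: rho01 => *; apply/andP; split; lra.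
have mL : 0 < - L by rewrite oppr_gt0.
have e1 : (-1 : R) ^+ 2 = 1 by rewrite sqrrN expr1n.
have := stable_kernel_gt0 (angle_bound rho1) mL e1.
suff -> : stable_F L = (-1)%:C * ((- L)%:C + r%:C * (cos (alpha * (1 - rho) * pi)
   +i* (-1 * sin (alpha * (1 - rho) * pi))) * ((- L) `^ (1 - alpha))%:C) by [].
rewrite /stable_F /cpow_i0 leNgt L0.
have angleE : cexpi (alpha * rho * pi) * cexpi (pi * (1 - alpha)) =
    - cos (alpha * (1 - rho) * pi) +i* sin (alpha * (1 - rho) * pi).
  rewrite -cexpiD.
  have -> : alpha * rho * pi + pi * (1 - alpha) = - (alpha * (1 - rho) * pi) + pi by ring.
  by rewrite /cexpi cosDpi sinDpi cosN sinN opprK.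
transitivity (L%:C + r%:C * (cexpi (alpha * rho * pi) * cexpi (pi * (1 - alpha))) *
    ((- L) `^ (1 - alpha))%:C).
  by congr (_ + _); rewrite /= !mulrA.
rewrite angleE.
by apply/eqP; rewrite eq_complex; apply/andP; split; apply/eqP => /=; ring.
Qed.

Lemma stable_F_neq0 (L : R) : L != 0 -> stable_F L != 0.
Proof.
by rewrite neq_lt => /orP[/stable_F_neg[]|/stable_F_pos[]].
Qed.

Lemma rlimit_powR (T : Type) (F : set_system T) (FF : Filter F) (f : T -> R) (b a : R) :
  0 < b -> rlimit F f b -> rlimit F (fun x => f x `^ a) (b `^ a).
Proof.
move=> b0; apply: (rlimit_continuous (g := fun u => u `^ a)).
apply/differentiable_continuous/derivable1_diffP.
by have [] := is_derive1_powR a b0.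
Qed.

Lemma climit_cpow_i0 (a L : R) : L != 0 -> climit (nbhs L) (fun x => cpow_i0 x a) (cpow_i0 L a).
Proof.
have Lr : rlimit (nbhs L) (fun x => x) L := @rlimit_id R L.
rewrite neq_lt => /orP[L0|L0].
  have near0 : \forall x \near L, (cexpi (pi * a) * ((- x) `^ a)%:C) = cpow_i0 x a.
    near=> x; rewrite /cpow_i0 leNgt.
    have -> // : x < 0 by near: x; exact: lt_nbhsl.
  apply: climit_near near0 _.
  rewrite /cpow_i0 leNgt L0/=.
  have h : climit (nbhs L) (fun x => ((- x) `^ a)%:C) ((- L) `^ a)%:C.
    apply: climit_real; apply: rlimit_powR; first by rewrite oppr_gt0.
    exact: rlimitN.
  by climit_tac.
have near0 : \forall x \near L, (x `^ a)%:C = cpow_i0 x a.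
  near=> x; rewrite /cpow_i0.
  by have -> // : 0 <= x; apply: ltW; near: x; exact: lt_nbhsr.
apply: climit_near near0 _; rewrite /cpow_i0 ltW//.
by apply: climit_real; exact: rlimit_powR.
Unshelve. all: by end_near. Qed.

Lemma climit_stable_F (T : Type) (F : set_system T) (FF : Filter F) (f : T -> R) (L : R) :
  L != 0 -> rlimit F f L -> climit F (fun x => stable_F (f x)) (stable_F L).
Proof.
move=> L0 fL; have fC := climit_real (FF := FF) fL.
have h : climit F (fun x => cpow_i0 (f x) (1 - alpha)) (cpow_i0 L (1 - alpha)).
  rewrite rlimit_cvgE in fL.
  apply: (climit_comp (G := nbhs L) (k := f) (f := fun x => cpow_i0 x (1 - alpha))).
    exact fL.
    exact: climit_cpow_i0.
by rewrite /stable_F; climit_tac.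
Qed.

(** At L != 0 this is pi times the Lebesgue density of the Boolean stable law. *)
Definition stable_density (L : R) : R := - complex.Im (stable_F L)^-1.

Lemma stable_density_continuous (L : R) : L != 0 ->
  rlimit (nbhs L) stable_density (stable_density L).
Proof.
move=> L0; have F0 := stable_F_neq0 L0; have FF := nbhs_filter L.
have FL := climit_stable_F FF L0 (@rlimit_id R L).
exact: (rlimitN (FF := FF) (climit_Im (FF := FF) (climitV (FF := FF) FL F0))).
Qed.
End BooleanStableBoundary.

(** * Scaling limit of the boundary values *)

Section BoundaryValuesLimit.
Context {R : realType} (mu : probability R R) (I : set R) (alpha rho r : R).
Hypotheses (I_open : open I) (I1 : I 1).
Hypotheses (alpha_gt0 : 0 < alpha) (alpha_lt1 : alpha < 1).
Hypothesis F_expansion :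
       (fun x : R => F_boundary mu x -
          r%:C * cexpi (alpha * rho * pi) * cpow_i0 (x - 1) (1 - alpha))
       =o_ ((1 : R)^') (fun x : R => (`|x - 1| `^ (1 - alpha))%:C).
Local Notation Fb := (F_boundary mu).
Local Notation c := (r%:C * cexpi (alpha * rho * pi)).

(* boundary value at x of the F-transform of mu^<t> *)
Definition boolean_F t x : R[i] := x%:C - cexp (t%:C * clog (x%:C - Fb x)).

Section along_filter.
Context (T : Type) (F : set_system T) {FF : Filter F} (s L : T -> R) (L0 : R).
Hypotheses (s_gt0 : \forall u \near F, 0 < s u) (s0 : rlimit F s 0).
Hypotheses (L00 : L0 != 0) (LL0 : rlimit F L L0).
Local Notation x := (fun u => expR (s u * L u)).

(** The factor s is extracted exactly, so that the homogeneity of [cpow_i0] applies to x - 1 = s m.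
    The filter is arbitrary because t and v will vary together. *)
Lemma expR_scaled_expansion : exists2 m : T -> R, rlimit F m L0 &
  forall u, expR (s u * L u) = 1 + s u * m u.
Proof.
have [q q0 qE] := @expR_expansion R.
have k0 : rlimit F (fun u => s u * L u) 0.
  by rlimit_tac; rewrite mul0r.
have qk : rlimit F (fun u => q (s u * L u)) (1 / 2).
  by rewrite rlimit_cvgE in k0; exact: (rlimit_comp k0 q0).
exists (fun u => L u + L u * (s u * L u) * q (s u * L u)).
  by rlimit_tac; rewrite !mulr0 !mul0r addr0.
move=> u; have := qE (s u * L u) => h.
have -> : expR (s u * L u) = 1 + s u * L u + (expR (s u * L u) - 1 - s u * L u) by ring.
rewrite h; ring.
Qed.

Lemma expR_cvg_dnbhs1 : x u @[u --> F] --> (1 : R)^'.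
Proof.
have [m mL xE] := expR_scaled_expansion.
have x1 : rlimit F x 1.
  have h : rlimit F (fun u => 1 + s u * m u) 1 by rlimit_tac; rewrite mul0r addr0.
  by apply: rlimit_near h; apply: nearW => u.
have m0 : \forall u \near F, m u != 0.
  have l0 : 0 < `|L0| by rewrite normr_gt0.
  move/rlimitP: mL => /(_ _ l0); apply: filterS => u.
  by apply: contraTneq => ->; rewrite subr0 ltxx.
move=> P nP; have {}nP : \forall y \near (1 : R), y != 1 -> P y by exact: nP.
rewrite rlimit_cvgE in x1.
have nP' : \forall u \near F, x u != 1 -> P (x u) by exact: x1 _ nP.
suff h : \forall u \near F, x u != 1 by apply: filterS2 nP' h => u; apply.
move: s_gt0 m0; apply: filterS2 => u su mu0.
by rewrite xE -subr_eq0 addrAC subrr add0r mulf_neq0// gt_eqF.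
Qed.

(* For t = s^alpha and x = exp (s L), both x - 1 and t F_mu(x) are of exact order s, while the
   terms of higher order in t log (x - F_mu(x)) are o(s). *)
Lemma boolean_F_limit :
  climit F (fun u => boolean_F (s u `^ alpha) (x u) / (s u)%:C) (stable_F alpha rho r L0) /\
  \forall u \near F, off_negative ((x u)%:C - Fb (x u)).
Proof.
have [m mL xE] := expR_scaled_expansion.
have x1 := expR_cvg_dnbhs1.
have xC : climit F (fun u => (x u)%:C) 1%:C.
  have h : rlimit F (fun u => 1 + s u * m u) 1 by rlimit_tac; rewrite mul0r addr0.
  by apply: climit_real; apply: rlimit_near h; apply: nearW => u.
have Fb0 : climit F (fun u => Fb (x u)) 0.
  exact: (climit_comp x1 (F_boundary_limit1 alpha_lt1 F_expansion)).
have rem0 : climit F (fun u => remainder mu alpha rho r (x u)) 0.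
  exact: (climit_comp x1 (remainder_limit F_expansion)).
have h0 : climit F (fun u => (x u)%:C - 1 - Fb (x u)) 0.
  by climit_tac; rewrite subrr subr0.
have [pl [pl0 plE]] := clog_expansion (off_negative_real (@ltr01 R)).
have [pe pe0 peE] := @cexp_expansion R.
pose h u := (x u)%:C - 1 - Fb (x u).
have {}h0 : climit F h 0 by exact h0.
have plh : climit F (fun u => pl (h u)) (pl 0).
  exact: (climit_comp (cvg_nbhs0 h0) pl0).
have clogE : \forall u \near F, clog ((x u)%:C - Fb (x u)) = h u + h u ^+ 2 * pl (h u).
  have := climit_nbhs h0 plE; apply: filterS => u; rewrite -/(h u) => e.
  rewrite rmorph1 in e; have clog1 : clog (1 : R[i]) = 0.
    by rewrite -(rmorph1 (real_complex R)) clog_real// ln1 rmorph0.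
  rewrite clog1 invr1 mul1r add0r in e.
  by rewrite -e; congr clog; rewrite /h; ring.
pose b := 1 - alpha.
(* F_mu(x) = s^(1 - alpha) Phi with Phi convergent. Multiplied by t = s^alpha this gives exactly s
   Phi, and below t (x - 1 - F_mu(x)) = s H. *)
pose Phi u := c * cpow_i0 (m u) b + remainder mu alpha rho r (x u) * (`|m u| `^ b)%:C.
have PhiL : climit F Phi (c * cpow_i0 L0 b).
  have h1 : climit F (fun u => cpow_i0 (m u) b) (cpow_i0 L0 b).
    rewrite rlimit_cvgE in mL.
    apply: (climit_comp (G := nbhs L0) (k := m) (f := fun x => cpow_i0 x b)).
      exact mL.
    exact: climit_cpow_i0.
  have h2 : climit F (fun u => (`|m u| `^ b)%:C) (`|L0| `^ b)%:C.
    apply: climit_real; apply: rlimit_powR; first by rewrite normr_gt0.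
    exact: rlimit_norm.
  by rewrite /Phi; climit_tac; rewrite mul0r addr0.
pose t u : R[i] := (s u `^ alpha)%:C.
have t0 : climit F t 0.
  have h1 : rlimit F (fun u => s u `^ alpha) 0.
    have s0' := s0; rewrite rlimit_cvgE in s0'.
    have := rlimit_comp s0' (rlimit_powR0 alpha_gt0).
    by apply: rlimit_near; apply: filterS s_gt0 => u su; rewrite gtr0_norm.
  exact: climit_real h1.
pose H u := t u * (m u)%:C - Phi u.
have mC := climit_real (FF := FF) mL.
have HL : climit F H (- (c * cpow_i0 L0 b)).
  by rewrite /H; climit_tac; rewrite mul0r add0r.
pose w u := t u * (h u + h u ^+ 2 * pl (h u)).
have w0 : climit F w 0.
  by rewrite /w; climit_tac; rewrite mul0r.
have pew : climit F (fun u => pe (w u)) (pe 0).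
  exact: (climit_comp (cvg_nbhs0 w0) pe0).
have xn1 : \forall u \near F, x u != 1.
  have h1 : \forall y \near (1 : R)^', y != 1 by rewrite near_withinE; exact: nearW.
  exact: x1 _ h1.
(* With log (1 + h) = h + h^2 pl(h) and exp w = 1 + w + w^2 pe(w), where w = t log (1 + h), every
   term has an exact factor s. After division, all terms but m - H contain a factor h or w and
   vanish in the limit. *)
have main : \forall u \near F, (m u)%:C - H u - H u * h u * pl (h u) -
    H u * (1 + h u * pl (h u)) * w u * pe (w u) =
    boolean_F (s u `^ alpha) (x u) / (s u)%:C.
  near=> u.
  have su : 0 < s u by near: u.
  have x1' : x u != 1 by near: u.
  have FbE : Fb (x u) = (s u `^ b)%:C * Phi u.
    rewrite (F_boundaryE _ alpha rho r x1') xE addrAC subrr add0r.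
    rewrite normrM (gtr0_norm su) powRM ?(ltW su)// cpow_i0_pM// -/b /Phi xE.
    rewrite (rmorphM (real_complex R)) /=.
    set A := (s u `^ b)%:C; set B := cpow_i0 _ _; set C := remainder _ _ _ _ _; set D := (_ `^ _)%:C.
    ring.
  have thE : t u * h u = (s u)%:C * H u.
    have ts : t u * (s u `^ b)%:C = (s u)%:C.
      rewrite /t -(rmorphM (real_complex R)) /= -powRD ?(gt_eqF su) ?implybT//.
      by rewrite addrC subrK powRr1// ltW.
    transitivity (t u * (s u)%:C * (m u)%:C - t u * (s u `^ b)%:C * Phi u).
      rewrite /h FbE xE rmorphD rmorphM /= rmorph1.
      set A := (s u `^ b)%:C; set B := (s u)%:C; set C := (m u)%:C.
      by move: (Phi u) (t u) => P1 t1; ring.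
    rewrite ts /H.
    by move: (Phi u) (t u) (s u)%:C (m u)%:C => P1 t1 s1 m1; ring.
  have wE : w u = (s u)%:C * (H u * (1 + h u * pl (h u))).
    by rewrite mulrA -thE /w; ring.
  have -> : boolean_F (s u `^ alpha) (x u) = (s u)%:C * (m u)%:C - w u - w u ^+ 2 * pe (w u).
    rewrite /boolean_F; have -> : clog ((x u)%:C - Fb (x u)) = h u + h u ^+ 2 * pl (h u).
      by near: u.
    rewrite peE -/(t u) -/(w u) xE rmorphD rmorphM /= rmorph1.
    by move: (pe (w u)) (w u) => p1 w1; move: (s u)%:C (m u)%:C => s1 m1; ring.
  have sC0 : (s u)%:C != 0 :> R[i] by rewrite -normc_gt0 normcC normr_gt0 gt_eqF.
  rewrite [X in _ = (_ - X - _) / _]wE expr2 [X in _ = (_ - _ - X * _ * _) / _]wE.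
  move: (pe (w u)) (pl (h u)) (w u) (H u) (h u) sC0 => p1 p2 w1 H1 h1.
  by move: (s u)%:C (m u)%:C => s1 m1 s10; field.
split; last first.
  have h1 : climit F (fun u => (x u)%:C - Fb (x u)) 1%:C.
    by climit_tac; rewrite subr0.
  exact: (climit_nbhs h1 (off_negative_near (off_negative_real (@ltr01 R)))).
apply: climit_near main _.
climit_tac; rewrite /stable_F; ring.
Unshelve. all: by end_near. Qed.
End along_filter.
End BoundaryValuesLimit.

Lemma climit_neq0 {R : realType} (T : Type) (F : set_system T) (FF : Filter F)
  (f : T -> R[i]) (a : R[i]) : climit F f a -> a != 0 -> \forall u \near F, f u != 0.
Proof.
move=> /climitP fa; rewrite -normc_gt0 => /fa; apply: filterS => u.
by apply: contraTneq => ->; rewrite subr0 ltxx.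
Qed.

(** A joint limit, together with continuity of the limit function, is put in the form required by
    the covering property of compact sets. *)
Lemma joint_dist {R : realType} (v a e : R) (F : set_system R) (FF : Filter F)
  (f : R -> R -> R) (g : R -> R) : 0 < e -> rlimit (filter_prod (nbhs v) F) (fun u => f u.2 u.1) a ->
  rlimit (nbhs v) g a -> \forall w \near v & t \near F, `|g w - f t w| < e.
Proof.
move=> e0 fa ga; have e20 : 0 < e / 2 by rewrite divr_gt0.
have FPF : Filter (filter_prod (nbhs v) F) by exact: filter_prod_filter.
have h : (fun u : R * R => u.1) u @[u --> filter_prod (nbhs v) F] --> nbhs v.
  exact: cvg_fst.
have /rlimitP/(_ _ e20) h1 := fa.
have /rlimitP/(_ _ e20) h2 := rlimit_comp h ga.
have tri (x y z : R) : `|x - y| < e / 2 -> `|x - z| < e / 2 -> `|z - y| < e.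
  by rewrite !ltr_norml => /andP[? ?] /andP[? ?]; apply/andP; split; lra.
by apply: filterS2 h1 h2 => -[w t]; exact: tri.
Qed.

(** * Densities of the rescaled Boolean powers *)

Section BooleanPowerDensity.
Context {R : realType} (mu : probability R R) (mu_ : R -> probability R R).
Context (I : set R) (alpha rho r : R).
Hypotheses (mu_nonneg : on_nonneg mu).
Hypothesis mu_power : forall t : R, 0 <= t <= 1 -> is_mult_boolean_power mu t (mu_ t).
Hypotheses (I_open : open I) (I1 : I 1).
Hypothesis F_cvg : forall x, I x -> cvg (F_transform mu (x +i* y) @[y --> 0^'+]).
Hypotheses (alpha01 : 0 < alpha < 1) (rho01 : 0 <= rho <= 1) (r_gt0 : 0 < r).
Hypothesis F_expansion :
       (fun x : R => F_boundary mu x -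
          r%:C * cexpi (alpha * rho * pi) * cpow_i0 (x - 1) (1 - alpha))
       =o_ ((1 : R)^') (fun x : R => (`|x - 1| `^ (1 - alpha))%:C).
Local Notation Fb := (F_boundary mu).

Definition power_scale (t : R) : R := t `^ alpha^-1.
Local Notation s := power_scale.
Definition boolean_density (t x : R) : R := - complex.Im (boolean_F mu t x)^-1.
(** [boolean_density] / pi is the density of mu^<t>; the factor s v^(s - 1) is the derivative of
    v^s, the inverse of the map x^(1/s) that pushes mu^<t> forward. *)
Definition power_density (t v : R) : R :=
  boolean_density t (v `^ s t) * (s t * v `^ (s t - 1)) / pi.
Local Notation stable_density := (stable_density alpha rho r).

Let alpha_gt0 : 0 < alpha. Proof. by case/andP: alpha01. Qed.
Let alpha_lt1 : alpha < 1. Proof. by case/andP: alpha01. Qed.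

Lemma power_scaleK (t : R) : 0 < t -> s t `^ alpha = t.
Proof. by move=> t0; rewrite /s -powRrM mulVf ?gt_eqF// powRr1// ltW. Qed.

(** The continued relation gives G_nu as an inverse in the half-plane. Its right-hand side is
    continuous up to x, since x - F_mu(x) avoids the cut of the logarithm and the limit of the
    denominator is nonzero. *)
Lemma boolean_boundary (t x : R) : 0 < t -> t <= 1 -> I x -> off_negative (x%:C - Fb x) ->
  boolean_F mu t x != 0 ->
  rlimit (0 : R)^'+ (poisson (mu_ t) x) (boolean_density t x).
Proof.
move=> t0 t1 Ix xoff F0.
have mass0 := mass_positive mu_nonneg I_open I1 F_cvg alpha_lt1 F_expansion.
have t01 : 0 <= t <= 1 by rewrite (ltW t0) t1.
have cont := mult_boolean_continuation mu_nonneg mass0 (mu_power t01).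
have FbL := F_boundary_limit F_cvg Ix.
have zL : climit (0 : R)^'+ (fun y => x +i* y) x%:C.
  by apply: climit_complex; [exact: rlimit_cst|exact: rlimit_at_right0].
have dL : climit (0 : R)^'+ (fun y => x +i* y - F_transform mu (x +i* y)) (x%:C - Fb x).
  by climit_tac.
have lL : climit (0 : R)^'+ (fun y => clog (x +i* y - F_transform mu (x +i* y)))
    (clog (x%:C - Fb x)).
  exact: (climit_compC dL (climit_clog xoff)).
have tlL : climit (0 : R)^'+ (fun y => t%:C * clog (x +i* y - F_transform mu (x +i* y)))
    (t%:C * clog (x%:C - Fb x)).
  by climit_tac.
have eL := climit_compC tlL (taylor2_continuous (taylor2_cexp _)).
have L : climit (0 : R)^'+ (fun y => (x +i* y -
    cexp (t%:C * clog (x +i* y - F_transform mu (x +i* y))))^-1) (boolean_F mu t x)^-1.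
  by climit_tac.
have h := rlimitN (FF := at_right_proper_filter (0 : R))
  (climit_Im (FF := at_right_proper_filter (0 : R)) L).
apply: rlimit_near h; rewrite near_withinE; apply: nearW => y y0.
have y0' : 0 < y by exact: y0.
rewrite poissonE//; congr (- complex.Im _).
have GE := cont (x +i* y) y0'.
have n0 : x +i* y - cexp (t%:C * clog (x +i* y - F_transform mu (x +i* y))) != 0.
  by apply: contra_eq_neq GE => ->; rewrite mulr0 eq_sym oner_eq0.
by rewrite -[LHS]mul1r -GE mulfK.
Qed.


Lemma rlimit_power_scale : rlimit (0 : R)^'+ s 0.
Proof.
have a0 : 0 < alpha^-1 by rewrite invr_gt0.
have h : rlimit (0 : R)^'+ (fun t => `|t| `^ alpha^-1) 0.
  apply: rlimit_comp (rlimit_powR0 a0).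
  by have := @rlimit_at_right0 R; rewrite rlimit_cvgE.
apply: rlimit_near h; rewrite near_withinE; apply: nearW => t t0.
by rewrite gtr0_norm.
Qed.

Section joint_limit.
Context (v0 : R) (v0_gt0 : 0 < v0) (v0_neq1 : v0 != 1).
Local Notation FP := (filter_prod (nbhs v0) (0 : R)^'+).

Let L0_neq0 : ln v0 != 0.
Proof. by rewrite ln_eq0. Qed.

Lemma near_joint : \forall u \near FP, 0 < u.1 /\ 0 < u.2.
Proof.
exists ([set x | 0 < x], [set x | 0 < x]).
  split => /=; first exact: lt_nbhsr.
  exact: nbhs_right_gt.
by move=> [a b].
Qed.

Lemma rlimit_joint1 : rlimit FP (fun u => ln u.1) (ln v0).
Proof.
have h : (fun u : R * R => u.1) u @[u --> FP] --> nbhs v0 by exact: cvg_fst.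
have l : rlimit (nbhs v0) (@ln R) (ln v0).
  by apply/continuous_rlimit; exact: continuous_ln.
exact: (rlimit_comp h l).
Qed.

Lemma rlimit_joint2 : rlimit FP (fun u => s u.2) 0.
Proof.
have h : (fun u : R * R => u.2) u @[u --> FP] --> (0 : R)^'+ by exact: cvg_snd.
exact: (rlimit_comp h rlimit_power_scale).
Qed.

Lemma near_powR_expR : \forall u \near FP,
  [/\ 0 < u.1, 0 < u.2, 0 < s u.2, s u.2 `^ alpha = u.2 &
     u.1 `^ s u.2 = expR (s u.2 * ln u.1)].
Proof.
apply: filterS near_joint => -[v t] /= [v_gt0 t_gt0]; split => //.
- exact: powR_gt0.
- exact: power_scaleK.
- by rewrite /powR gt_eqF.
Qed.

(** The factor s undoes the division by s in [boolean_F_limit]. The second part collects the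
    conditions under which [boolean_boundary] applies at x = v^s. *)
Lemma joint_limit :
  rlimit FP (fun u => s u.2 * boolean_density u.2 (u.1 `^ s u.2))
    (stable_density (ln v0)) /\
  \forall u \near FP, [/\ I (u.1 `^ s u.2), boolean_F mu u.2 (u.1 `^ s u.2) != 0 &
    off_negative ((u.1 `^ s u.2)%:C - Fb (u.1 `^ s u.2))].
Proof.
have sg : \forall u \near FP, 0 < s u.2 by apply: filterS near_powR_expR => u [].
have FPF : Filter FP by exact: filter_prod_filter.
have [FL offL] := boolean_F_limit alpha_gt0 alpha_lt1 F_expansion sg rlimit_joint2 L0_neq0 rlimit_joint1.
have x1 := expR_cvg_dnbhs1 sg rlimit_joint2 L0_neq0 rlimit_joint1.
have F0 := stable_F_neq0 alpha01 rho01 r_gt0 L0_neq0.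
have QF0 := climit_neq0 FPF FL F0.
split.
  have h := rlimitN (FF := FPF) (climit_Im (FF := FPF) (climitV (FF := FPF) FL F0)).
  apply: rlimit_near h; apply: filterS near_powR_expR => u [v_gt0 t_gt0 s_gt0 sK xE].
  rewrite /boolean_density xE sK invf_div.
  by move: (boolean_F _ _ _)^-1 => z; rewrite mulrN; congr (- _); exact: ImCM.
have NI : \forall u \near FP, I (expR (s u.2 * ln u.1)) by exact: x1 FPF _ (near_I I_open I1).
have NP := near_powR_expR.
near=> u.
have [v_gt0 t_gt0 s_gt0 sK xE] : [/\ 0 < u.1, 0 < u.2, 0 < s u.2, s u.2 `^ alpha = u.2 &
  u.1 `^ s u.2 = expR (s u.2 * ln u.1)] by near: u.
have QF0u : boolean_F mu (s u.2 `^ alpha) (expR (s u.2 * ln u.1)) / (s u.2)%:C != 0 by near: u.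
rewrite xE; split; [by near: u| |by near: u].
by apply: contraNneq QF0u; rewrite sK => ->; rewrite mul0r.
Unshelve. all: by end_near. Qed.

Lemma power_density_joint_limit :
  rlimit FP (fun u => power_density u.2 u.1) (stable_density (ln v0) / (pi * v0)).
Proof.
have FPF : Filter FP by exact: filter_prod_filter.
have [dL _] := joint_limit.
have k0 : rlimit FP (fun u => s u.2 * ln u.1) 0.
  by have h1 := rlimit_joint1; have h2 := rlimit_joint2; rlimit_tac; rewrite mul0r.
have x1 : rlimit FP (fun u => expR (s u.2 * ln u.1)) 1.
  rewrite -expR0; apply: (rlimit_continuous (g := expR)) k0.
  exact: continuous_expR.
have v1 : rlimit FP (fun u => u.1) v0.
  have h : (fun u : R * R => u.1) u @[u --> FP] --> nbhs v0 by exact: cvg_fst.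
  exact: (rlimit_comp h (@rlimit_id R v0)).
have h : rlimit FP (fun u => s u.2 * boolean_density u.2 (u.1 `^ s u.2) *
    expR (s u.2 * ln u.1) * u.1^-1 * pi^-1) (stable_density (ln v0) / (pi * v0)).
  rlimit_tac; first by rewrite gt_eqF.
  by rewrite mulr1 invfM mulrA mulrAC.
apply: rlimit_near h; apply: filterS near_powR_expR => u [v_gt0 t_gt0 s_gt0 sK xE].
rewrite /power_density powRB ?(gt_eqF v_gt0) ?implybT// powRr1 ?ltW// xE.
by ring.
Qed.
End joint_limit.

Lemma stable_density_limit (v : R) : 0 < v -> v != 1 ->
  rlimit (nbhs v) (fun w => stable_density (ln w)) (stable_density (ln v)).
Proof.
move=> v0 v1; have L0 : ln v != 0 by rewrite ln_eq0.
have l : rlimit (nbhs v) (@ln R) (ln v).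
  by apply/continuous_rlimit; exact: continuous_ln.
have h := stable_density_continuous alpha01 rho01 r_gt0 L0.
rewrite rlimit_cvgE in l; exact: (rlimit_comp l h).
Qed.

Lemma stable_target_limit (v : R) : 0 < v -> v != 1 ->
  rlimit (nbhs v) (fun w => stable_density (ln w) / (pi * w)) (stable_density (ln v) / (pi * v)).
Proof.
move=> v0 v1; have h := stable_density_limit v0 v1; have FF := nbhs_filter v.
have i := @rlimit_id R v.
rlimit_tac; [by rewrite mulf_neq0 ?gt_eqF ?pi_gt0|by []].
Qed.

Lemma power_density_near (K : set R) (e : R) : compact K ->
  (forall v, K v -> 0 < v /\ v != 1) -> 0 < e ->
  \forall t \near (0 : R)^'+, K `<=` (fun v =>
    `|stable_density (ln v) / (pi * v) - power_density t v| < e).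
Proof.
move=> /compact_near_coveringP cK K01 e0.
apply: (cK R (0 : R)^'+ (fun t v =>
  `|stable_density (ln v) / (pi * v) - power_density t v| < e)) => v /K01[v0 v1].
exact: joint_dist e0 (power_density_joint_limit v0 v1) (stable_target_limit v0 v1).
Qed.

Lemma power_density_uniform (K : set R) (g : R -> R) : compact K ->
  (forall v, K v -> 0 < v /\ v != 1) ->
  (forall v, K v -> g v = stable_density (ln v) / (pi * v)) ->
  {uniform K, power_density @ (0 : R)^'+ --> g}.
Proof.
move=> cK K01 gE P /uniform_nbhs[E [entE]] EP.
move: entE; rewrite -entourage_from_ballE => -[e /= e0 eE].
have := power_density_near cK K01 e0; apply: filterS => t h; apply: EP => v Kv.
by apply: eE; rewrite /= gE//; exact: h.
Qed.

Lemma power_law_itv nu (t c d : R) : 0 < t -> 0 < c -> c < d -> 1 < c \/ d < 1 ->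
  power_law nu (t `^ (- alpha^-1)) `]c, d[%classic = nu `]c `^ s t, d `^ s t[%classic.
Proof.
move=> t0 c0 cd c1.
have s0 : 0 < s t by exact: powR_gt0.
have sE : t `^ (- alpha^-1) = (s t)^-1 by rewrite powRN.
rewrite /power_law /distribution /pushforward; congr (nu _).
apply/seteqP; split => x /=; rewrite !in_itv/= /rpow sE.
  move=> /andP[cx xd].
  have x0 : 0 < x.
    (* A nonpositive x could enter the preimage only through the conventions of the power: 0 is sent
       to 0 < c, and a negative x to 1, which lies outside ]c, d[ by assumption. *)
    rewrite ltNge; apply/negP; rewrite le_eqVlt => /orP[/eqP x0|x0].
      by move: cx; rewrite x0 powR0 ?invr_neq0 ?gt_eqF// ltNge (ltW c0).
    have x1 : x `^ (s t)^-1 = 1 by rewrite /powR (lt_eqF x0) ln0 ?mulr0 ?expR0// ltW.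
    by move: cx xd; rewrite x1; case: c1 => h1 h2 h3; lra.
  have xE : x = (x `^ (s t)^-1) `^ s t by rewrite -powRrM mulVf ?gt_eqF// powRr1// ltW.
  rewrite xE !gt0_ltr_powR// ?nnegrE ?powR_ge0 ?(ltW c0)//.
  by rewrite (le_trans (powR_ge0 _ _) (ltW xd)).
move=> /andP[cx xd].
have x0 : 0 < x by apply: le_lt_trans cx; exact: powR_ge0.
have d0 : 0 < d by apply: lt_trans cd.
have powK (y : R) : 0 < y -> (y `^ s t) `^ (s t)^-1 = y.
  by move=> y0; rewrite -powRrM mulfV ?gt_eqF// powRr1// ltW.
by rewrite -{1}(powK c c0) -{1}(powK d d0) !gt0_ltr_powR// ?invr_gt0 ?nnegrE ?powR_ge0 ?(ltW x0).
Qed.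

(** Inversion with phi v = v^s needs its hypotheses on all of ]p, q[ for one and the same t; they
    hold jointly near each v, and [p, q] is compact. Excluding 1 keeps ln v away from 0, where
    [stable_F] vanishes. *)
Lemma power_law_density_itv (p c d q : R) : 0 < p -> p < c -> c < d -> d < q -> 1 < p \/ q < 1 ->
  \forall t \near (0 : R)^'+,
    is_density_on (power_law (mu_ t) (t `^ (- alpha^-1))) `[c, d] (power_density t).
Proof.
move=> p0 pc cd dq pq1.
have pq : p <= q by lra.
have pqP (v : R) : `[p, q]%classic v -> 0 < v /\ v != 1.
  rewrite /= in_itv/= => /andP[pv vq]; split; first exact: lt_le_trans pv.
  case: pq1 => h; first by rewrite gt_eqF// (lt_le_trans h).
  by rewrite lt_eqF// (le_lt_trans vq).
have [w wpq wM] : exists2 w : R, w \in `[p, q] & forall v, v \in `[p, q] ->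
    stable_density (ln v) <= stable_density (ln w).
  apply: (@EVT_max R (fun v => stable_density (ln v))) => //.
  apply: continuous_in_subspaceT => v; rewrite inE => /pqP[v0 v1].
  by apply/continuous_rlimit; exact: stable_density_limit.
set M := stable_density (ln w) in wM.
have near1 : \forall t \near (0 : R)^'+, t < 1 by exact: nbhs_right_lt.
have near2 : \forall t \near (0 : R)^'+, `[p, q]%classic `<=` (fun v =>
    [/\ I (v `^ s t), boolean_F mu t (v `^ s t) != 0,
      off_negative ((v `^ s t)%:C - Fb (v `^ s t)) &
      `|stable_density (ln v) - s t * boolean_density t (v `^ s t)| < 1]).
  have /compact_near_coveringP cK := @segment_compact R p q.
  apply: (cK R (0 : R)^'+ (fun t v =>
    [/\ I (v `^ s t), boolean_F mu t (v `^ s t) != 0,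
      off_negative ((v `^ s t)%:C - Fb (v `^ s t)) &
      `|stable_density (ln v) - s t * boolean_density t (v `^ s t)| < 1])).
  move=> v /pqP[v0 v1].
  have [h1 h2] := joint_limit v0 v1.
  have h3 := joint_dist (at_right_proper_filter (0 : R)) ltr01
    (f := fun t v => s t * boolean_density t (v `^ s t)) h1 (stable_density_limit v0 v1).
  have FPF : Filter (filter_prod (nbhs v) (0 : R)^'+) by exact: filter_prod_filter.
  by apply: (@filterS2 _ (filter_prod (nbhs v) (0 : R)^'+) FPF _ _ _ _ h2 h3) => -[v' t] [].
near=> t.
have t0 : 0 < t by near: t; exact: nbhs_right_gt.
have t1 : t < 1 by near: t.
have tP : `[p, q]%classic `<=` (fun v =>
    [/\ I (v `^ s t), boolean_F mu t (v `^ s t) != 0,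
      off_negative ((v `^ s t)%:C - Fb (v `^ s t)) &
      `|stable_density (ln v) - s t * boolean_density t (v `^ s t)| < 1]) by near: t.
have s0 : 0 < s t by exact: powR_gt0.
have q0 : 0 < q by exact: lt_le_trans pq.
have onto x : p `^ s t < x < q `^ s t -> exists2 v, `[p, q]%classic v & x = v `^ s t.
  move=> /andP[px xq].
  have x0 : 0 < x by apply: le_lt_trans px; exact: powR_ge0.
  have powK (y : R) : 0 < y -> (y `^ s t) `^ (s t)^-1 = y.
    by move=> y0; rewrite -powRrM mulfV ?gt_eqF// powRr1// ltW.
  exists (x `^ (s t)^-1); last by rewrite -powRrM mulVf ?gt_eqF// powRr1// ltW.
  rewrite /= in_itv/= -{1}(powK p p0) -{1}(powK q q0).
  by rewrite !ge0_ler_powR ?nnegrE ?powR_ge0 ?invr_ge0 ?(ltW px) ?(ltW xq) ?(ltW x0) ?(ltW s0).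
(* The bound (M + 1) / s comes from s [boolean_density] being within 1 of [stable_density], which is
   at most M. *)
apply: (@stieltjes_inversion R (mu_ t) _ (fun v => v `^ s t) (fun v => s t * v `^ (s t - 1)) p q
  _ _ _ _ (p `^ s t) (q `^ s t) ((M + 1) / s t) (boolean_density t)) => //.
- by move=> v /andP[pv _]; apply: is_derive1_powR; exact: lt_trans pv.
- move=> v /andP[pv _]; apply/continuous_rlimit.
  have v0 : 0 < v by exact: lt_trans pv.
  have i := @rlimit_id R v; have FF := nbhs_filter v.
  have h := rlimit_powR (a := s t - 1) FF v0 i.
  by rlimit_tac.
- by move=> v /andP[pv _]; rewrite mulr_gt0// powR_gt0//; exact: lt_trans pv.
- move=> v v' pv vv' v'q; have v0 : 0 < v by exact: lt_trans pv.
  by rewrite gt0_ltr_powR// nnegrE ltW//; exact: lt_trans vv'.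
- move=> v /andP[pv vq]; have v0 : 0 < v by exact: lt_trans pv.
  by rewrite !gt0_ltr_powR// nnegrE ltW.
- move=> x /onto[v /tP[Ix F0 xoff _] ->].
  by apply: boolean_boundary => //; exact: ltW.
- move=> x /onto[v vpq ->]; have [_ _ _] := tP v vpq; have := wM v vpq.
  rewrite ler_pdivlMr// mulrC => h1; rewrite ltr_norml => /andP[h2 _].
  by move: h1 h2; set a := stable_density _; set b := _ * _ => h1 h2; lra.
- move=> c' d' pc' c'd' d'q; apply: power_law_itv => //; first exact: lt_trans pc'.
  by case: pq1 => h; [left; exact: lt_trans pc'|right; exact: lt_trans h].
Unshelve. all: by end_near. Qed.
End BooleanPowerDensity.

(** * Compact subsets and exhaustion of the intervals ]0, 1[ and ]1, +oo[ *)

Section CompactEnclosure.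
Context {R : realType}.

Lemma is_density_onS (m : set R -> \bar R) (D E : set R) (f : R -> R) : measurable D ->
  E `<=` D -> is_density_on m D f -> is_density_on m E f.
Proof.
move=> mD ED [mf f0 fE]; split.
- exact: measurable_funS mf.
- by move=> x /ED; exact: f0.
- by move=> A mA AE; apply: fE => //; exact: subset_trans ED.
Qed.

(** The two outer points provide the open margin around [c, d] that the inversion theorem asks
    for. *)
Lemma compact_gt1 (K : set R) : compact K -> K `<=` `]1, +oo[%classic ->
  exists p c d q : R, [/\ 1 < p, p < c, c < d, d < q & K `<=` `[c, d]%classic].
Proof.
move=> /compact_near_coveringP cK K1.
have nK : \forall e \near (0 : R)^'+, K `<=` (fun v => 1 + e <= v <= e^-1).
  apply: (cK R (0 : R)^'+ (fun e v => 1 + e <= v <= e^-1)) => v /K1/=.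
  rewrite in_itv/= andbT => v1.
  exists ([set w | 1 + (v - 1) / 2 < w /\ w < v + 1],
    [set e | 0 < e /\ e < Num.min ((v - 1) / 2) (v + 1)^-1]).
    split => /=.
      near=> w; split; near: w; [apply: lt_nbhsr|apply: lt_nbhsl]; lra.
    near=> e; split; near: e; first exact: nbhs_right_gt.
    apply: nbhs_right_lt; rewrite lt_min divr_gt0 ?subr_gt0//= invr_gt0; lra.
  move=> [w e] /= [[w1 w2] [e0]]; rewrite lt_min => /andP[e1 e2].
  rewrite -[w]invrK lef_pV2 ?posrE ?invr_gt0; [|lra|lra].
  apply/andP; split; first by rewrite invrK; lra.
  by apply: (le_trans (ltW e2)); rewrite lef_pV2 ?posrE; lra.
near (0 : R)^'+ => e.
have e0 : 0 < e by near: e; exact: nbhs_right_gt.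
(* This gives 1 + e < 4 < 1 / e, so that the four points are in the right order. *)
have e1 : e < 4^-1 by near: e; apply: nbhs_right_lt; rewrite invr_gt0.
have e4 : 4 < e^-1 by rewrite -[4]invrK ltf_pV2 ?posrE ?invr_gt0.
exists (1 + e / 2), (1 + e), e^-1, (e^-1 + 1); split; try lra.
move=> v Kv; rewrite /= in_itv/=.
have : K `<=` (fun v => 1 + e <= v <= e^-1) by near: e.
exact.
Unshelve. all: by end_near. Qed.

Lemma compact_lt1 (K : set R) : compact K -> K `<=` `]0, 1[%classic ->
  exists p c d q : R, [/\ 0 < p, p < c, c < d, d < q & q < 1 /\ K `<=` `[c, d]%classic].
Proof.
move=> /compact_near_coveringP cK K1.
have nK : \forall e \near (0 : R)^'+, K `<=` (fun v => e <= v <= 1 - e).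
  apply: (cK R (0 : R)^'+ (fun e v => e <= v <= 1 - e)) => v /K1/=.
  rewrite in_itv/= => /andP[v0 v1].
  exists ([set w | v / 2 < w /\ w < (v + 1) / 2],
    [set e | 0 < e /\ e < Num.min (v / 2) ((1 - v) / 2)]).
    split => /=.
      near=> w; split; near: w; [apply: lt_nbhsr|apply: lt_nbhsl]; lra.
    near=> e; split; near: e; first exact: nbhs_right_gt.
    apply: nbhs_right_lt; rewrite lt_min; apply/andP; split; lra.
  move=> [w e] /= [[w1 w2] [e0]]; rewrite lt_min => /andP[e1 e2].
  apply/andP; split; lra.
near (0 : R)^'+ => e.
have e0 : 0 < e by near: e; exact: nbhs_right_gt.
have e1 : e < 4^-1 by near: e; apply: nbhs_right_lt; rewrite invr_gt0.
exists (e / 2), e, (1 - e), (1 - e / 2); split; try lra.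
split; first lra.
move=> v Kv; rewrite /= in_itv/=.
have : K `<=` (fun v => e <= v <= 1 - e) by near: e.
exact.
Unshelve. all: by end_near. Qed.

End CompactEnclosure.

Section Exhaustion.
Context {R : realType}.

(** The offset 4 keeps both segments nondegenerate from n = 0 on. *)
Definition exhaustion (n : nat) : set R :=
  `[n.+4%:R^-1, 1 - n.+4%:R^-1]%classic `|` `[1 + n.+4%:R^-1, n.+4%:R]%classic.

Lemma exhaustion_step (n : nat) : 0 < n.+4%:R^-1 :> R.
Proof. by rewrite invr_gt0 ltr0n. Qed.

Lemma exhaustion_incr : {homo exhaustion : n k / (n <= k)%N >-> n `<=` k}.
Proof.
move=> n k nk x; have h : n.+4%:R <= k.+4%:R :> R by rewrite ler_nat.
have h' : k.+4%:R^-1 <= n.+4%:R^-1 :> R by rewrite lef_pV2 ?posrE ?ltr0n.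
rewrite /exhaustion /= !in_itv/=.
move: h h'; move: (n.+4%:R) (k.+4%:R) (n.+4%:R^-1) (k.+4%:R^-1) => c d a b h h'.
by move=> -[/andP[? ?]|/andP[? ?]]; [left|right]; apply/andP; split; lra.
Qed.

Lemma bigcup_exhaustion : \bigcup_n exhaustion n = `]0, 1[%classic `|` `]1, +oo[%classic.
Proof.
apply/seteqP; split => x.
  move=> [n _]; have := exhaustion_step n; rewrite /exhaustion /= !in_itv/= !andbT.
  move: (n.+4%:R) (n.+4%:R^-1) => b a h [/andP[? ?]|/andP[? ?]]; [left|right]; last by lra.
  by apply/andP; split; lra.
have large (y : R) : exists n : nat, y <= n.+4%:R.
  have [n hn] : exists n : nat, y < n%:R.
    by exists (Num.truncn `|y|).+1; apply: le_lt_trans (ler_norm _) _; exact: truncnS_gt.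
  by exists n; apply: (le_trans (ltW hn)); rewrite ler_nat !leqW.
have inv_le (a : R) n : 0 < a -> a^-1 <= n.+4%:R -> n.+4%:R^-1 <= a.
  by move=> a0 h; rewrite -[a]invrK lef_pV2 ?posrE ?ltr0n ?invr_gt0.
rewrite /= !in_itv/= !andbT => -[/andP[x0 x1]|x1].
  have [n hn] := large (Num.max x^-1 (1 - x)^-1).
  move: hn; rewrite ge_max => /andP[/(inv_le _ _ x0) h1].
  move=> /inv_le; rewrite subr_gt0 => /(_ x1) h2.
  exists n => //; left; rewrite /= in_itv/=.
  by move: h1 h2; move: (n.+4%:R^-1) => a h1 h2; apply/andP; split; lra.
have [n hn] := large (Num.max (x - 1)^-1 x).
move: hn; rewrite ge_max => /andP[/inv_le]; rewrite subr_gt0 => /(_ x1) h1 h2.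
exists n => //; right; rewrite /= in_itv/=.
by move: h1 h2; move: (n.+4%:R) (n.+4%:R^-1) => b a h1 h2; apply/andP; split; lra.
Qed.

Lemma measurable_exhaustion n : measurable (exhaustion n).
Proof. exact: measurableU. Qed.

Lemma exhaustion_fin n : (@lebesgue_measure R (exhaustion n) < +oo)%E.
Proof.
apply: (@le_lt_trans _ _ (@lebesgue_measure R `[0, n.+4%:R]%classic)).
  apply: le_measure; rewrite ?inE; [exact: measurable_exhaustion|exact: measurable_itv|].
  move=> x; have := exhaustion_step n; have h : 4 <= n.+4%:R :> R by rewrite ler_nat.
  rewrite /exhaustion /= !in_itv/=; move: h; move: (n.+4%:R) (n.+4%:R^-1) => b a h.
  by move=> h' -[/andP[? ?]|/andP[? ?]]; apply/andP; split; lra.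
by rewrite lebesgue_measure_itv/=; case: ifP => // _; rewrite -EFinB ltry.
Qed.

Lemma exhaustion_lt1 n : `[n.+4%:R^-1, 1 - n.+4%:R^-1]%classic `<=` (`]0, 1[%classic : set R).
Proof.
move=> x; have := exhaustion_step n; rewrite /= !in_itv/=.
by move: (n.+4%:R^-1) => a h /andP[? ?]; apply/andP; split; lra.
Qed.

Lemma exhaustion_gt1 n : `[1 + n.+4%:R^-1, n.+4%:R]%classic `<=` (`]1, +oo[%classic : set R).
Proof.
move=> x; have := exhaustion_step n; rewrite /= !in_itv/= andbT.
by move: (n.+4%:R) (n.+4%:R^-1) => b a h /andP[? ?]; lra.
Qed.

Lemma exhaustion_disjoint n :
  `[n.+4%:R^-1, 1 - n.+4%:R^-1]%classic `&` `[1 + n.+4%:R^-1, n.+4%:R]%classic = set0 :> set R.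
Proof.
apply/seteqP; split => // x [/exhaustion_lt1 + /exhaustion_gt1].
by rewrite /= !in_itv/= andbT => /andP[_ x1] /(lt_trans x1); rewrite ltxx.
Qed.

End Exhaustion.

(** * The Boolean stable law *)

Section StableBoundaryValues.
Context {R : realType} (alpha rho r : R).
Hypotheses (alpha01 : 0 < alpha < 1) (rho01 : 0 <= rho <= 1) (r_gt0 : 0 < r).

Lemma normc_sqrt (x y : R) : 0 < x -> normc (x +i* y) = x * Num.sqrt (1 + (y / x) ^+ 2).
Proof.
move=> x0; rewrite /= -{2}(ger0_norm (ltW x0)) -sqrtr_sqr -sqrtrM ?sqr_ge0//.
by congr Num.sqrt; field; rewrite gt_eqF.
Qed.

(** Off the imaginary axis the arccosine is traded for the arctangent of a quantity that tends to 0
    with y, from which the boundary arguments 0 and pi can be read off. *)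
Lemma carg_pos (x y : R) : 0 < x -> 0 < y -> carg (x +i* y) = atan (y / x).
Proof.
move=> x0 y0; rewrite /carg /cmod normc_sqrt//= (ltW y0).
have -> : x / (x * Num.sqrt (1 + (y / x) ^+ 2)) = cos (atan (y / x)).
  by rewrite cos_atan invfM mulrA mulfV ?gt_eqF// mul1r.
rewrite cosK// in_itv/=; apply/andP; split; last first.
  by apply: ltW; apply: lt_trans (atan_ltpi2 _) _; have := pi_gt0 R; lra.
by apply: ltW; rewrite -atan0 lt_atan ?divr_gt0.
Qed.

Lemma carg_neg (x y : R) : x < 0 -> 0 < y -> carg (x +i* y) = pi - atan (y / - x).
Proof.
move=> x0 y0; have mx : 0 < - x by rewrite oppr_gt0.
have nE : normc (x +i* y) = normc (- x +i* y) by rewrite /= sqrrN.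
rewrite /carg /cmod nE normc_sqrt//= (ltW y0).
have -> : x / (- x * Num.sqrt (1 + (y / - x) ^+ 2)) = cos (pi - atan (y / - x)).
  rewrite [pi - _]addrC cosDpi cosN cos_atan -{1}(opprK x) mulNr; congr (- _).
  by rewrite invfM mulrA mulfV ?gt_eqF// mul1r.
have a0 : 0 < atan (y / - x) by rewrite -atan0 lt_atan ?divr_gt0.
have a1 := atan_ltpi2 (y / - x).
by rewrite cosK// in_itv/=; apply/andP; split; lra.
Qed.

Lemma climit_line (x : R) : climit (0 : R)^'+ (fun y => x +i* y) x%:C.
Proof. by apply: climit_complex; [exact: rlimit_cst|exact: rlimit_at_right0]. Qed.

Lemma rlimit_atan_line (a : R) : rlimit (0 : R)^'+ (fun y => atan (y / a)) 0.
Proof.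
have h := @rlimit_at_right0 R; have FF := at_right_proper_filter (0 : R).
have h' : rlimit (0 : R)^'+ (fun y => y / a) 0 by rlimit_tac; rewrite mul0r.
by rewrite -[X in rlimit _ _ X]atan0; apply: (rlimit_continuous (g := @atan R)) h';
  exact: continuous_atan.
Qed.

Lemma climit_cexpi (T : Type) (F : set_system T) (FF : Filter F) (f : T -> R) (a : R) :
  rlimit F f a -> climit F (fun u => cexpi (f u)) (cexpi a).
Proof.
move=> fa; apply: climit_complex.
  by apply: (rlimit_continuous (g := @cos R)) fa; exact: continuous_cos.
by apply: (rlimit_continuous (g := @sin R)) fa; exact: continuous_sin.
Qed.

Lemma cpow_boundary (x a : R) : x != 0 ->
  climit (0 : R)^'+ (fun y => cpow (x +i* y) a) (cpow_i0 x a).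
Proof.
move=> x0; have FF := at_right_proper_filter (0 : R).
have nL : climit (0 : R)^'+ (fun y => (normc (x +i* y) `^ a)%:C) (`|x| `^ a)%:C.
  apply: climit_real; apply: rlimit_powR; first by rewrite normr_gt0.
  by rewrite -normcC; apply: climit_normc; exact: climit_line.
have y_gt0 : \forall y \near (0 : R)^'+, 0 < y by exact: nbhs_right_gt.
have [theta tE tL] : exists2 theta : R, cpow_i0 x a = (`|x| `^ a)%:C * cexpi (a * theta) &
    rlimit (0 : R)^'+ (fun y => carg (x +i* y)) theta.
  move: x0; rewrite neq_lt => /orP[x0|x0].
    exists pi.
      by rewrite /cpow_i0 leNgt x0/= ltr0_norm// mulrC [pi * a]mulrC.
    have h := rlimit_atan_line (- x).
    have h' : rlimit (0 : R)^'+ (fun y => pi - atan (y / - x)) pi.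
      by rlimit_tac; rewrite subr0.
    by apply: rlimit_near h'; apply: filterS y_gt0 => y y0; rewrite carg_neg.
  exists 0.
    by rewrite /cpow_i0 ltW// gtr0_norm// mulr0 /cexpi cos0 sin0 mulr1.
  apply: rlimit_near (rlimit_atan_line x).
  by apply: filterS y_gt0 => y y0; rewrite carg_pos.
have aL : rlimit (0 : R)^'+ (fun y => a * carg (x +i* y)) (a * theta) by rlimit_tac.
have eL := climit_cexpi FF aL.
by rewrite tE; apply: (climitM (FF := FF)) nL eL.
Qed.

Context (b : probability R R) (b_stable : is_boolean_stable alpha rho r b).

Lemma stable_boundary (x : R) : x != 0 ->
  rlimit (0 : R)^'+ (poisson b x) (stable_density alpha rho r x).
Proof.
move=> x0; have FF := at_right_proper_filter (0 : R).
have zL := @climit_line x.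
have pL := cpow_boundary (a := 1 - alpha) x0.
have L : climit (0 : R)^'+ (fun y => x +i* y +
    r%:C * cexpi (alpha * rho * pi) * cpow (x +i* y) (1 - alpha)) (stable_F alpha rho r x).
  by climit_tac.
have F0 := stable_F_neq0 alpha01 rho01 r_gt0 x0.
have h := rlimitN (FF := FF) (climit_Im (FF := FF) (climitV (FF := FF) L F0)).
apply: rlimit_near h; rewrite near_withinE; apply: nearW => y y0.
have y0' : 0 < y by exact: y0.
rewrite poissonE//; congr (- complex.Im _).
by rewrite -(b_stable (z := x +i* y) y0') /F_transform invrK.
Qed.

(** At iy the power term of F_b has modulus r y^(1 - alpha) and dominates y, so |F_b(iy)| >= (r / 2)
    y^(1 - alpha) for small y. Hence [-y, y] has mass at most 2 y / |F_b(iy)| <= (4 / r) y^alpha. *)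
Lemma stable_no_atom : b [set 0] = 0%E.
Proof.
case/andP: alpha01 => a0 a1.
have mass0 : mass b [set 0] = 0.
  apply/eqP; rewrite eq_le; apply/andP; split; last by rewrite /mass fine_ge0.
  apply/ler_addgt0Pr => e e0; rewrite add0r.
  have d0 : 0 < Num.min (r / 2) (e * r / 4).
    by rewrite lt_min !divr_gt0// mulr_gt0.
  have := rlimit_powR0 a0; move/rlimitP => /(_ _ d0) yL.
  have {}yL : \forall y \near (0 : R)^'+, `|0 - `|y| `^ alpha| < Num.min (r / 2) (e * r / 4).
    by apply: cvg_within yL.
  near (0 : R)^'+ => y.
  have y0 : 0 < y by near: y; exact: nbhs_right_gt.
  have : `|0 - `|y| `^ alpha| < Num.min (r / 2) (e * r / 4) by near: y.
  rewrite sub0r normrN (gtr0_norm y0) ger0_norm ?powR_ge0// lt_min => /andP[yr ye].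
  have yb0 : 0 < y `^ (1 - alpha) by rewrite powR_gt0.
  have yE : y = y `^ alpha * y `^ (1 - alpha).
    by rewrite -powRD ?subrKC ?powRr1 ?ltW// (gt_eqF y0) implybT.
  apply: (@le_trans _ _ (mass b `[0 - y, 0 + y]%classic)).
    by apply: le_mass => // x /= ->; rewrite in_itv/= sub0r add0r oppr_le0 ltW.
  apply: le_trans (mass_ball_le b 0 y0) _.
  have PF : poisson b 0 y <= (normc (F_transform b (0 +i* y)))^-1.
    rewrite poissonE// -normcV /F_transform invrK.
    by apply: le_trans (Im_le_normc _); rewrite -normrN ler_norm.
  have FB : y `^ (1 - alpha) * (r / 2) <= normc (F_transform b (0 +i* y)).
    have cn : normc (r%:C * cexpi (alpha * rho * pi) * cpow (0 +i* y) (1 - alpha)) =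
        r * y `^ (1 - alpha).
      rewrite normcM normcM normcC normc_cexpi mulr1 (gtr0_norm r_gt0); congr (_ * _).
      rewrite /cpow normcM normcC normc_cexpi mulr1 ger0_norm ?powR_ge0//.
      by congr (_ `^ _); rewrite /cmod /= expr0n/= add0r sqrtr_sqr gtr0_norm.
    have yn : normc (0 +i* y) = y by rewrite /= expr0n/= add0r sqrtr_sqr gtr0_norm.
    have := normcB (F_transform b (0 +i* y)) (0 +i* y).
    have := normcD (F_transform b (0 +i* y)) (- (0 +i* y)).
    rewrite {1}(b_stable (z := 0 +i* y) y0) addrAC subrr add0r cn normcNr yn.
    move: (normc _) => N h _.
    have : y <= y `^ (1 - alpha) * (r / 2).
      by rewrite {1}yE mulrC ler_pM2l// ltW.
    lra.
  have FB0 : 0 < y `^ (1 - alpha) * (r / 2) by rewrite mulr_gt0// divr_gt0.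
  have P1 : poisson b 0 y <= (y `^ (1 - alpha) * (r / 2))^-1.
    by apply: le_trans PF _; rewrite lef_pV2// posrE// (lt_le_trans FB0).
  apply: (@le_trans _ _ (2 * y * (y `^ (1 - alpha) * (r / 2))^-1)).
    by rewrite ler_pM2l// mulr_gt0.
  have -> : 2 * y * (y `^ (1 - alpha) * (r / 2))^-1 = y `^ alpha * 4 / r.
    by rewrite {1}yE; field; rewrite !gt_eqF.
  by rewrite ler_pdivrMr//; lra.
by rewrite -massE// mass0.
Unshelve. all: by end_near. Qed.

End StableBoundaryValues.

Section ExponentialOfStable.
Context {R : realType} (alpha rho r : R).
Hypotheses (alpha01 : 0 < alpha < 1) (rho01 : 0 <= rho <= 1) (r_gt0 : 0 < r).
Context (b m : probability R R) (b_stable : is_boolean_stable alpha rho r b).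
Hypothesis mE : forall A : set R, measurable A -> m A = b (expR @^-1` A).

(** This is the inversion theorem with phi = ln, whose derivative 1 / v explains the denominator.
    The boundary values are bounded since ln [p, q] is compact and avoids 0. *)
Lemma exp_law_density (p c d q : R) : 0 < p -> p < c -> c < d -> d < q -> 1 < p \/ q < 1 ->
  is_density_on m `[c, d] (fun v => stable_density alpha rho r (ln v) / (pi * v)).
Proof.
move=> p0 pc cd dq pq1.
have pq : p < q by lra.
have q0 : 0 < q by exact: lt_trans pq.
have lpq : ln p <= ln q by rewrite ler_ln ?posrE// ltW.
have L0 (x : R) : ln p <= x <= ln q -> x != 0.
  move=> /andP[px xq]; case: pq1 => h.
    by rewrite gt_eqF// (lt_le_trans _ px)// ln_gt0.
  by rewrite lt_eqF// (le_lt_trans xq)// ln_lt0// q0.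
have [w _ wM] : exists2 w : R, w \in `[ln p, ln q] & forall x, x \in `[ln p, ln q] ->
    stable_density alpha rho r x <= stable_density alpha rho r w.
  apply: EVT_max => //; apply: continuous_in_subspaceT => x; rewrite inE/= in_itv/= => /L0 x0.
  by apply/continuous_rlimit; exact: stable_density_continuous.
have -> : (fun v : R => stable_density alpha rho r (ln v) / (pi * v)) =
    (fun v => stable_density alpha rho r (ln v) * v^-1 / pi).
  by apply/funext => v; rewrite invfM mulrA mulrAC.
apply: (@stieltjes_inversion R b m (@ln R) (fun v => v^-1) p q _ _ _ _ (ln p) (ln q)
  (stable_density alpha rho r w) (stable_density alpha rho r)) => //.
- by move=> v /andP[pv _]; apply: is_derive1_ln; exact: lt_trans pv.
- move=> v /andP[pv _]; apply/continuous_rlimit; have v0 : 0 < v by exact: lt_trans pv.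
  have i := @rlimit_id R v; have FF := nbhs_filter v.
  by rlimit_tac; rewrite ?gt_eqF.
- by move=> v /andP[pv _]; rewrite invr_gt0; exact: lt_trans pv.
- move=> v v' pv vv' _; have v0 : 0 < v by exact: lt_trans pv.
  by rewrite ltr_ln ?posrE//; exact: lt_trans vv'.
- move=> v /andP[pv vq]; have v0 : 0 < v by exact: lt_trans pv.
  by rewrite !ltr_ln ?posrE// pv vq.
- move=> x /andP[px xq]; apply: stable_boundary => //.
  by apply: L0; rewrite !ltW.
- by move=> x /andP[px xq]; apply: wM; rewrite in_itv/= !ltW.
- move=> c' d' pc' c'd' d'q; rewrite mE//; congr (b _).
  have c0 : 0 < c' by exact: lt_trans pc'.
  have d0 : 0 < d' by exact: lt_trans c'd'.
  by apply/seteqP; split => x /=; rewrite !in_itv/= -[X in X < expR x](lnK c0)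
    -[X in expR x < X](lnK d0) !ltr_expR.
Qed.

Lemma exp_law_support : m (`]0, 1[%classic `|` `]1, +oo[%classic) = 1%E.
Proof.
rewrite mE; last exact: measurableU.
have -> : expR @^-1` (`]0, 1[%classic `|` `]1, +oo[%classic) = ~` [set (0 : R)].
  apply/seteqP; split => x /=; rewrite !in_itv/= expR_gt0/= andbT.
    by move=> h x0; move: h; rewrite x0 expR0 ltxx => -[].
  move=> /eqP; rewrite neq_lt => /orP[x0|x0]; [left|right].
    by rewrite expR_lt1.
  by rewrite expR_gt1.
by rewrite probability_setC// (stable_no_atom alpha01 r_gt0 b_stable) sube0.
Qed.
End ExponentialOfStable.

(** * Weak convergence *)

Section WeakConvergence.
Context {R : realType}.
Local Notation lam := (@lebesgue_measure R).

Lemma is_density_onU (m : probability R R) (D E : set R) (f : R -> R) :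
  measurable D -> measurable E -> D `&` E = set0 ->
  is_density_on m D f -> is_density_on m E f -> is_density_on m (D `|` E) f.
Proof.
move=> mD mE DE [fD f0D DP] [fE f0E EP]; split.
- exact/measurable_funU.
- by move=> x [/f0D|/f0E].
move=> A mA ADE.
have AE : A = (A `&` D) `|` (A `&` E) by rewrite -setIUr; apply/esym/setIidPl.
have mAD : measurable (A `&` D) by exact: measurableI.
have mAE : measurable (A `&` E) by exact: measurableI.
have disj : (A `&` D) `&` (A `&` E) = set0 by rewrite setIACA setIid DE setI0.
transitivity (m (A `&` D) + m (A `&` E))%E; first by rewrite {1}AE; exact: measureU.
rewrite (DP _ mAD (@subIsetr _ _ _)) (EP _ mAE (@subIsetr _ _ _)).
rewrite [in RHS]AE ge0_integral_setU//.
- apply/measurable_funU => //; split; apply/measurable_EFinP.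
    exact: measurable_funS fD.
  exact: measurable_funS fE.
- by move=> x [[_ /f0D]|[_ /f0E]]; rewrite lee_fin.
- by apply/disj_setPS; rewrite disj.
Qed.

Lemma density_measure_le (m m' : probability R R) (D A : set R) (f g : R -> R) (e : R) :
  measurable D -> is_density_on m D f -> is_density_on m' D g -> 0 <= e ->
  (forall x, D x -> f x <= g x + e) -> measurable A ->
  (m (A `&` D) <= m' (A `&` D) + e%:E * lam (A `&` D))%E.
Proof.
move=> mD [mf f0 fE] [mg g0 gE] e0 fg mA.
have mAD : measurable (A `&` D) by exact: measurableI.
have sub := @subIsetr _ A D.
rewrite fE// gE// -integral_cst// -ge0_integralD//.
- apply: ge0_le_integral => //.
  + by move=> x [_ /f0]; rewrite lee_fin.
  + by apply/measurable_EFinP; exact: measurable_funS mf.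
  + apply/measurable_EFinP; apply: (@measurable_funS _ _ _ _ D) => //.
    exact: measurable_funD.
  + by move=> x [_ Dx]; rewrite lee_fin; exact: fg.
- by move=> x [_ /g0]; rewrite lee_fin.
- by apply/measurable_EFinP; exact: measurable_funS mg.
Qed.

(** The comparison is made on sets rather than on densities, so that a single error measure [eta]
    can hold both a density error on a set and the whole mass off it. *)
Lemma Rintegral_le_measure (m m' : probability R R) (eta : {measure set R -> \bar R})
    (u : R -> R) (M e : R) :
  (forall A, measurable A -> (m A <= m' A + eta A)%E) -> (eta setT <= e%:E)%E ->
  measurable_fun setT u -> (forall x, 0 <= u x <= M) ->
  (\int[m]_x u x)%R <= (\int[m']_x u x)%R + M * e.
Proof.
move=> mm' etaT mu u0M.
have u0 x : (0 <= (u x)%:E)%E by rewrite lee_fin; case/andP: (u0M x).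
have mu' : measurable_fun setT (EFin \o u) by exact/measurable_EFinP.
have M0 : 0 <= M by case/andP: (u0M 0) => h; exact: le_trans.
have uM x : `|u x| <= M by case/andP: (u0M x) => h1 h2; rewrite ger0_norm.
have iu := bounded_integrable m mu uM.
have iu' := bounded_integrable m' mu uM.
have h : (\int[m]_x (u x)%:E <= \int[m']_x (u x)%:E + (M * e)%:E)%E.
  apply: (@le_trans _ _ (\int[measure_add m' eta]_x (u x)%:E)%E).
    apply: ge0_le_measure_integral => // A mA.
    by apply: le_trans (mm' _ mA) _; rewrite -measure_addE.
  rewrite ge0_integral_measure_add//; apply: leeD => //.
  apply: (@le_trans _ _ (\int[eta]_x (cst M%:E) x)%E).
    apply: ge0_le_integral => // x _; rewrite lee_fin; by case/andP: (u0M x).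
  by rewrite integral_cst// EFinM; apply: lee_wpmul2l => //; rewrite lee_fin.
rewrite -lee_fin EFinD /Rintegral !fineK//.
- exact: integrable_fin_num iu'.
- exact: integrable_fin_num iu.
Qed.

(** The argument is of Scheffe type. No tightness of [m_] is assumed: on D n the lower bound on
    densities makes m at most [m_ t] up to a small error, and off D n the measure m itself is
    small. *)
Lemma weakly_cvg_densities (F : set_system R) (FF : Filter F) (m_ : R -> probability R R)
    (m : probability R R) (f : R -> R -> R) (g : R -> R) (D : nat -> set R) :
  (forall n, measurable (D n)) -> (forall n, (lam (D n) < +oo)%E) ->
  {homo D : n k / (n <= k)%N >-> n `<=` k} -> m (\bigcup_n D n) = 1%E ->
  (forall n, \forall t \near F, is_density_on (m_ t) (D n) (f t)) ->
  (forall n, is_density_on m (D n) g) ->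
  (forall n (e : R), 0 < e -> \forall t \near F, forall x, D n x -> g x <= f t x + e) ->
  weakly_cvg F m_ m.
Proof.
move=> mD Dfin Dinc Dm Df Dg fg h hc hb.
have [M M0 hM] : exists2 M : R, 0 <= M & forall x, `|h x| <= M.
  case: hb => M [_ hM]; exists (Num.max M 0 + 1).
    by rewrite addr_ge0// le_max lexx orbT.
  by move=> x; apply: hM => //; rewrite (@le_lt_trans _ _ (Num.max M 0)) ?ltrDl// le_max lexx.
have mh : measurable_fun setT h by exact: continuous_measurable_fun.
apply/cvgrPdist_lt => e e0.
(* The final error is 2 M (2 d) = e 4 M / (4 M + 1), which is less than e even for M = 0. *)
pose d := e / (4 * M + 1).
have M1 : 0 < 4 * M + 1 by rewrite ltr_wpDl// mulr_ge0.
have d0 : 0 < d by rewrite divr_gt0.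
have [n nd] : exists n, (m (~` D n) <= d%:E)%E.
  have cv : (m \o D) n @[n --> \oo] --> m (\bigcup_n D n).
    apply: nondecreasing_cvg_mu => //; first exact: bigcup_measurable.
    by move=> i j ij; apply/subsetPset; exact: Dinc.
  rewrite Dm in cv.
  have cv' : fine (m (D n)) @[n --> \oo] --> (1 : R) by exact: (fine_cvg cv).
  move/cvgrPdist_lt : cv' => /(_ _ d0) [n _ /(_ n (leqnn n))] /= nd; exists n.
  rewrite probability_setC// -(massE m (mD n)) -EFinB lee_fin.
  by move: nd; rewrite ltr_norml => /andP[_]; rewrite /mass; lra.
pose L := fine (lam (D n)).
have L0 : 0 <= L by rewrite fine_ge0// measure_ge0.
have LE : L%:E = lam (D n) by rewrite /L fineK// ge0_fin_numE// Dfin.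
pose d' := d / (L + 1).
have d'0 : 0 < d' by rewrite divr_gt0// ltr_wpDl.
have d'L : d' * L <= d.
  rewrite /d' mulrAC ler_pdivrMr ?ltr_wpDl// ler_pM2l//; lra.
have mDc : measurable (~` D n) by exact: measurableC.
have key : \forall t \near F, forall u : R -> R, measurable_fun setT u ->
    (forall x, 0 <= u x <= 2 * M) ->
    (\int[m]_x u x)%R <= (\int[m_ t]_x u x)%R + 2 * M * (2 * d).
  move: (Df n) (fg n _ d'0); apply: filterS2 => t dft gft u mu u0M.
  pose w x := (d' * \1_(D n) x)%:E.
  have mw : measurable_fun setT w.
    by apply/measurable_EFinP; apply: measurable_funM => //; exact: measurable_indic.
  have w0 x : (0 <= w x)%E by rewrite lee_fin mulr_ge0// ltW.
  have wE A : measurable A -> density_measure mw w0 A = (d'%:E * lam (A `&` D n))%E.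
    move=> mA; rewrite /density_measure /w; under eq_integral do rewrite EFinM.
    rewrite ge0_integralZl_EFin ?(ltW d'0)//.
    - rewrite integral_indic//; [by rewrite setIC|exact: mD].
    - apply/measurable_EFinP; apply: measurable_indic; exact: mD.
  (* The first summand accounts for the density error d' on D n, the second for the mass of m
     outside D n; each has total mass at most d. *)
  pose eta := measure_add (density_measure mw w0) (mrestr m mDc).
  have etaE A : measurable A -> eta A = (d'%:E * lam (A `&` D n) + m (A `&` ~` D n))%E.
    by move=> mA; rewrite -wE//; exact: measure_addE.
  apply: (@Rintegral_le_measure m (m_ t) eta) => //.
    move=> A mA; suff : (m A <= m_ t A + (d'%:E * lam (A `&` D n) + m (A `&` ~` D n)))%E.
      by rewrite -etaE.
    have AE : A = (A `&` D n) `|` (A `&` ~` D n) by rewrite -setIUr setUv setIT.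
    apply: (@le_trans _ _ (m (A `&` D n) + m (A `&` ~` D n))%E).
      by rewrite {1}AE; apply: measureU2; exact: measurableI.
    rewrite addeA; apply: leeD => //.
    apply: le_trans (density_measure_le (mD n) (Dg n) dft (ltW d'0) gft mA) _.
    apply: leeD => //; apply: le_measure; rewrite ?inE//; exact: measurableI.
  suff : (d'%:E * lam (D n) + m (~` D n) <= (2 * d)%:E)%E.
    by rewrite -{1}(setTI (D n)) -{1}(setTI (~` D n)) -etaE.
  rewrite mulr_natl mulr2n EFinD; apply: leeD => //.
  by rewrite -LE -EFinM lee_fin.
have int_h (nu : probability R R) : nu.-integrable setT (EFin \o h).
  exact: bounded_integrable mh hM.
have int_M (nu : probability R R) : nu.-integrable setT (EFin \o (fun=> M)).
  by apply: (@bounded_integrable _ _ _ M) => // x; rewrite ger0_norm.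
have addM (nu : probability R R) : (\int[nu]_x (h x + M) = \int[nu]_x h x + M)%R.
  have e1 := Rintegral_prob_cst nu M.
  by rewrite RintegralD ?e1; [by []|by []|exact: int_h|exact: int_M].
have subM (nu : probability R R) : (\int[nu]_x (M - h x) = M - \int[nu]_x h x)%R.
  have e1 := Rintegral_prob_cst nu M.
  by rewrite RintegralB ?e1; [by []|by []|exact: int_M|exact: int_h].
have small : 2 * M * (2 * d) < e.
  have -> : 2 * M * (2 * d) = e * (4 * M / (4 * M + 1)) by rewrite /d; ring.
  by rewrite gtr_pMr// ltr_pdivrMr// mul1r ltrDl.
apply: filterS key => t key.
(* The one-sided estimate for these two nonnegative test functions yields both inequalities for
   h. *)
have h1 := key (fun x => h x + M) _ _; rewrite !addM in h1.
have h2 := key (fun x => M - h x) _ _; rewrite !subM in h2.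
have b1 x : 0 <= h x + M <= 2 * M.
  by have := hM x; rewrite ler_norml => /andP[? ?]; apply/andP; split; lra.
have b2 x : 0 <= M - h x <= 2 * M.
  by have := hM x; rewrite ler_norml => /andP[? ?]; apply/andP; split; lra.
have {}h1 := h1 (measurable_funD mh (measurable_cst _)) b1.
have {}h2 := h2 (measurable_funB (measurable_cst _) mh) b2.
by rewrite ltr_norml; apply/andP; split; lra.
Qed.

End WeakConvergence.

Theorem theorem5p5 (R : realType) (mu : probability R R)
    (mu_ : R -> probability R R) (I : set R) (alpha rho r : R)
    (mu_nonneg : on_nonneg mu)
    (mu_power : forall t, 0 <= t <= 1 -> is_mult_boolean_power mu t (mu_ t))
    (I_open : open I) (I_itv : is_interval I) (I_pos : I `<=` `]0, +oo[)
    (I1 : I 1)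
    (F_cvg : forall x, I x ->
       cvg (F_transform mu (x +i* y) @[y --> 0^'+]) /\
       0 <= complex.Im (F_boundary mu x))
    (F_cont : {for (1 : R), continuous (F_boundary mu)})
    (alpha01 : 0 < alpha < 1) (rho01 : 0 <= rho <= 1) (r_gt0 : 0 < r)
    (F_expansion :
       (fun x : R => F_boundary mu x -
          r%:C * cexpi (alpha * rho * pi) * cpow_i0 (x - 1) (1 - alpha))
       =o_ ((1 : R)^') (fun x : R => (`|x - 1| `^ (1 - alpha))%:C)) :
  (exists f : R -> R -> R,
     (forall K : set R, compact K -> K `<=` `]1, +oo[ ->
        (\forall t \near 0^'+,
           is_density_on (power_law (mu_ t) (t `^ (- alpha^-1))) K (f t)) /\
        {uniform K, f @ 0^'+ -->
           (fun x => r * sin (alpha * rho * pi) / (pi * x) *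
              ((ln x) `^ (alpha - 1) /
               ((ln x) `^ (2 * alpha) +
                2 * r * cos (alpha * rho * pi) * (ln x) `^ alpha +
                r ^+ 2)))}) /\
     (forall K : set R, compact K -> K `<=` `]0, 1[ ->
        (\forall t \near 0^'+,
           is_density_on (power_law (mu_ t) (t `^ (- alpha^-1))) K (f t)) /\
        {uniform K, f @ 0^'+ -->
           (fun x => r * sin (alpha * (1 - rho) * pi) / (pi * x) *
              ((- ln x) `^ (alpha - 1) /
               ((- ln x) `^ (2 * alpha) +
                2 * r * cos (alpha * (1 - rho) * pi) * (- ln x) `^ alpha +
                r ^+ 2)))})) /\
  (forall (d : measure_display) (T : measurableType d) (P : probability T R)
      (B : {RV P >-> R}),
     is_boolean_stable alpha rho r (distribution P B) ->
     weakly_cvg 0^'+ (fun t => power_law (mu_ t) (t `^ (- alpha^-1)))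
       (distribution P (expR \o B))).

Proof.
have I_cvg x : I x -> cvg (F_transform mu (x +i* y) @[y --> 0^'+]) by case/F_cvg.
have [a0 a1] := andP alpha01.
pose g := fun v : R => stable_density alpha rho r (ln v) / (pi * v).
have K1 (K : set R) : K `<=` `]1, +oo[%classic -> forall v, K v -> 0 < v /\ v != 1.
  move=> KJ v /KJ; rewrite /= in_itv/= andbT => v1.
  by rewrite (lt_trans ltr01 v1) gt_eqF.
have K0 (K : set R) : K `<=` `]0, 1[%classic -> forall v, K v -> 0 < v /\ v != 1.
  by move=> KJ v /KJ; rewrite /= in_itv/= => /andP[v0 v1]; rewrite v0 lt_eqF.
have dens_itv := power_law_density_itv mu_nonneg mu_power I_open I1 I_cvg alpha01 rho01 r_gt0
  F_expansion.
have dens1 (K : set R) : compact K -> K `<=` `]1, +oo[%classic -> \forall t \near 0^'+,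
    is_density_on (power_law (mu_ t) (t `^ (- alpha^-1))) K (power_density mu alpha t).
  move=> cK /(compact_gt1 cK)[p [c [d [q [p1 pc cd dq Kcd]]]]].
  have := dens_itv p c d q (lt_trans ltr01 p1) pc cd dq (or_introl p1).
  by apply: filterS => t; apply: is_density_onS.
have dens0 (K : set R) : compact K -> K `<=` `]0, 1[%classic -> \forall t \near 0^'+,
    is_density_on (power_law (mu_ t) (t `^ (- alpha^-1))) K (power_density mu alpha t).
  move=> cK /(compact_lt1 cK)[p [c [d [q [p0 pc cd dq [q1 Kcd]]]]]].
  have := dens_itv p c d q p0 pc cd dq (or_intror q1).
  by apply: filterS => t; apply: is_density_onS.
have unif K h := @power_density_uniform R mu I alpha rho r I_open I1 alpha01 rho01 r_gt0
  F_expansion K h.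
split.
  exists (power_density mu alpha); split => K cK KJ; split; [exact: dens1| |exact: dens0|].
    apply: unif => //; first exact: K1.
    move=> v /KJ; rewrite /= in_itv/= andbT => v1.
    have [_] := stable_F_pos alpha01 rho01 r_gt0 (ln_gt0 v1).
    rewrite /stable_density => ->; rewrite !invfM; ring.
  apply: unif => //; first exact: K0.
  move=> v /KJ; rewrite /= in_itv/= => v01.
  have [_] := stable_F_neg alpha01 rho01 r_gt0 (ln_lt0 v01).
  rewrite /stable_density => ->; rewrite !invfM; ring.
move=> d T P B b_stable.
have mE (A : set R) : measurable A ->
    distribution P (expR \o B) A = distribution P B (expR @^-1` A) by [].
have exp_dens := exp_law_density alpha01 rho01 r_gt0 b_stable mE.
(* Each set of the exhaustion has one segment on either side of 1, where the uniform estimates are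
   available; the limit law gives no mass to 1 or to ]-oo, 0]. *)
apply: (weakly_cvg_densities (at_right_proper_filter (0 : R)) (f := power_density mu alpha)
  (g := g) (D := exhaustion)).
- exact: measurable_exhaustion.
- exact: exhaustion_fin.
- exact: exhaustion_incr.
- have supp := exp_law_support alpha01 r_gt0 b_stable mE.
  by rewrite bigcup_exhaustion; exact supp.
- move=> n; have c0 := @segment_compact R n.+4%:R^-1 (1 - n.+4%:R^-1).
  have c1 := @segment_compact R (1 + n.+4%:R^-1) n.+4%:R.
  have := dens1 _ c1 (@exhaustion_gt1 R n).
  have := dens0 _ c0 (@exhaustion_lt1 R n).
  apply: filterS2 => t h0 h1; apply: is_density_onU => //.
  exact: exhaustion_disjoint.
- move=> n; apply: is_density_onU => //; first exact: exhaustion_disjoint.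
    have [p [c [d' [q [p0 pc cd dq [q1 Kcd]]]]]] :=
      compact_lt1 (@segment_compact R _ _) (@exhaustion_lt1 R n).
    apply: is_density_onS Kcd _; first exact: measurable_itv.
    by apply: exp_dens pc cd dq _; [|right].
  have [p [c [d' [q [p1 pc cd dq Kcd]]]]] :=
    compact_gt1 (@segment_compact R _ _) (@exhaustion_gt1 R n).
  apply: is_density_onS Kcd _; first exact: measurable_itv.
  by apply: exp_dens pc cd dq _; [exact: lt_trans p1|left].
- move=> n e e0.
  have nearK K := @power_density_near R mu I alpha rho r I_open I1 alpha01 rho01 r_gt0
    F_expansion K e.
  have h0 := nearK _ (@segment_compact R _ _) (K0 _ (@exhaustion_lt1 R n)) e0.
  have h1 := nearK _ (@segment_compact R _ _) (K1 _ (@exhaustion_gt1 R n)) e0.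
  apply: filterS2 h0 h1 => t h0 h1 x.
  have gle : `|g x - power_density mu alpha t x| < e -> g x <= power_density mu alpha t x + e.
    by rewrite ltr_norml => /andP[_ h]; rewrite -lerBlDl ltW.
  by move=> [/h0|/h1]; exact: gle.
Qed.
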